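(* The Chop Chop protocol (described in the context) satisfies validity: in every execution, if a correct client $\chi$ broadcasts a message $m$, then eventually a correct server delivers $m$ from $\chi$.
   Context: MODEL. Asynchronous message passing over authenticated reliable point-to-point links between clients, brokers, and $3f+1$ servers (a fixed known set). At most $f$ servers are Byzantine; any number of clients and brokers may be Byzantine, but at least one broker is correct. Cryptography is ideal: signatures and multi-signatures are unforgeable; multi-signatures of several processes on the same statement can be aggregated and verified; Merkle roots are collision-resistant, with proofs of inclusion. A directory $dir$ gives each client a unique integer identifier $id$, together with a transferable certified assignment ($id\leftrightarrow$ client) that anyone can import. Servers have access to a Server Total Order Broadcast (STOB) satisfying: no duplication (no message broadcast by a correct server is delivered more than once by a correct server), integrity (a delivered message was broadcast by some server), validity (a message broadcast by a correct server is eventually delivered by a correct server), agreement (a message delivered by one correct server is eventually delivered by all correct servers), total order (for different $m,m'$: if a correct server delivers $m$ without having delivered $m'$, no correct server delivers $m'$ before $m$). A statement is *certified* if it carries multi-signatures of $f+1$ distinct servers. An *evidence* with number $n$ is a certified statement $[\mathrm{Completion},r,n]$. INTERFACE. Clients trigger $\mathrm{Broadcast}(m)$; servers trigger $\mathrm{Deliver}(\chi,m)$. Correct clients obey: (CR1) a new message is broadcast only after receiving the completion certificate of the previous one; (CR2) the same message is never broadcast twice in a row. Correct brokers obey: (BR1) a new batch is sent to the servers only once the previously sent one has been delivered by STOB (at the correct servers). CLIENT $\chi$ with identifier $id$. State: counter $s=0$, an evidence, and for each pending message $m$ and broker $\beta$ a set $S_{m,\beta}$ of used sequence numbers. On $\mathrm{Broadcast}(m)$: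 mark $m$ pending and submit. Submit: choose a broker $\beta$ not yet tried for $m$, send it $[\mathrm{Submission},$ assignment of $id$, $m,s,$ signature on $[\mathrm{Message},m,s]$, evidence$]$, add $s$ to $S_{m,\beta}$, and start a finite timer; when it rings and $m$ is still pending, submit again. (By definition a submission by a correct client with $s>0$ carries an evidence with number $\ge s$.) On $[\mathrm{Inclusion},m,root,proof,k,E]$ from $\beta$, where $m$ is pending and was submitted to $\beta$: if $proof$ shows that $(id,k,m)$ is a leaf under $root$, $E$ is a valid evidence, $k\le$ number of $E$, and $k\ge s$, then set $s:=k$, store $E$, add $k$ to $S_{m,\beta}$ and send $\beta$ a multi-signature on $[\mathrm{Reduction},root]$. On $[\mathrm{Completion},r,m,k,proof,n,cert]$ from $\beta$, where $cert$ certifies $[\mathrm{Completion},r,n]$: keep it as evidence if $n$ exceeds the stored number; if $m$ is pending, $k\in S_{m,\beta}$ and $proof$ shows $(id,k,m)$ is a leaf under $r$, then set $s:=s+1$ and make $m$ no longer pending (this is receiving the completion certificate). BROKER $\beta$. Batch counter starts at 1. Import the assignment in each Submission; accept it if its signature is valid and either its sequence number is $0$ or its evidence is valid with number $\ge$ its sequence number. Accepted submissions are queued per identifier and moved into a pool containing at most one submission per identifier. When a pool is nonempty a finite timer is started; when it rings, the pool is emptied into a batch: $k$ is the maximum of its sequence numbers, $root$ is the Merkle root of all leaves $(id,k,m)$, and each client is sent $[\mathrm{Inclusion},m,root,proof,k,E]$ with $E$ the submitted evidence of largest number. After another finite timer, clients in the batch that have not sent a valid multi-signature on $[\mathrm{Reduction},root]$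 are *stragglers*, keeping their original sequence number and signature. Let $r$ be the Merkle root of the leaves $(id,k',m)$, where $k'$ is the original sequence number for stragglers and $k'=k$ otherwise. The broker sends all servers $[\mathrm{Batch},num,ids,payloads,stragglers]$ (payloads are the pairs $(k,m)$; stragglers maps straggler identifiers to original sequence numbers), where $num$ is the batch counter, which is then incremented. On $[\mathrm{BatchAcquired},r,unknowns]$ from a server, it replies with $[\mathrm{Signatures},r,num,$ assignments of $unknowns$, aggregate of the multi-signatures, straggler signatures$]$. On collecting $f+1$ valid server multi-signatures on $[\mathrm{Witness},(r,\beta,num)]$ it aggregates them into a witness certificate $W$ and sends $[\mathrm{Witness},r,num,W]$ to all servers. On collecting $f+1$ valid matching completion shards (below) for the batch, it aggregates them into a certificate and sends to every client in the batch whose leaf is not $\bot$ the message $[\mathrm{Completion},r',m,k'',proof,n,cert]$, where $r'$ is the completion root and $(id,k'',m)$ the client's leaf in it. SERVER. State: $batches$ (map from keys $(root,broker,number)$ to batches); for each broker $\beta$ an expected number $e_\beta=1$ and an expected root (initially empty); FIFO queue $pool$; for each identifier $last[id]$, initially $(-1,\bot)$; delivery counter $c=1$; per-broker count $d_\beta=0$ of completed batches. (1) On $[\mathrm{Batch},num,ids,payloads,stragglers]$ from $\beta$: sort entries by identifier, compute the Merkle root $r$ of leaves $(id,k',m)$ with straggler sequence numbers substituted; if key $(r,\beta,num)\notin batches$, $num=e_\beta$, the expected root of $\beta$ is empty, identifiers are distinct and lengths match, then store the batch under the key, set the expected root to $r$, and reply $[\mathrm{BatchAcquired},r,\text{identifiers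 unknown to } dir]$. (2) On $[\mathrm{Signatures},r,num,\dots]$ from $\beta$: import the assignments; require that $r$ is the expected root of $\beta$, $num=e_\beta$, the batch is stored under $(r,\beta,num)$, and all its identifiers are known. Check that exactly the stragglers come with individual signatures, each valid on $[\mathrm{Message},m,\text{straggler number}]$, and that the aggregate multi-signature is valid for all other identifiers on $[\mathrm{Reduction},\rho]$, with $\rho$ the Merkle root of the leaves built from $ids$ and $payloads$ (without straggler substitution). If so, send $\beta$ a multi-signature on $[\mathrm{Witness},(r,\beta,num)]$. (3) On $[\mathrm{Witness},r,num,W]$ from $\beta$ with $r$ the expected root, $num=e_\beta$ and $W$ certifying $[\mathrm{Witness},(r,\beta,num)]$: STOB-broadcast $(\beta,r,W)$. (4) On STOB-delivery of $(\beta,r,W)$: let $key=(r,\beta,e_\beta)$; ignore unless $W$ certifies $[\mathrm{Witness},key]$. Otherwise increment $e_\beta$; if the expected root of $\beta$ is not $r$, send $[\mathrm{RequestBatch},key]$ to all servers; push $key$ into $pool$; remove $r$ from the expected root of $\beta$. (5) On $[\mathrm{RequestBatch},key]$ with $key\in batches$: reply with the stored batch and its assignments. On receiving such a reply for $key\in pool$, $key\notin batches$: import the assignments, sort by identifier, recompute the root (with straggler substitution) and store the batch under $key$ if all identifiers are known and the root equals that of $key$. (6) When the head $key=(r,\beta,num)$ of $pool$ is in $batches$: pop it and complete the batch. For each identifier in sorted order, with message $m$ and sequence number $q$ (straggler number if a straggler, payload number otherwise) and $last[id]=(q',m')$: if $q<q'$, the completion leaf is $\bot$; else if $m=m'$,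 the leaf is $(id,q',m')$; else if $q>q'$ and $m\ne m'$, set $last[id]:=(q,m)$, leaf $(id,q,m)$, and trigger $\mathrm{Deliver}(dir[id],m)$; otherwise nothing is delivered (leaf $\bot$). Send $\beta$ a completion shard: a multi-signature on $[\mathrm{Completion},\text{Merkle root of the completion leaves},c]$ together with the list of identifiers whose leaf differs from the submitted one. Then increment $c$ and $d_\beta$ and send $[\mathrm{Collection},key]$ to all servers. (7) On $[\mathrm{Collection},(r,\beta,num)]$ with $num\le d_\beta$: reply $[\mathrm{CollectionAccept},key]$. A server that has completed $key$ and received $[\mathrm{CollectionAccept},key]$ from all $3f+1$ servers deletes $key$ from $batches$.
   Formalization: In server rule (4), on STOB-delivery of a batch of β the expected root of β is always reset to empty, even when it differs from r; if only r were removed, Byzantine brokers could leave every correct server stuck when f ≥ 1. *)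

(* Defs.v *)
From HB Require Import structures.
From Stdlib Require List.
Set Warnings "-notation-overridden,-redundant-canonical-projection".
From mathcomp Require Import all_boot.

Set Implicit Arguments.
Unset Strict Implicit.
Unset Printing Implicit Defensive.

Definition upd (A : eqType) (B : Type) (g : A -> B) (a : A) (b : B) : A -> B :=
  fun x => if x == a then b else g x.

(* Finite maps with numeric keys, as association lists. *)
Definition lookup (T : Type) (i : nat) (s : seq (nat * T)) : option T :=
  omap snd (ohead [seq x <- s | x.1 == i]).

(* An ideal Merkle tree over sequences of T.  Nothing is assumed about the
   verification of proofs against a value that is the root of no sequence. *)
Record merkle (T : eqType) := Merkle {
  root_of : eqType;
  proof_of : Type;
  mroot : seq T -> root_of;
  mprove : seq T -> T -> proof_of;
  mverify : root_of -> T -> proof_of -> bool;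
  mroot_inj : injective mroot;
  mprove_complete : forall s x, x \in s -> mverify (mroot s) x (mprove s x);
  mverify_sound : forall s x pf, mverify (mroot s) x pf -> x \in s }.

Section ChopChop.

Variables (f : nat) (Server Broker : finType) (Client Msg : eqType).

(* A leaf is Some (identifier, sequence number, message), or None for the
   leaf "bottom" of a completion tree. *)
Definition leaf : eqType := option (nat * nat * Msg)%type.

Variable MT : merkle leaf.

(* [ident] is the directory. *)
Variable ident : Client -> nat.

Inductive process :=
| PClient of Client
| PBroker of Broker
| PServer of Server.

Variable correct : process -> bool.

(* The assignments that each process knows at the start. *)
Variable dir0 : process -> nat -> option Client.

Notation Root := (root_of MT).
Notation Inclusion := (proof_of MT).
Notation root_from := (mroot MT).

Definition key : eqType := (Root * Broker * nat)%type.

(* Signatures and multi-signatures are symbolic terms that name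
    their signers and the signed statement; forging is excluded below by the
    condition [unforgeable] on executions. *)

Inductive stmt :=
| StMessage of Msg & nat
| StReduction of Root
| StWitness of key
| StCompletion of Root & nat.

Definition stmt_code (s : stmt) : ((Msg * nat) + Root) + (key + (Root * nat)) :=
  match s with
  | StMessage m n => inl (inl (m, n))
  | StReduction r => inl (inr r)
  | StWitness k => inr (inl k)
  | StCompletion r n => inr (inr (r, n))
  end.

Definition stmt_decode (c : ((Msg * nat) + Root) + (key + (Root * nat))) : stmt :=
  match c with
  | inl (inl (m, n)) => StMessage m n
  | inl (inr r) => StReduction r
  | inr (inl k) => StWitness k
  | inr (inr (r, n)) => StCompletion r n
  end.

Lemma stmt_codeK : cancel stmt_code stmt_decode.
Proof. by case. Qed.

HB.instance Definition _ := Equality.copy stmt (can_type stmt_codeK).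

Definition client_sig : eqType := (Client * stmt)%type.
Definition server_sig : eqType := (Server * stmt)%type.

(* An aggregate of multi-signatures of servers on one statement. *)
Record cert := Cert { cert_stmt : stmt; cert_signers : {set Server} }.

Definition certifies (W : cert) (s : stmt) : bool :=
  (cert_stmt W == s) && (f < #|cert_signers W|).

(* The number of an evidence; None if there is no evidence, or an invalid one. *)
Definition evidence_number (E : option cert) : option nat :=
  if E is Some (Cert (StCompletion _ n) A) then
    if f < #|A| then Some n else None
  else None.

Definition evidence_covers (E : option cert) (k : nat) : bool :=
  if evidence_number E is Some n then k <= n else false.

(* Certified assignments cannot be forged: (i, chi) verifies only if the
   directory gives the identifier i to chi. *)
Definition assignment := (nat * Client)%type.

Definition import (d : nat -> option Client) (asg : seq assignment) :=
  foldl (fun d (a : assignment) =>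
           if ident a.2 == a.1 then upd d a.1 (Some a.2) else d) d asg.

Definition export (d : nat -> option Client) (js : seq nat) : seq assignment :=
  pmap (fun i => omap (pair i) (d i)) js.

Record batch := Batch {
  ids : seq nat;
  payloads : seq (nat * Msg);
  stragglers : seq (nat * nat) }.

(* (identifier, (payload number, message)), sorted by identifier *)
Definition entries (b : batch) : seq (nat * (nat * Msg)) :=
  sort (fun x y => x.1 <= y.1) (zip (ids b) (payloads b)).

Definition is_straggler (b : batch) (i : nat) : bool :=
  i \in [seq x.1 | x <- stragglers b].

(* The entries (id, k', m), with straggler numbers substituted. *)
Definition numbered (b : batch) : seq (nat * nat * Msg) :=
  [seq (e.1, odflt e.2.1 (lookup e.1 (stragglers b)), e.2.2) | e <- entries b].

Definition batch_root (b : batch) : Root := root_from (map Some (numbered b)).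

Definition reduction_leaves (b : batch) : seq leaf :=
  [seq Some (e.1, e.2.1, e.2.2) | e <- entries b].

Definition reduction_root (b : batch) : Root := root_from (reduction_leaves b).

Inductive message :=
| MSubmission of assignment & Msg & nat & client_sig & option cert
| MInclusion of Msg & Root & Inclusion & nat & option cert
| MReduction of client_sig
| MBatch of nat & batch
| MBatchAcquired of Root & seq nat
| MSignatures of Root & nat & seq assignment & stmt * seq Client
               & seq (nat * client_sig)
| MWitnessShard of server_sig
| MWitness of Root & nat & cert
| MRequestBatch of key
| MBatchReply of key & batch & seq assignment
| MCompletionShard of key & server_sig & seq (nat * leaf)
| MCompletion of Root & Msg & nat & Inclusion & nat & cert
| MCollection of key
| MCollectionAccept of key.

Definition stob_message := (Broker * Root * cert)%type.

Record effects := Effects {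
  sends : seq (process * message);
  stobs : seq stob_message;
  delivers : seq (Client * Msg);
  signs : seq stmt }.

Definition no_effect := Effects [::] [::] [::] [::].
Definition only_send l := Effects l [::] [::] [::].

Definition to_servers (msg : message) : seq (process * message) :=
  [seq (PServer p, msg) | p <- enum Server].

(* A correct client broadcasts a new message only when the previous one is
   completed, so at most one message is pending.  [c_tried] and [c_used] belong to
   the pending message: the pair (beta, k) is in [c_used] iff k is in the set
   S_{m,beta} of the pending message m.  [c_last] is the last broadcast message. *)
Record client_state := ClientState {
  c_seq : nat;
  c_evidence : option cert;
  c_pending : option Msg;
  c_tried : {set Broker};
  c_used : seq (Broker * nat);
  c_last : option Msg }.

Definition client0 := ClientState 0 None None set0 [::] None.

Definition client_submit (chi : Client) (st : client_state) (beta : Broker) :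
    client_state * effects :=
  if c_pending st is Some m then
    let s := c_seq st in
    let st' := ClientState s (c_evidence st) (Some m) (beta |: c_tried st)
                 ((beta, s) :: c_used st) (c_last st) in
    let msg := MSubmission (ident chi, chi) m s (chi, StMessage m s)
                 (c_evidence st) in
    (st', Effects [:: (PBroker beta, msg)] [::] [::] [:: StMessage m s])
  else (st, no_effect).

Definition client_broadcast (chi : Client) (st : client_state) (m : Msg)
    (beta : Broker) : client_state * effects :=
  client_submit chi
    (ClientState (c_seq st) (c_evidence st) (Some m) set0 [::] (Some m)) beta.

Definition client_inclusion (chi : Client) (st : client_state) (beta : Broker)
    (m : Msg) (root : Root) (pf : Inclusion) (k : nat) (E : option cert) :
    client_state * effects :=
  if [&& c_pending st == Some m, beta \in c_tried st,
         mverify root (Some (ident chi, k, m)) pf,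
         evidence_covers E k & c_seq st <= k]
  then (ClientState k E (c_pending st) (c_tried st) ((beta, k) :: c_used st)
          (c_last st),
        Effects [:: (PBroker beta, MReduction (chi, StReduction root))] [::] [::]
          [:: StReduction root])
  else (st, no_effect).

Definition client_completion (chi : Client) (st : client_state) (beta : Broker)
    (r : Root) (m : Msg) (k : nat) (pf : Inclusion) (n : nat) (W : cert) :
    client_state * effects :=
  if certifies W (StCompletion r n) then
    let E := if (if evidence_number (c_evidence st) is Some n0 then n0 < n
                 else true)
             then Some W else c_evidence st in
    if [&& c_pending st == Some m, (beta, k) \in c_used st
         & mverify r (Some (ident chi, k, m)) pf]
    then (ClientState (c_seq st).+1 E None (c_tried st) (c_used st) (c_last st),
          no_effect)
    else (ClientState (c_seq st) E (c_pending st) (c_tried st) (c_used st)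
            (c_last st), no_effect)
  else (st, no_effect).

Definition client_receive (chi : Client) (st : client_state) (src : process)
    (msg : message) : client_state * effects :=
  match src, msg with
  | PBroker beta, MInclusion m root pf k E =>
      client_inclusion chi st beta m root pf k E
  | PBroker beta, MCompletion r m k pf n W =>
      client_completion chi st beta r m k pf n W
  | _, _ => (st, no_effect)
  end.

Record submission := Submission {
  sub_client : Client;
  sub_msg : Msg;
  sub_num : nat;
  sub_sig : client_sig;
  sub_evidence : option cert }.

Definition sub_id (x : submission) : nat := ident (sub_client x).

(* A batch whose stragglers are settled, with the aggregate multi-signature and
   the straggler signatures. *)
Record sealed := Sealed {
  sl_batch : batch;
  sl_aggregate : stmt * seq Client;
  sl_signatures : seq (nat * client_sig) }.

(* [b_flushes] counts the batches formed so far, and [b_reducing] maps the rank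
   of a batch whose reduction timer is running to its submissions.  [b_reduced]
   collects the valid multi-signatures on reductions.  The sealed batches wait
   in [b_outbox] until the previous batch is STOB-delivered; [b_num] is the batch counter and
   [b_sent] lists the numbered batches already sent, latest first. *)
Record broker_state := BrokerState {
  b_dir : nat -> option Client;
  b_queue : nat -> seq submission;
  b_pool : seq submission;
  b_flushes : nat;
  b_reducing : nat -> option (seq submission);
  b_reduced : seq (Client * Root);
  b_outbox : seq sealed;
  b_num : nat;
  b_sent : seq (nat * sealed);
  b_witnesses : key -> {set Server};
  b_completions : nat * Root * nat -> {set Server} }.

Definition broker0 (beta : Broker) :=
  BrokerState (dir0 (PBroker beta)) (fun=> [::]) [::] 0 (fun=> None) [::] [::]
    1 [::] (fun=> set0) (fun=> set0).

Definition broker_submission (st : broker_state) (a : assignment) (m : Msg)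
    (s : nat) (sg : client_sig) (E : option cert) : broker_state * effects :=
  let: BrokerState d q pool fl red ms out num sent wit compl := st in
  let d' := import d [:: a] in
  let ok := [&& ident a.2 == a.1, sg == (a.2, StMessage m s)
              & (s == 0) || evidence_covers E s] in
  let q' := if ok then upd q a.1 (rcons (q a.1) (Submission a.2 m s sg E))
            else q in
  (BrokerState d' q' pool fl red ms out num sent wit compl, no_effect).

Definition poolable (st : broker_state) (i : nat) : bool :=
  (0 < size (b_queue st i)) && (i \notin map sub_id (b_pool st)).

Definition broker_pool (st : broker_state) (i : nat) : broker_state * effects :=
  let: BrokerState d q pool fl red ms out num sent wit compl := st in
  if q i is x :: q_i then
    (BrokerState d (upd q i q_i) (rcons pool x) fl red ms out num sent wit compl,
     no_effect)
  else (st, no_effect).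

Definition batch_number (subs : seq submission) : nat :=
  \max_(x <- subs) sub_num x.

Definition make_batch (subs : seq submission) (late : pred submission) : batch :=
  Batch (map sub_id subs)
    [seq (batch_number subs, sub_msg x) | x <- subs]
    [seq (sub_id x, sub_num x) | x <- subs & late x].

Definition best_evidence (subs : seq submission) : option cert :=
  foldr (fun x E => match evidence_number (sub_evidence x), evidence_number E with
                    | Some n, Some n' => if n' < n then sub_evidence x else E
                    | Some _, None => sub_evidence x
                    | None, _ => E
                    end) None subs.

Definition broker_flush (st : broker_state) : broker_state * effects :=
  let: BrokerState d q pool fl red ms out num sent wit compl := st in
  let k := batch_number pool in
  let b := make_batch pool pred0 in
  let inclusion x :=
    MInclusion (sub_msg x) (reduction_root b)
      (mprove MT (reduction_leaves b) (Some (sub_id x, k, sub_msg x)))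
      k (best_evidence pool) in
  (BrokerState d q [::] fl.+1 (upd red fl (Some pool)) ms out num sent wit compl,
   only_send [seq (PClient (sub_client x), inclusion x) | x <- pool]).

Definition broker_reduction (st : broker_state) (sg : client_sig) :
    broker_state * effects :=
  let: BrokerState d q pool fl red ms out num sent wit compl := st in
  if sg is (chi, StReduction root) then
    (BrokerState d q pool fl red ((chi, root) :: ms) out num sent wit compl,
     no_effect)
  else (st, no_effect).

Definition seal (ms : seq (Client * Root)) (subs : seq submission) : sealed :=
  let root := reduction_root (make_batch subs pred0) in
  let late x := (sub_client x, root) \notin ms in
  Sealed (make_batch subs late)
    (StReduction root, [seq sub_client x | x <- subs & ~~ late x])
    [seq (sub_id x, sub_sig x) | x <- subs & late x].

Definition broker_seal (st : broker_state) (i : nat) : broker_state * effects :=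
  let: BrokerState d q pool fl red ms out num sent wit compl := st in
  if red i is Some subs then
    (BrokerState d q pool fl (upd red i None) ms (rcons out (seal ms subs))
       num sent wit compl, no_effect)
  else (st, no_effect).

Definition broker_send (st : broker_state) : broker_state * effects :=
  let: BrokerState d q pool fl red ms out num sent wit compl := st in
  if out is x :: out' then
    (BrokerState d q pool fl red ms out' num.+1 ((num, x) :: sent) wit compl,
     only_send (to_servers (MBatch num (sl_batch x))))
  else (st, no_effect).

Definition broker_acquired (st : broker_state) (src : process) (r : Root)
    (unknowns : seq nat) : broker_state * effects :=
  if ohead [seq x <- b_sent st | batch_root (sl_batch x.2) == r] is Some (num, x)
  then (st, only_send [:: (src, MSignatures r num (export (b_dir st) unknowns)
                                  (sl_aggregate x) (sl_signatures x))])
  else (st, no_effect).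

Definition broker_witness (beta : Broker) (st : broker_state) (sg : server_sig) :
    broker_state * effects :=
  let: BrokerState d q pool fl red ms out num sent wit compl := st in
  if sg is (p, StWitness (r, beta', n) as s) then
    let kk : key := (r, beta', n) in
    let mine := if lookup n sent is Some x then batch_root (sl_batch x) == r
                else false in
    if [&& beta' == beta, mine & p \notin wit kk] then
      let A := p |: wit kk in
      (BrokerState d q pool fl red ms out num sent (upd wit kk A) compl,
       if #|A| == f.+1 then only_send (to_servers (MWitness r n (Cert s A)))
       else no_effect)
    else (st, no_effect)
  else (st, no_effect).

(* The exceptions of a completion shard list the leaves that differ from the
   submitted ones, so that the broker can rebuild the completion tree. *)
Definition completion_leaves (b : batch) (exc : seq (nat * leaf)) : seq leaf :=
  [seq odflt (Some e) (lookup e.1.1 exc) | e <- numbered b].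

Definition broker_completion (beta : Broker) (st : broker_state) (kk : key)
    (sg : server_sig) (exc : seq (nat * leaf)) : broker_state * effects :=
  let: BrokerState d q pool fl red ms out num sent wit compl := st in
  let: (r, beta', i) := kk in
  match lookup i sent, sg with
  | Some x, (p, StCompletion r' n as s) =>
    let b := sl_batch x in
    let ls := completion_leaves b exc in
    let slot := (i, r', n) in
    if [&& beta' == beta, batch_root b == r, root_from ls == r'
         & p \notin compl slot] then
      let A := p |: compl slot in
      let completion (l : leaf) : option (process * message) :=
        if l is Some (j, k, m) then
          omap (fun chi => (PClient chi,
                            MCompletion r' m k (mprove MT ls l) n (Cert s A)))
               (d j)
        else None in
      (BrokerState d q pool fl red ms out num sent wit (upd compl slot A),
       if #|A| == f.+1 then only_send (pmap completion ls) else no_effect)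
    else (st, no_effect)
  | _, _ => (st, no_effect)
  end.

Definition broker_receive (beta : Broker) (st : broker_state) (src : process)
    (msg : message) : broker_state * effects :=
  match src, msg with
  | _, MSubmission a m s sg E => broker_submission st a m s sg E
  | PClient _, MReduction sg => broker_reduction st sg
  | PServer _, MBatchAcquired r unknowns => broker_acquired st src r unknowns
  | PServer _, MWitnessShard sg => broker_witness beta st sg
  | PServer _, MCompletionShard kk sg exc => broker_completion beta st kk sg exc
  | _, _ => (st, no_effect)
  end.

(* [s_last] maps an identifier to None when its last pair is (-1, bottom). *)
Record server_state := ServerState {
  s_dir : nat -> option Client;
  s_batches : key -> option batch;
  s_expnum : Broker -> nat;
  s_exproot : Broker -> option Root;
  s_pool : seq key;
  s_last : nat -> option (nat * Msg);
  s_count : nat;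
  s_done : Broker -> nat;
  s_completed : seq key;
  s_accepts : key -> {set Server} }.

Definition server0 (p : Server) :=
  ServerState (dir0 (PServer p)) (fun=> None) (fun=> 1) (fun=> None) [::]
    (fun=> None) 1 (fun=> 0) [::] (fun=> set0).

Definition known (d : nat -> option Client) (i : nat) : bool := isSome (d i).

Definition server_batch (st : server_state) (beta : Broker) (num : nat)
    (b : batch) : server_state * effects :=
  let: ServerState d bs en er pool last c dn cp acc := st in
  let r := batch_root b in
  let kk : key := (r, beta, num) in
  if [&& ~~ isSome (bs kk), num == en beta, er beta == None, uniq (ids b)
       & size (ids b) == size (payloads b)]
  then (ServerState d (upd bs kk (Some b)) en (upd er beta (Some r))
          pool last c dn cp acc,
        only_send [:: (PBroker beta,
                       MBatchAcquired r [seq i <- ids b | ~~ known d i])])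
  else (st, no_effect).

(* An aggregate verifies only against exactly the set of its signers. *)
Definition valid_signatures (d : nat -> option Client) (b : batch)
    (agg : stmt * seq Client) (sigs : seq (nat * client_sig)) : bool :=
  [&& perm_eq [seq x.1 | x <- sigs] [seq x.1 | x <- stragglers b],
      all (fun x : nat * client_sig =>
             match d x.1, lookup x.1 (entries b), lookup x.1 (stragglers b) with
             | Some chi, Some (_, m), Some k => x.2 == (chi, StMessage m k)
             | _, _, _ => false
             end) sigs,
      agg.1 == StReduction (reduction_root b)
    & perm_eq (map Some agg.2) [seq d i | i <- ids b & ~~ is_straggler b i]].

Definition server_signatures (st : server_state) (p : Server) (beta : Broker)
    (r : Root) (num : nat) (asg : seq assignment) (agg : stmt * seq Client)
    (sigs : seq (nat * client_sig)) : server_state * effects :=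
  let: ServerState d bs en er pool last c dn cp acc := st in
  let d' := import d asg in
  let kk : key := (r, beta, num) in
  let ok := [&& er beta == Some r, num == en beta
              & if bs kk is Some b
                then all (known d') (ids b) && valid_signatures d' b agg sigs
                else false] in
  (ServerState d' bs en er pool last c dn cp acc,
   if ok then
     Effects [:: (PBroker beta, MWitnessShard (p, StWitness kk))] [::] [::]
       [:: StWitness kk]
   else no_effect).

Definition server_witness (st : server_state) (beta : Broker) (r : Root)
    (num : nat) (W : cert) : server_state * effects :=
  if [&& s_exproot st beta == Some r, num == s_expnum st beta
       & certifies W (StWitness (r, beta, num))]
  then (st, Effects [::] [:: (beta, r, W)] [::] [::])
  else (st, no_effect).

(* Once a batch of beta is delivered, no root is expected from beta until its
   next batch is received. *)
Definition server_stob_deliver (st : server_state) (sm : stob_message) :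
    server_state * effects :=
  let: ServerState d bs en er pool last c dn cp acc := st in
  let: (beta, r, W) := sm in
  let kk : key := (r, beta, en beta) in
  if certifies W (StWitness kk) then
    (ServerState d bs (upd en beta (en beta).+1) (upd er beta None)
       (rcons pool kk) last c dn cp acc,
     if er beta == Some r then no_effect
     else only_send (to_servers (MRequestBatch kk)))
  else (st, no_effect).

Definition server_request (st : server_state) (q : Server) (kk : key) :
    server_state * effects :=
  if s_batches st kk is Some b then
    (st, only_send [:: (PServer q,
                        MBatchReply kk b (export (s_dir st) (ids b)))])
  else (st, no_effect).

Definition server_reply (st : server_state) (kk : key) (b : batch)
    (asg : seq assignment) : server_state * effects :=
  let: ServerState d bs en er pool last c dn cp acc := st in
  if (kk \in pool) && ~~ isSome (bs kk) then
    let d' := import d asg in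
    let ok := all (known d') (ids b) && (batch_root b == kk.1.1) in
    (ServerState d' (if ok then upd bs kk (Some b) else bs) en er
       pool last c dn cp acc, no_effect)
  else (st, no_effect).

(* For each entry: the updated map of last pairs, the completion leaves and the
   delivered pairs (identifier, message). *)
Fixpoint complete_entries (last : nat -> option (nat * Msg))
    (es : seq (nat * nat * Msg)) :
    (nat -> option (nat * Msg)) * seq leaf * seq (nat * Msg) :=
  if es is (i, k, m) :: es' then
    let: (last1, l, dl) :=
      match last i with
      | None => (upd last i (Some (k, m)), Some (i, k, m), [:: (i, m)])
      | Some (k', m') =>
          if k < k' then (last, None, [::])
          else if m == m' then (last, Some (i, k', m'), [::])
          else if k' < k then
            (upd last i (Some (k, m)), Some (i, k, m), [:: (i, m)])
          else (last, None, [::])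
      end in
    let: (last2, ls, dls) := complete_entries last1 es' in
    (last2, l :: ls, dl ++ dls)
  else (last, [::], [::]).

Definition completable (st : server_state) : bool :=
  if s_pool st is kk :: _ then isSome (s_batches st kk) else false.

Definition server_complete (st : server_state) (p : Server) :
    server_state * effects :=
  let: ServerState d bs en er pool last c dn cp acc := st in
  if pool is kk :: pool' then
    if bs kk is Some b then
      let beta := kk.1.2 in
      let: (last', ls, dls) := complete_entries last (numbered b) in
      let s := StCompletion (root_from ls) c in
      let exc := [seq (x.1.1.1, x.2) | x <- zip (numbered b) ls
                                      & Some x.1 != x.2] in
      (ServerState d bs en er pool' last' c.+1 (upd dn beta (dn beta).+1)
         (kk :: cp) acc,
       Effects ((PBroker beta, MCompletionShard kk (p, s) exc)
                :: to_servers (MCollection kk))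
         [::]
         (pmap (fun x : nat * Msg => omap (pair^~ x.2) (d x.1)) dls)
         [:: s])
    else (st, no_effect)
  else (st, no_effect).

Definition server_collection (st : server_state) (q : Server) (kk : key) :
    server_state * effects :=
  if kk.2 <= s_done st kk.1.2
  then (st, only_send [:: (PServer q, MCollectionAccept kk)])
  else (st, no_effect).

Definition server_accept (st : server_state) (q : Server) (kk : key) :
    server_state * effects :=
  let: ServerState d bs en er pool last c dn cp acc := st in
  let A := q |: acc kk in
  let bs' := if (kk \in cp) && (A == setT) then upd bs kk None else bs in
  (ServerState d bs' en er pool last c dn cp (upd acc kk A), no_effect).

Definition server_receive (p : Server) (st : server_state) (src : process)
    (msg : message) : server_state * effects :=
  match src, msg with
  | PBroker beta, MBatch num b => server_batch st beta num b
  | PBroker beta, MSignatures r num asg agg sigs =>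
      server_signatures st p beta r num asg agg sigs
  | PBroker beta, MWitness r num W => server_witness st beta r num W
  | PServer q, MRequestBatch kk => server_request st q kk
  | PServer q, MBatchReply kk b asg => server_reply st kk b asg
  | PServer q, MCollection kk => server_collection st q kk
  | PServer q, MCollectionAccept kk => server_accept st q kk
  | _, _ => (st, no_effect)
  end.

Record config := Config {
  clients : Client -> client_state;
  brokers : Broker -> broker_state;
  servers : Server -> server_state }.

Definition config0 := Config (fun=> client0) broker0 server0.

(* [EvSubmit] is the ringing of a client's timer, [EvFlush] and [EvSeal] that of
   the two timers of a broker.  Faulty processes have no state: they may send,
   and STOB-broadcast if they are servers, anything at any time. *)
Inductive event :=
| EvIdle
| EvReceive of process & process & message    (* source, destination *)
| EvBroadcast of Client & Msg & Broker
| EvSubmit of Client & Broker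
| EvPool of Broker & nat
| EvFlush of Broker
| EvSeal of Broker & nat
| EvSend of Broker
| EvStobDeliver of Server & stob_message
| EvComplete of Server
| EvFaultySend of process & process & message (* source, destination *)
| EvFaultyStob of Server & stob_message.

Definition actor (e : event) : option process :=
  match e with
  | EvIdle => None
  | EvReceive _ dst _ => Some dst
  | EvBroadcast chi _ _ | EvSubmit chi _ => Some (PClient chi)
  | EvPool beta _ | EvFlush beta | EvSeal beta _ | EvSend beta =>
      Some (PBroker beta)
  | EvStobDeliver p _ | EvComplete p | EvFaultyStob p _ => Some (PServer p)
  | EvFaultySend src _ _ => Some src
  end.

(* A correct broker sends a batch only once the correct servers have
   STOB-delivered the previous one.  A correct server has STOB-delivered the batch of beta numbered n iff
   its expected number for beta exceeds n; here n is the last number used. *)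
Definition previous_delivered (c : config) (beta : Broker) : bool :=
  [forall p : Server, correct (PServer p) ==>
     (b_num (brokers c beta) <= s_expnum (servers c p) beta)].

(* A correct client broadcasts a message only if the previous one is completed
   and differs from it. *)
Definition enabled (c : config) (e : event) : bool :=
  match e with
  | EvIdle => true
  | EvReceive _ dst _ => correct dst
  | EvBroadcast chi m _ =>
      [&& correct (PClient chi), c_pending (clients c chi) == None
        & c_last (clients c chi) != Some m]
  | EvSubmit chi beta =>
      [&& correct (PClient chi), isSome (c_pending (clients c chi))
        & beta \notin c_tried (clients c chi)]
  | EvPool beta i => correct (PBroker beta) && poolable (brokers c beta) i
  | EvFlush beta =>
      correct (PBroker beta) && (0 < size (b_pool (brokers c beta)))
  | EvSeal beta i =>
      correct (PBroker beta) && isSome (b_reducing (brokers c beta) i)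
  | EvSend beta =>
      [&& correct (PBroker beta), 0 < size (b_outbox (brokers c beta))
        & previous_delivered c beta]
  | EvStobDeliver p _ => correct (PServer p)
  | EvComplete p => correct (PServer p) && completable (servers c p)
  | EvFaultySend src _ _ => ~~ correct src
  | EvFaultyStob p _ => ~~ correct (PServer p)
  end.

Definition at_client (c : config) (chi : Client) (x : client_state * effects) :=
  (Config (upd (clients c) chi x.1) (brokers c) (servers c), x.2).
Definition at_broker (c : config) (beta : Broker) (x : broker_state * effects) :=
  (Config (clients c) (upd (brokers c) beta x.1) (servers c), x.2).
Definition at_server (c : config) (p : Server) (x : server_state * effects) :=
  (Config (clients c) (brokers c) (upd (servers c) p x.1), x.2).

Definition step (c : config) (e : event) : config * effects :=
  match e with
  | EvIdle => (c, no_effect)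
  | EvReceive src (PClient chi) msg =>
      at_client c chi (client_receive chi (clients c chi) src msg)
  | EvReceive src (PBroker beta) msg =>
      at_broker c beta (broker_receive beta (brokers c beta) src msg)
  | EvReceive src (PServer p) msg =>
      at_server c p (server_receive p (servers c p) src msg)
  | EvBroadcast chi m beta =>
      at_client c chi (client_broadcast chi (clients c chi) m beta)
  | EvSubmit chi beta => at_client c chi (client_submit chi (clients c chi) beta)
  | EvPool beta i => at_broker c beta (broker_pool (brokers c beta) i)
  | EvFlush beta => at_broker c beta (broker_flush (brokers c beta))
  | EvSeal beta i => at_broker c beta (broker_seal (brokers c beta) i)
  | EvSend beta => at_broker c beta (broker_send (brokers c beta))
  | EvStobDeliver p sm => at_server c p (server_stob_deliver (servers c p) sm)
  | EvComplete p => at_server c p (server_complete (servers c p) p)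
  | EvFaultySend _ dst msg => (c, only_send [:: (dst, msg)])
  | EvFaultyStob _ sm => (c, Effects [::] [:: sm] [::] [::])
  end.

Section Run.

Variable x : nat -> event.

Fixpoint conf (t : nat) : config :=
  if t is t'.+1 then (step (conf t') (x t')).1 else config0.

Definition out (t : nat) : effects := (step (conf t) (x t)).2.

Definition sent (src dst : process) (msg : message) (t : nat) : Prop :=
  actor (x t) = Some src /\ List.In (dst, msg) (sends (out t)).

Definition signed (a : process) (s : stmt) (t : nat) : Prop :=
  actor (x t) = Some a /\ s \in signs (out t).

Definition stob_broadcast (p : Server) (sm : stob_message) (t : nat) : Prop :=
  actor (x t) = Some (PServer p) /\ List.In sm (stobs (out t)).

Definition stob_delivered (p : Server) (sm : stob_message) (t : nat) : Prop :=
  x t = EvStobDeliver p sm.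

Definition client_broadcasts (chi : Client) (m : Msg) (t : nat) : Prop :=
  exists beta, x t = EvBroadcast chi m beta.

Definition server_delivers (p : Server) (chi : Client) (m : Msg) (t : nat) : Prop :=
  actor (x t) = Some (PServer p) /\ (chi, m) \in delivers (out t).

(* Authenticated reliable links.  A message may be received several times. *)
Definition link_authentic : Prop :=
  forall t src dst msg, x t = EvReceive src dst msg ->
    exists2 t', t' < t & sent src dst msg t'.

Definition link_reliable : Prop :=
  forall t src dst msg, correct src -> correct dst -> sent src dst msg t ->
    exists2 t', t < t' & x t' = EvReceive src dst msg.

Definition cert_signatures (W : cert) : seq (process * stmt) :=
  [seq (PServer p, cert_stmt W) | p <- enum (cert_signers W)].

Definition evidence_signatures (E : option cert) : seq (process * stmt) :=
  if E is Some W then cert_signatures W else [::].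

Definition message_signatures (msg : message) : seq (process * stmt) :=
  match msg with
  | MSubmission _ _ _ sg E => (PClient sg.1, sg.2) :: evidence_signatures E
  | MInclusion _ _ _ _ E => evidence_signatures E
  | MReduction sg => [:: (PClient sg.1, sg.2)]
  | MSignatures _ _ _ agg sigs =>
      [seq (PClient chi, agg.1) | chi <- agg.2]
      ++ [seq (PClient y.2.1, y.2.2) | y <- sigs]
  | MWitnessShard sg | MCompletionShard _ sg _ => [:: (PServer sg.1, sg.2)]
  | MWitness _ _ W | MCompletion _ _ _ _ _ W => cert_signatures W
  | _ => [::]
  end.

(* No signature of a correct process is ever sent or STOB-broadcast by anybody
   unless that process has produced it. *)
Definition unforgeable : Prop :=
  forall t a s, correct a ->
    (exists src dst msg,
        sent src dst msg t /\ List.In (a, s) (message_signatures msg)) \/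
    (exists p sm,
        stob_broadcast p sm t /\ List.In (a, s) (cert_signatures sm.2)) ->
    exists2 t', t' <= t & signed a s t'.

Record stob : Prop := Stob {
  stob_no_duplication : forall q sm t0 p t1 t2,
    correct (PServer q) -> stob_broadcast q sm t0 ->
    correct (PServer p) -> stob_delivered p sm t1 -> stob_delivered p sm t2 ->
    t1 = t2;
  stob_integrity : forall p sm t,
    correct (PServer p) -> stob_delivered p sm t ->
    exists q t', t' < t /\ stob_broadcast q sm t';
  stob_validity : forall p sm t,
    correct (PServer p) -> stob_broadcast p sm t ->
    exists q t', correct (PServer q) /\ stob_delivered q sm t';
  stob_agreement : forall p q sm t,
    correct (PServer p) -> correct (PServer q) -> stob_delivered p sm t ->
    exists t', stob_delivered q sm t';
  stob_total_order : forall p q sm sm' t t',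
    correct (PServer p) -> correct (PServer q) -> sm <> sm' ->
    stob_delivered p sm t ->
    (forall u, u < t -> ~ stob_delivered p sm' u) ->
    stob_delivered q sm' t' ->
    exists2 u, u < t' & stob_delivered q sm u }.

(* Timers are finite, and processes do not stall: a local event of a correct
   process that stays enabled eventually happens.  For [EvSubmit chi beta] this
   says that, as long as a message is pending, each broker is eventually tried. *)
Definition local (e : event) : bool :=
  match e with
  | EvSubmit _ _ | EvPool _ _ | EvFlush _ | EvSeal _ _ | EvSend _
  | EvComplete _ => true
  | _ => false
  end.

Definition fair : Prop :=
  forall e t, local e -> (forall t', t <= t' -> enabled (conf t') e) ->
    exists2 t', t <= t' & x t' = e.

(* A submission by a correct client with a positive number carries an evidence
   whose number is at least as large. *)
Definition covered_submissions : Prop :=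
  forall t chi dst a m s sg E, correct (PClient chi) ->
    sent (PClient chi) dst (MSubmission a m s sg E) t -> 0 < s ->
    evidence_covers E s.

Record execution : Prop := Execution {
  exec_enabled : forall t, enabled (conf t) (x t);
  exec_authentic : link_authentic;
  exec_reliable : link_reliable;
  exec_unforgeable : unforgeable;
  exec_stob : stob;
  exec_fair : fair;
  exec_covered : covered_submissions }.

End Run.

End ChopChop.

Arguments PClient {Server Broker Client} _.
Arguments PBroker {Server Broker Client} _.
Arguments PServer {Server Broker Client} _.

(* Submission.v *)
(* Correct servers effectively STOB-deliver the same sequence of keys, hence
   complete the same batches in the same order and go through the same values of
   [s_last].  Every delivered key carries the signature of a correct witness,
   which has stored the batch, knows its identifiers and has checked its
   signatures; so the batch can be retrieved, each of its entries for a correct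
   client was signed by that client, and the witness itself can name the client
   of a delivered entry.

   Let s be the counter of chi when it broadcasts m.  It suffices that a correct
   server records for chi an entry (k, m) with k >= s: numbers signed before the
   broadcast are smaller than s, so such an entry was signed afterwards, and a
   witness of its batch delivers m.  If m is completed, the certificate provides
   such a record.  Otherwise chi eventually submits m to a correct broker, whose
   batch is completed by all correct servers.  If the entry of chi is not
   delivered there, an earlier record (q, m') prevents it.  If q >= s, then
   m' = m since m has remained pending; if q < s, then m' = m was recorded before
   the previous message of chi, which is distinct from m, has been completed with
   a larger number: a contradiction. *)

Require Import Defs.
From HB Require Import structures.
From Stdlib Require Import Classical.
From Stdlib Require List.
Set Warnings "-notation-overridden,-redundant-canonical-projection".
From mathcomp Require Import all_boot zify.

Set Implicit Arguments.
Unset Strict Implicit.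
Unset Printing Implicit Defensive.

#[local] Arguments EvSubmit {Server Broker Client Msg MT}.
#[local] Arguments EvBroadcast {Server Broker Client Msg MT}.
#[local] Arguments EvPool {Server Broker Client Msg MT}.
#[local] Arguments EvFlush {Server Broker Client Msg MT}.
#[local] Arguments EvSeal {Server Broker Client Msg MT}.
#[local] Arguments EvSend {Server Broker Client Msg MT}.
#[local] Arguments EvStobDeliver {Server Broker Client Msg MT}.
#[local] Arguments EvComplete {Server Broker Client Msg MT}.
#[local] Arguments MBatch {Server Broker Client Msg MT}.
#[local] Arguments MBatchAcquired {Server Broker Client Msg MT}.
#[local] Arguments MSignatures {Server Broker Client Msg MT}.
#[local] Arguments MWitnessShard {Server Broker Client Msg MT}.
#[local] Arguments MWitness {Server Broker Client Msg MT}.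
#[local] Arguments MRequestBatch {Server Broker Client Msg MT}.
#[local] Arguments MBatchReply {Server Broker Client Msg MT}.
#[local] Arguments MCollectionAccept {Server Broker Client Msg MT}.
#[local] Arguments MCompletion {Server Broker Client Msg MT}.
#[local] Arguments StMessage {Broker Msg MT}.
#[local] Arguments StReduction {Broker Msg MT}.
#[local] Arguments StWitness {Broker Msg MT}.
#[local] Arguments StCompletion {Broker Msg MT}.

(** STOB excludes duplicates only for messages broadcast by correct servers, and a faulty broker may
    obtain certificates for different roots, or with different signers, under one number. Raw
    deliveries are therefore not compared; only effective ones are, whose certificate matches the
    number expected at that moment, and total order decides which of several certificates wins.
    Batches get deleted, so the history of a server cannot be read off its state. It is an
    existentially quantified list of entry lists, pinned by the Merkle roots of the completed keys;
    injectivity of roots makes two such lists comparable. A server may complete a batch without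
    knowing all its identifiers, and then delivers nothing for the unknown ones; hence delivery is
    located at a witness. Progress meets two circularities. A broker sends a batch only after the
    previous one is delivered: a delivery that never came would freeze the expected numbers of all
    correct servers, and the exchange then succeeds. A batch to be retrieved may have been deleted:
    but deletion requires acceptance by the very server that asks for it. *)

Lemma InP (T : eqType) (a : T) s : reflect (List.In a s) (a \in s).
Proof.
elim: s => [|b s IH] /=; first by constructor.
rewrite inE; apply: (iffP orP) => [[/eqP->|/IH]|[->|/IH]]; by auto.
Qed.

Lemma mem_cat_cons (T : eqType) (a : T) s :
  a \in s -> exists s1 s2, s = s1 ++ a :: s2.
Proof. by case/splitPr=> s1 s2; exists s1, s2. Qed.

Lemma In_map (T1 T2 : Type) (h : T1 -> T2) a s : List.In a s -> List.In (h a) (map h s).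
Proof. by elim: s => [//|b s IH] /= [->|/IH]; auto. Qed.

Lemma In_mapP (T1 T2 : Type) (h : T1 -> T2) y s :
  List.In y (map h s) -> exists2 a, List.In a s & y = h a.
Proof.
elim: s => [//|b s IH] /= [<-|/IH[a]]; first by exists b; auto.
by exists a; auto.
Qed.

Lemma In_pmapP (T1 T2 : Type) (h : T1 -> option T2) y s :
  List.In y (pmap h s) -> exists a, h a = Some y.
Proof.
elim: s => [//|b s IH] /=; case E: (h b) => [z|] //= [<-|//]; by exists b.
Qed.

Lemma rev_iota1S k : rev (iota 1 k.+1) = k.+1 :: rev (iota 1 k).
Proof. by rewrite -[in LHS](addn1 k) iotaD rev_cat add1n. Qed.

Lemma cat_split (T : Type) (s s' : seq T) E1 e E2 : s ++ s' = E1 ++ e :: E2 ->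
  (exists e2, s = E1 ++ e :: e2) \/ exists E3, E1 = s ++ E3 /\ s' = E3 ++ e :: E2.
Proof.
elim: s E1 => [|a s IH] E1; first by right; exists E1.
case: E1 => [|b E1] /= [-> E]; first by left; exists s.
by case: (IH _ E) => [[e2 ->]|[E3 [-> ->]]]; [left; exists e2|right; exists E3].
Qed.

Lemma flatten_split (T : Type) (ess : seq (seq T)) E1 e E2 :
  flatten ess = E1 ++ e :: E2 -> exists ess1 es ess2 e1 e2,
  [/\ ess = ess1 ++ es :: ess2, es = e1 ++ e :: e2 & E1 = flatten ess1 ++ e1].
Proof.
elim: ess E1 => [|es ess IH] E1 /=; first by case: E1.
move=> H; case: (cat_split H) => [[e2 E]|[E3 [-> /IH[ess1 [es' [ess2 [e1 [e2 [-> H2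
    H3]]]]]]]]].
  by exists [::], es, ess, E1, e2.
by exists (es :: ess1), es', ess2, e1, e2; split=> //=; rewrite H3 catA.
Qed.

(** Aligns a list of entry blocks with a list of keys having the same roots: a split of the keys
    induces a split of the blocks. *)
Lemma map_eq_cat (T1 T2 T3 : Type) (g : T1 -> T3) (h : T2 -> T3) s s1 a s2 :
  map g s = map h (s1 ++ a :: s2) -> exists r1 b r2,
  [/\ s = r1 ++ b :: r2, map g r1 = map h s1 & g b = h a].
Proof.
elim: s1 s => [|c s1 IH] [|d s] //= [Ed].
  by exists [::], d, s.
by move/IH=> [r1 [b [r2 [-> E1 E2]]]]; exists (d :: r1), b, r2; rewrite /= Ed E1.
Qed.

(** * The last pairs as a fold over the completed entries *)

Section Completion.
Variable Msg : eqType.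
Implicit Types (L : nat -> option (nat * Msg)) (i k q : nat) (m : Msg).
Implicit Types (es : seq (nat * nat * Msg)).

(** The case in which completion updates the last pair and delivers; [None] stands for the pair (-1,
    bottom), below every number. *)
Definition fresh (o : option (nat * Msg)) k m :=
  if o is Some (k', m') then (k' < k) && (m != m') else true.

Definition record_entry L (e : nat * nat * Msg) :=
  let: (i, k, m) := e in if fresh (L i) k m then upd L i (Some (k, m)) else L.

Definition record_all L es := foldl record_entry L es.

(** Expresses the case analysis of the server through [fresh], which separates map, leaf and
    delivery and turns the map into a left fold. *)
Lemma complete_entries_cons L i k m es :
  complete_entries L ((i, k, m) :: es) =
  let L1 := record_entry L (i, k, m) in
  let rest := complete_entries L1 es in
  let l := if fresh (L i) k m then Some (i, k, m) else
           if L i is Some (k', m') then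
             if (k' <= k) && (m == m') then Some (i, k', m') else None
           else None in
  (rest.1.1, l :: rest.1.2,
   (if fresh (L i) k m then [:: (i, m)] else [::]) ++ rest.2).
Proof.
rewrite /= /fresh; case: (L i) => [[k' m']|] /=; last by case: complete_entries => -[].
case: ltngtP => [||->]; case: eqP => [->|] //= *; by case: complete_entries => -[].
Qed.

Lemma complete_entries_last L es :
  (complete_entries L es).1.1 = record_all L es.
Proof. by elim: es L => [//|[[i k] m] es IH] L; rewrite complete_entries_cons /= IH.
    Qed.

(** Whether the entry is fresh or repeats the recorded message, its leaf is the pair recorded right
    after it is processed: a completion leaf attests a record. *)
Lemma complete_entries_leaf L es i k m :
  Some (i, k, m) \in (complete_entries L es).1.2 ->
  exists es1 es2, es = es1 ++ es2 /\ record_all L es1 i = Some (k, m).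
Proof.
elim: es L => [//|[[j q] n] es IH] L; rewrite complete_entries_cons /= inE.
case/orP => [|/IH[es1 [es2 [-> E]]]]; last by exists ((j, q, n) :: es1), es2.
case: ifP => [F /eqP[-> -> ->]|_].
  (* A fresh entry writes its own record, so the prefix includes it. *)
  by exists [:: (j, q, n)], es; split=> //=; rewrite F /upd eqxx.
case E: (L j) => [[k' m']|//]; case: ifP => // _ /eqP[-> -> ->].
by exists [::], ((j, q, n) :: es).
Qed.

Lemma complete_entries_deliver L es1 es2 i k m :
  fresh (record_all L es1 i) k m ->
  (i, m) \in (complete_entries L (es1 ++ (i, k, m) :: es2)).2.
Proof.
elim: es1 L => [|[[j q] n] es1 IH] L F; rewrite cat_cons || rewrite cat0s.
  by rewrite complete_entries_cons /= [fresh _ _ _]F /= inE eqxx.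
by rewrite complete_entries_cons /= mem_cat IH ?orbT.
Qed.

Lemma record_all_cat L es1 es2 :
  record_all L (es1 ++ es2) = record_all (record_all L es1) es2.
Proof. exact: foldl_cat. Qed.

Lemma record_all_rcons L es e :
  record_all L (rcons es e) = record_entry (record_all L es) e.
Proof. exact: foldl_rcons. Qed.

(** The last update of [i] wrote the pair, and only fresh entries update; so each record leads back
    to an entry that completion delivers. *)
Lemma record_all_origin es i k m :
  record_all (fun=> None) es i = Some (k, m) ->
  exists es1 es2, es = es1 ++ (i, k, m) :: es2 /\
    fresh (record_all (fun=> None) es1 i) k m.
Proof.
elim/last_ind: es => [//|es [[j q] n] IH]; rewrite record_all_rcons /=.
case: ifP => F; last by case/IH=> es1 [es2 [-> H]]; exists es1, (rcons es2 (j, q,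
    n)); rewrite rcons_cat.
rewrite {1}/upd; case: eqP => [-> [<- <-]|_]; first by exists es, [::]; rewrite cats1.
by case/IH=> es1 [es2 [-> H]]; exists es1, (rcons es2 (j, q, n)); rewrite rcons_cat.
Qed.

Lemma record_all_mono L es i k m : L i = Some (k, m) ->
  exists k' m', record_all L es i = Some (k', m') /\ k <= k'.
Proof.
elim: es L k m => [|[[j q] n] es IH] L k m E /=; first by exists k, m.
case: ifP => F; last exact: IH E.
have [ji|ji] := eqVneq i j; last by apply: (IH _ k m); rewrite /upd (negPf ji).
have [|k' [m' [E' H]]] := IH (upd L j (Some (q, n))) q n; first by rewrite /upd ji eqxx.
exists k', m'; split=> //; apply: leq_trans H.
by move: F; rewrite -ji E => /andP[/ltnW].
Qed.

End Completion.

Section Lookup.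
Variable T : eqType.
Implicit Types (s : seq (nat * T)).

Lemma lookup_mem i s v : lookup i s = Some v -> (i, v) \in s.
Proof.
rewrite /lookup; elim: s => [//|[j w] s IH] /=; case: eqP => [->[->]|_ /IH H].
  exact: mem_head.
by rewrite inE H orbT.
Qed.

Lemma lookup_uniq i s v :
  uniq (map fst s) -> (i, v) \in s -> lookup i s = Some v.
Proof.
rewrite /lookup; elim: s => [//|[j w] s IH] /= /andP[Hj Hu].
rewrite inE => /orP[/eqP[-> ->]|H]; first by rewrite eqxx.
case: eqP => [ij|_]; last exact: IH.
by case/negP: Hj; rewrite ij; apply/mapP; exists (i, v).
Qed.

Lemma lookup_None i s : i \notin map fst s -> lookup i s = None.
Proof.
move=> H; case E: (lookup i s) => [v|//].
by case/negP: H; apply/mapP; exists (i, v); rewrite ?(lookup_mem E).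
Qed.

End Lookup.

Lemma uniq_map_inj (T1 T2 : eqType) (h : T1 -> T2) s :
  uniq (map h s) -> {in s &, injective h}.
Proof.
elim: s => [//|a s IH] /= /andP[Ha /IH{}IH] y z; rewrite !inE.
case: eqP => [->|_] /=; case: eqP => [->|_] //= Hy Hz E; last exact: IH.
  by case/negP: Ha; rewrite E map_f.
by case/negP: Ha; rewrite -E map_f.
Qed.

(** * Batches *)

Section Batches.
Variables (Server Broker : finType) (Client Msg : eqType).
Variable MT : merkle (leaf Msg).
Variable ident : Client -> nat.

Notation cert := (cert Server Broker MT).
Notation submission := (submission Server Broker Client MT).
Notation sealed := (sealed Broker Client MT).

Implicit Types (b : batch Msg).

Definition cert_code (W : cert) := (cert_stmt W, cert_signers W).
Lemma cert_codeK : cancel cert_code (fun c => Cert c.1 c.2).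
Proof. by case. Qed.
HB.instance Definition _ := Equality.copy cert (can_type cert_codeK).

Definition submission_code (x : submission) :=
  (sub_client x, sub_msg x, sub_num x, sub_sig x, sub_evidence x).
Lemma submission_codeK :
  cancel submission_code (fun c => let: (a, b, c, d, e) := c in Submission a b c d e).
Proof. by case. Qed.
HB.instance Definition _ := Equality.copy submission (can_type submission_codeK).

Definition batch_code (b : batch Msg) := (ids b, payloads b, stragglers b).
Lemma batch_codeK : cancel batch_code (fun c => let: (a, b, c) := c in Batch a b c).
Proof. by case. Qed.
HB.instance Definition _ := Equality.copy (batch Msg) (can_type batch_codeK).

Definition sealed_code (y : sealed) := (sl_batch y, sl_aggregate y, sl_signatures y).
Lemma sealed_codeK : cancel sealed_code (fun c => let: (a, b, c) := c in Sealed a b c).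
Proof. by case. Qed.
HB.instance Definition _ := Equality.copy sealed (can_type sealed_codeK).

(** The shape that a server checks on a batch received from its broker, though not on a batch
    obtained by request. *)
Definition well_formed (b : batch Msg) :=
  uniq (ids b) && (size (ids b) == size (payloads b)).

Lemma unzip1_entries b : well_formed b -> perm_eq (map fst (entries b)) (ids b).
Proof.
case/andP=> _ /eqP sz; have <- : unzip1 (zip (ids b) (payloads b)) = ids b.
  by apply: unzip1_zip; rewrite sz.
by apply: perm_map; rewrite perm_sort.
Qed.

Lemma uniq_entries b : well_formed b -> uniq (map fst (entries b)).
Proof. by move=> wf; rewrite (perm_uniq (unzip1_entries wf)); case/andP: wf. Qed.

Lemma mem_numbered b i k m : (i, k, m) \in numbered b ->
  exists k0, (i, (k0, m)) \in entries b /\ k = odflt k0 (lookup i (stragglers b)).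
Proof. by case/mapP=> [[j [k0 n]]] /= H [-> -> ->]; exists k0. Qed.

Lemma numbered_id b i k m : (i, k, m) \in numbered b -> i \in ids b.
Proof.
case/mem_numbered=> k0 [+ _]; rewrite mem_sort.
elim: (ids b) (payloads b) => [|j s IH] [|p ps] //=; rewrite !inE.
by case/orP=> [/eqP[->]|/IH ->]; rewrite ?eqxx ?orbT.
Qed.

Definition valid_submission (x : submission) : bool :=
  sub_sig x == (sub_client x, StMessage (sub_msg x) (sub_num x)).

Lemma mem_make_batch (subs : seq submission) late e :
  (e \in entries (make_batch ident subs late)) =
  (e \in [seq (sub_id ident x, (batch_number subs, sub_msg x)) | x <- subs]).
Proof. by rewrite mem_sort /= zip_map. Qed.

Lemma well_formed_make_batch (subs : seq submission) late :
  uniq (map (sub_id ident) subs) -> well_formed (make_batch ident subs late).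
Proof. by move=> u; rewrite /well_formed /= u !size_map eqxx. Qed.

Hypothesis ident_inj : injective ident.

(** A sound directory that knows every identifier of the batch agrees with [sub_client] on it,
    [ident] being injective. So an honestly sealed batch passes the checks of any witness with such
    a directory. *)
Lemma sealed_valid_signatures ms (subs : seq submission) (d : nat -> option Client) :
  uniq (map (sub_id ident) subs) -> all valid_submission subs ->
  (forall i chi, d i = Some chi -> ident chi = i) ->
  all (known d) (map (sub_id ident) subs) ->
  let y := seal ident ms subs in
  valid_signatures d (sl_batch y) (sl_aggregate y) (sl_signatures y).
Proof.
move=> u /allP valid dP /allP kn /=; set late := fun _ => _.
have dE z : z \in subs -> d (sub_id ident z) = Some (sub_client z).
  move=> zs; have := kn _ (map_f (sub_id ident) zs); rewrite /known.
  by case E: (d _) => [chi|//] _; rewrite (ident_inj (dP _ _ E)).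
have idI : {in subs &, injective (sub_id ident)} by apply: uniq_map_inj.
apply/and4P; split=> //=.
- by rewrite -!map_comp /=.
- apply/allP=> y /mapP[z + ->]; rewrite mem_filter => /andP[lz zs] /=.
  have eE : lookup (sub_id ident z) (entries (make_batch ident subs late)) =
      Some (batch_number subs, sub_msg z).
    apply: lookup_uniq; first exact/uniq_entries/well_formed_make_batch.
    by rewrite mem_make_batch; apply/mapP; exists z.
  have sE : lookup (sub_id ident z)
      [seq (sub_id ident z', sub_num z') | z' <- subs & late z'] = Some (sub_num z).
    apply: lookup_uniq; last by apply/mapP; exists z; rewrite // mem_filter lz.
    by rewrite -map_comp; apply: subseq_uniq u; exact/map_subseq/filter_subseq.
  by rewrite dE // eE sE; apply: valid.
- suff -> : [seq d i | i <- [seq sub_id ident z | z <- subs] &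
      ~~ is_straggler (make_batch ident subs late) i] =
    [seq Some c | c <- [seq sub_client z | z <- subs & ~~ late z]] by [].
  rewrite filter_map -!map_comp /=.
  rewrite (@eq_in_filter _ _ (fun z => ~~ late z)); last first.
    move=> z zs /=; congr (~~ _); rewrite /is_straggler /= -map_comp.
    apply/mapP/idP => [[z' ]|lz]; last by exists z; rewrite // mem_filter lz.
    by rewrite mem_filter /= => /andP[lz' zs'] /idI ->.
  by apply/eq_in_map => z; rewrite mem_filter => /andP[_ zs]; rewrite /= dE.
Qed.

(** A straggler keeps its submitted number and the others get the maximum of the pool; neither is
    below the submitted number. *)
Lemma sealed_numbered ms (subs : seq submission) z :
  uniq (map (sub_id ident) subs) -> z \in subs ->
  exists2 k, sub_num z <= k &
    (sub_id ident z, k, sub_msg z) \in numbered (sl_batch (seal ident ms subs)).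
Proof.
move=> u zs; have idI : {in subs &, injective (sub_id ident)} by apply: uniq_map_inj.
set b := sl_batch _.
exists (odflt (batch_number subs) (lookup (sub_id ident z) (stragglers b))).
  case E: lookup => [v|] /=; last by rewrite /batch_number; apply: leq_bigmax_seq.
  move/lookup_mem: E => /mapP[z']; rewrite mem_filter => /andP[_ z's] [].
  by move/idI => -> // ->.
apply/mapP; exists (sub_id ident z, (batch_number subs, sub_msg z)) => //.
by rewrite mem_make_batch; apply/mapP; exists z.
Qed.

Lemma import_known (d : nat -> option Client) asg i :
  known d i -> known (import ident d asg) i.
Proof.
elim: asg d => [//|a s IH] d H /=; apply: IH; case: ifP => // _.
by rewrite /known /upd; case: eqP.
Qed.

Lemma import_sound (d : nat -> option Client) asg :
  (forall i chi, d i = Some chi -> ident chi = i) ->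
  forall i chi, import ident d asg i = Some chi -> ident chi = i.
Proof.
elim: asg d => [//|a s IH] d H /=; apply: IH; case: ifP => // /eqP E i chi.
by rewrite /upd; case: eqP => [-> [<-]|_ /H].
Qed.

Lemma import_export (d d0 : nat -> option Client) js i :
  (forall i chi, d0 i = Some chi -> ident chi = i) ->
  i \in js -> known d0 i -> known (import ident d (export d0 js)) i.
Proof.
move=> d0P; elim: js d => [//|j js IH] d; rewrite inE => /orP[/eqP <-|ij] K.
  rewrite /export /=; move: (K); rewrite {1}/known.
  case E: (d0 i) => [chi|//] _ /=; rewrite (d0P _ _ E) eqxx.
  by apply: import_known; rewrite /known /upd eqxx.
rewrite /export /=; case E: (d0 j) => [chi|] /=; exact: IH.
Qed.

(** Identifiers being distinct, the reduction tree has a single leaf for [i], and for a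
    non-straggler it carries the number of the entry itself. So a multi-signature on the root binds
    its signer to this entry. *)
Lemma merkle_leaf_commits b i k m k0 m0 pf : well_formed b ->
  ~~ is_straggler b i -> (i, k, m) \in numbered b ->
  mverify (reduction_root MT b) (Some (i, k0, m0)) pf -> k0 = k /\ m0 = m.
Proof.
move=> wf ns /mem_numbered[k1 [E1 ->]] /mverify_sound/mapP[[j [k2 m2]] E2 [ij ->  ->]].
rewrite -{}ij in E2; rewrite lookup_None //=.
have := lookup_uniq (uniq_entries wf) E1.
by rewrite (lookup_uniq (uniq_entries wf) E2) => -[-> ->].
Qed.

End Batches.

(** * Server invariants *)

Section Protocol.
Variables (f : nat) (Server Broker : finType) (Client Msg : eqType).
Variable MT : merkle (leaf Msg).
Variable ident : Client -> nat.

Notation process := (process Server Broker Client).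
Notation event := (event Server Broker Client MT).
Notation message := (message Server Broker Client MT).
Notation client_state := (client_state Server Broker MT).
Notation broker_state := (broker_state Server Broker Client MT).
Notation server_state := (server_state Server Broker Client MT).
Notation key := (key Broker MT).
Notation effects := (effects Server Broker Client MT).
Notation cert := (cert Server Broker MT).
Notation no_effect := (no_effect Server Broker Client MT).
Notation stmt := (stmt Broker MT).

(** Each kind of process gets one transition function over all events, those of other kinds being
    idle, so that invariants can be proved without the global configuration. *)
Definition client_next (chi : Client) (st : client_state) (e : event) :
    client_state * effects :=
  match e with
  | EvReceive src _ msg => client_receive f ident chi st src msg
  | EvBroadcast _ m beta => client_broadcast ident chi st m beta
  | EvSubmit _ beta => client_submit ident chi st beta
  | _ => (st, no_effect)
  end.

Definition broker_next (beta : Broker) (st : broker_state) (e : event) :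
    broker_state * effects :=
  match e with
  | EvReceive src _ msg => broker_receive f ident beta st src msg
  | EvPool _ i => broker_pool st i
  | EvFlush _ => broker_flush f ident st
  | EvSeal _ i => broker_seal ident st i
  | EvSend _ => broker_send st
  | _ => (st, no_effect)
  end.

Definition server_next (p : Server) (st : server_state) (e : event) :
    server_state * effects :=
  match e with
  | EvReceive src _ msg => server_receive f ident p st src msg
  | EvStobDeliver _ sm => server_stob_deliver f st sm
  | EvComplete _ => server_complete st p
  | _ => (st, no_effect)
  end.

(** The sequence of effective STOB deliveries: completing a batch only moves the border between the
    two parts. [s_completed] has the latest key first, hence [rev]. *)
Definition delivered_keys (st : server_state) : seq key :=
  rev (s_completed st) ++ s_pool st.

Definition numbers (beta : Broker) (s : seq key) : seq nat :=
  [seq kk.2 | kk <- s & kk.1.2 == beta].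

(** [si_stored] confines stored keys to those already delivered and the one currently expected.
    [si_last] keeps the completed entries in a list [ess] pinned by the roots of the keys, since the
    batches may be deleted. *)
Record server_inv (st : server_state) : Prop := ServerInv {
  si_done : forall beta, s_done st beta < s_expnum st beta;
  si_completed : forall beta,
    numbers beta (rev (s_completed st)) = iota 1 (s_done st beta);
  si_pool : forall beta,
    numbers beta (s_pool st) =
    iota (s_done st beta).+1 (s_expnum st beta - (s_done st beta).+1);
  si_root : forall kk b, s_batches st kk = Some b -> batch_root MT b = kk.1.1;
  si_expected : forall beta r, s_exproot st beta = Some r ->
    exists2 b, s_batches st (r, beta, s_expnum st beta) = Some b & well_formed b;
  si_stored : forall kk b, s_batches st kk = Some b ->
    kk.2 < s_expnum st kk.1.2 \/
    kk.2 = s_expnum st kk.1.2 /\ s_exproot st kk.1.2 = Some kk.1.1;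
  si_dir : forall i chi, s_dir st i = Some chi -> ident chi = i;
  si_last : exists ess : seq (seq (nat * nat * Msg)),
    [seq mroot MT (map Some es) | es <- ess] =
      [seq kk.1.1 | kk <- rev (s_completed st)] /\
    s_last st = record_all (fun=> None) (flatten ess) }.

Lemma numbers_delivered st beta : server_inv st ->
  numbers beta (delivered_keys st) = iota 1 (s_expnum st beta).-1.
Proof.
case=> Hd Hc Hp _ _ _ _ _; rewrite /numbers filter_cat map_cat.
rewrite -/(numbers _ _) -/(numbers beta (s_pool st)) Hc Hp -iotaD.
have H := Hd beta; congr iota; lia.
Qed.

Lemma mem_numbers beta (s : seq key) n :
  reflect (exists r, (r, beta, n) \in s) (n \in numbers beta s).
Proof.
apply: (iffP mapP) => [[[[r beta'] n']]|[r H]].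
  by rewrite mem_filter /= => /andP[/eqP -> H] ->; exists r.
by exists (r, beta, n); rewrite ?mem_filter ?eqxx.
Qed.

Lemma delivered_lt st kk : server_inv st -> kk \in delivered_keys st ->
  0 < kk.2 < s_expnum st kk.1.2.
Proof.
case: kk => [[r beta] n] inv H; have : n \in numbers beta (delivered_keys st).
  by apply/mem_numbers; exists r.
rewrite numbers_delivered // mem_iota; have := si_done inv beta; rewrite /=; lia.
Qed.

Lemma delivered_ex st beta n : server_inv st ->
  0 < n < s_expnum st beta -> exists r, (r, beta, n) \in delivered_keys st.
Proof. by move=> inv H; apply/mem_numbers; rewrite numbers_delivered // mem_iota;
    lia. Qed.

Lemma delivered_uniq st : server_inv st -> uniq (delivered_keys st).
Proof.
move=> inv; have: forall beta, uniq (numbers beta (delivered_keys st)).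
  by move=> beta; rewrite numbers_delivered // iota_uniq.
elim: (delivered_keys st) => [//|kk s IH] u /=; apply/andP; split.
  apply/negP=> H; have := u kk.1.2; rewrite /numbers /= eqxx /= => /andP[/negP[]].
  by apply: map_f; rewrite mem_filter eqxx.
by apply: IH => beta; have := u beta; rewrite /numbers /=; case: ifP => //= _ /andP[].
Qed.

(** For each broker, the completed keys and then the pool carry consecutive numbers, so the bare
    counter [s_done] decides membership. *)
Lemma delivered_done st kk : server_inv st -> kk \in delivered_keys st ->
  (kk \in s_completed st) = (kk.2 <= s_done st kk.1.2).
Proof.
case: kk => [[r beta] n] inv; rewrite mem_cat mem_rev /= => /orP[H|H]; last first.
  have: n \in numbers beta (s_pool st) by apply/mem_numbers; exists r.
  rewrite si_pool // mem_iota => Hn; apply/idP/idP => [H'|]; last by lia.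
  have: n \in numbers beta (rev (s_completed st)).
    by apply/mem_numbers; exists r; rewrite mem_rev.
  by rewrite si_completed // mem_iota; lia.
have: n \in numbers beta (rev (s_completed st)).
  by apply/mem_numbers; exists r; rewrite mem_rev.
by rewrite si_completed // mem_iota H; lia.
Qed.

Lemma server_batch_inv st beta num b :
  server_inv st -> server_inv (server_batch st beta num b).1.
Proof.
case: st => d bs en er pool last c dn cp acc inv /=; case: ifP => //=.
case: inv => /= I1 I2 I3 I4 I5 I8 I6 I7 /and5P[H1 /eqP E /eqP H2 H3 H4].
split=> //= [kk b'|beta' r|kk b']; rewrite /upd.
- by case: eqP => [-> [<-]//|_]; apply: I4.
- have [->|ne] := eqVneq beta' beta.
    by move=> [<-]; exists b; rewrite -?E ?eqxx // /well_formed H3.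
  move/I5=> [b' Hb' w]; exists b' => //; case: eqP => // -[_ ]; by move/eqP: ne.
- case: eqP => [-> _ /=|_ /I8]; first by rewrite eqxx; auto.
  by case=> [|[En Er]]; [auto|right; case: eqP Er => // ->; rewrite H2].
Qed.

Lemma server_signatures_inv st p beta r num asg agg sigs :
  server_inv st -> server_inv (server_signatures ident st p beta r num asg agg sigs).1.
Proof.
case: st => d bs en er pool last c dn cp acc [/= I1 I2 I3 I4 I5 I8 I6 I7].
by split=> //=; apply: import_sound.
Qed.

Lemma server_stob_deliver_inv st sm :
  server_inv st -> server_inv (server_stob_deliver f st sm).1.
Proof.
case: st sm => d bs en er pool last c dn cp acc [[beta r] W] inv /=; case: ifP => //= _.
case: inv => /= I1 I2 I3 I4 I5 I8 I6 I7; split=> //= [beta'|beta'|beta' r'|kk b].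
- by have := I1 beta'; rewrite /upd; case: eqP => [->|//]; lia.
- rewrite /numbers filter_rcons /upd /= eq_sym; case: eqP => [->|_]; last exact: I3.
  rewrite map_rcons -/(numbers beta pool) I3 /= -cats1.
  have := I1 beta; set a := (dn beta).+1 => la.
  by rewrite subSn // -addn1 iotaD; congr (_ ++ [:: _]); lia.
- by rewrite /upd; case: eqP => // _; apply: I5.
- by move/I8; rewrite /upd; case: eqP => [->|_] // [|[-> _]]; auto.
Qed.

Lemma server_reply_inv st kk b asg :
  server_inv st -> server_inv (server_reply ident st kk b asg).1.
Proof.
move=> inv; have := delivered_lt inv; case: st inv => d bs en er pool last c dn cp
    acc inv.
move=> lt /=; case: ifP => //= /andP[Hp N].
case: inv => /= I1 I2 I3 I4 I5 I8 I6 I7; split=> //= [kk' b'|beta r H|kk' b'|].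
- case: ifP => [/andP[_ /eqP R]|_]; last exact: I4.
  by rewrite /upd; case: eqP => [-> [<-]//|_]; apply: I4.
- have [b' Hb w] := I5 _ _ H; exists b' => //.
  by case: ifP => // _; rewrite /upd; case: eqP => // E; move: N; rewrite -E Hb.
- case: ifP => _; last exact: I8.
  rewrite /upd; case: eqP => [-> _|_]; last exact: I8.
  (* A requested key sits in the pool, so its number is already passed. *)
  by left; have := lt kk; rewrite /delivered_keys mem_cat Hp orbT => /(_ isT)/andP[].
- exact: import_sound.
Qed.

(** A deleted key is completed, so its number lies below the expected one: the batch of the expected
    root survives. *)
Lemma server_accept_inv st q kk :
  server_inv st -> server_inv (server_accept st q kk).1.
Proof.
move=> inv; have := delivered_lt inv; case: st inv => d bs en er pool last c dn cp acc.
case=> /= I1 I2 I3 I4 I5 I8 I6 I7 lt; split=> //= [kk' b'|beta r H|kk' b'].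
- by case: ifP => _; last exact: I4; rewrite /upd; case: eqP => // _; apply: I4.
- have [b' Hb w] := I5 _ _ H; exists b' => //; case: ifP => // /andP[C _].
  rewrite /upd; case: eqP => // E; have := lt kk; rewrite /delivered_keys mem_cat.
  by rewrite mem_rev C -E /= ltnn andbF => /(_ isT).
- by case: ifP => _; last exact: I8; rewrite /upd; case: eqP => // _; apply: I8.
Qed.

Lemma server_complete_inv st p :
  server_inv st -> server_inv (server_complete st p).1.
Proof.
case: st => d bs en er [|kk pool] last c dn cp acc inv //=.
case Eb: (bs kk) => [b|//].
have := complete_entries_last last (numbered b).
case: (complete_entries _ _) => [[last' ls] dls] /= Elast.
case: inv => /= I1 I2 I3 I4 I5 I8 I6 [ess [Eess El]].
(* The head of the pool carries the first number not yet completed. *)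
have hd : kk.2 = (dn kk.1.2).+1 /\ (dn kk.1.2).+1 < en kk.1.2.
  have := I3 kk.1.2; rewrite /numbers /= eqxx /=; have := I1 kk.1.2.
  by case E: (_ - _) => [|n] //= ? [-> _]; split=> //; lia.
split=> //= [beta|beta|beta|].
- by rewrite /upd; case: eqP => [->|_] //; case: hd.
- rewrite /numbers rev_cons filter_rcons /upd eq_sym; case: eqP => [->|_]; last
    exact: I2.
  rewrite map_rcons -/(numbers _ _) I2 -cats1 -[(dn _).+1]addn1 iotaD.
  by case: hd => /= -> _; rewrite add1n.
- have := I3 beta; rewrite /numbers /= /upd eq_sym; case: eqP => [->|//] /=.
  by case: hd => -> lt; rewrite -subnSK // => -[].
- exists (rcons ess (numbered b)); rewrite map_rcons rev_cons map_rcons Eess.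
  rewrite flatten_rcons record_all_cat -El -Elast; split=> //.
  by rewrite -(I4 _ _ Eb).
Qed.

Lemma server_next_inv p st e : server_inv st -> server_inv (server_next p st e).1.
Proof.
case: e => //= [src _ msg|_ sm|_] inv; last 2 first.
- exact: server_stob_deliver_inv.
- exact: server_complete_inv.
case: src => [c|beta|q]; case: msg => //= *.
- exact: server_batch_inv.
- exact: server_signatures_inv.
- by rewrite /server_witness; case: ifP.
- by rewrite /server_request; case: s_batches.
- exact: server_reply_inv.
- by rewrite /server_collection; case: ifP.
- exact: server_accept_inv.
Qed.

(** * State changes of each process along an execution *)

Variable correct : process -> bool.
Variable dir0 : process -> nat -> option Client.
Variable x : nat -> event.

Notation cf t := (conf f ident dir0 x t).
Notation clt t chi := (clients (cf t) chi).
Notation brk t beta := (brokers (cf t) beta).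
Notation srv t p := (servers (cf t) p).
Notation sent := (sent f ident dir0 x).
Notation signed := (signed f ident dir0 x).
Notation out := (out f ident dir0 x).

Lemma client_cases chi t : clt t.+1 chi = clt t chi \/
  actor (x t) = Some (PClient chi) /\
  clt t.+1 chi = (client_next chi (clt t chi) (x t)).1.
Proof.
rewrite /=; case: (x t) => [|src [c|b|p] msg|c m b|c b|b i|b|b i|b|p sm|p|src dst
    msg|p sm] /=;
  auto; rewrite /upd; case: eqP => [->|_]; by auto.
Qed.

Lemma broker_cases beta t : brk t.+1 beta = brk t beta \/
  actor (x t) = Some (PBroker beta) /\
  brk t.+1 beta = (broker_next beta (brk t beta) (x t)).1.
Proof.
rewrite /=; case: (x t) => [|src [c|b|p] msg|c m b|c b|b i|b|b i|b|p sm|p|src dst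
    msg|p sm] /=;
  auto; rewrite /upd; case: eqP => [->|_]; by auto.
Qed.

Lemma server_cases p t : srv t.+1 p = srv t p \/
  actor (x t) = Some (PServer p) /\
  srv t.+1 p = (server_next p (srv t p) (x t)).1.
Proof.
rewrite /=; case: (x t) => [|src [c|b|q] msg|c m b|c b|b i|b|b i|b|q sm|q|src dst
    msg|q sm] /=;
  auto; rewrite /upd; case: eqP => [->|_]; by auto.
Qed.

Hypothesis exec : execution f ident correct dir0 x.
Hypothesis dir0P : forall a i chi, dir0 a i = Some chi -> ident chi = i.
Hypothesis ident_inj : injective ident.
Hypothesis card_server : #|Server| = 3 * f + 1.
Hypothesis card_faulty : #|[set p : Server | ~~ correct (PServer p)]| <= f.

Lemma client_act chi t : correct (PClient chi) -> actor (x t) = Some (PClient chi) ->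
  clt t.+1 chi = (client_next chi (clt t chi) (x t)).1 /\
  out t = (client_next chi (clt t chi) (x t)).2.
Proof.
rewrite /Defs.out /= => cc; have := exec_enabled exec t.
case: (x t) => [|src [c|b|p] msg|c m b|c b|b i|b|b i|b|p sm|p|src dst msg|p sm] //=
    en [];
  try (by move=> ->; rewrite /upd eqxx).
by move=> E; rewrite E cc in en.
Qed.

Lemma broker_act beta t : correct (PBroker beta) -> actor (x t) = Some (PBroker beta) ->
  brk t.+1 beta = (broker_next beta (brk t beta) (x t)).1 /\
  out t = (broker_next beta (brk t beta) (x t)).2.
Proof.
rewrite /Defs.out /= => cc; have := exec_enabled exec t.
case: (x t) => [|src [c|b|p] msg|c m b|c b|b i|b|b i|b|p sm|p|src dst msg|p sm] //=
    en [];
  try (by move=> ->; rewrite /upd eqxx).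
by move=> E; rewrite E cc in en.
Qed.

Lemma server_act p t : correct (PServer p) -> actor (x t) = Some (PServer p) ->
  srv t.+1 p = (server_next p (srv t p) (x t)).1 /\
  out t = (server_next p (srv t p) (x t)).2.
Proof.
rewrite /Defs.out /= => cc; have := exec_enabled exec t.
case: (x t) => [|src [c|b|q] msg|c m b|c b|b i|b|b i|b|q sm|q|src dst msg|q sm] //=
    en [];
  try (by move=> ->; rewrite /upd eqxx).
- by move=> E; rewrite E cc in en.
- by move=> E; rewrite E cc in en.
Qed.

Lemma server_invariant p t : server_inv (srv t p).
Proof.
elim: t => [|t IH].
  by split=> //= [i chi|]; [exact: dir0P|exists [::]].
case: (server_cases p t) => [->|[_ ->]] //; exact: server_next_inv.
Qed.

(** * Effective deliveries of keys *)

Lemma delivered_next p st e :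
  delivered_keys (server_next p st e).1 = delivered_keys st /\
    s_expnum (server_next p st e).1 = s_expnum st \/
  exists (q : Server) (beta : Broker) r (W : cert), let kk : key := (r, beta,
      s_expnum st beta) in
    [/\ e = EvStobDeliver q (beta, r, W), certifies f W (StWitness kk),
        delivered_keys (server_next p st e).1 = rcons (delivered_keys st) kk &
        s_expnum (server_next p st e).1 =
          upd (s_expnum st) beta (s_expnum st beta).+1].
Proof.
case: e => [|src dst msg|c m b|c b|b i|b|b i|b|q [[beta r] W]|q|src dst msg|q sm] /=;
    auto.
- left; case: src => [c|beta|q]; case: msg => //= *.
  + by case: st => *; rewrite /server_batch; case: ifP.
  + by case: st.
  + by rewrite /server_witness; case: ifP.
  + by rewrite /server_request; case: s_batches.
  + by case: st => *; rewrite /server_reply; case: ifP.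
  + by rewrite /server_collection; case: ifP.
  + by case: st.
- case: st => d bs en er pool last cnt dn cp acc /=; case: ifP => C /=; auto.
  by right; exists q, beta, r, W; split=> //; rewrite /delivered_keys /= rcons_cat.
- left; case: st => d bs en er [|kk pool] last cnt dn cp acc //=.
  case: (bs kk) => [b|//]; case: complete_entries => [[last' ls] dls] /=.
  by rewrite /delivered_keys /= rev_cons cat_rcons.
Qed.

(** An effective delivery: the certificate is for the number expected at that moment. A
    [stob_delivered] message whose certificate does not match leaves the state unchanged. *)
Definition delivers_key p (kk : key) u :=
  exists W, [/\ x u = EvStobDeliver p (kk.1.2, kk.1.1, W),
    certifies f W (StWitness kk) & s_expnum (srv u p) kk.1.2 = kk.2].

Lemma delivered_step p t :
  delivered_keys (srv t.+1 p) = delivered_keys (srv t p) /\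
    s_expnum (srv t.+1 p) = s_expnum (srv t p) \/
  exists kk, [/\ delivers_key p kk t,
    delivered_keys (srv t.+1 p) = rcons (delivered_keys (srv t p)) kk &
    s_expnum (srv t.+1 p) = upd (s_expnum (srv t p)) kk.1.2 kk.2.+1].
Proof.
case: (server_cases p t) => [->|[A ->]]; first by auto.
case: (delivered_next p (srv t p) (x t)) => [|[q [beta [r [W [E C D S]]]]]]; first by
    auto.
right; exists (r, beta, s_expnum (srv t p) beta); split=> //.
by exists W; split=> //; move: A; rewrite E /= => -[->].
Qed.

Lemma delivers_key_step p kk t : delivers_key p kk t ->
  delivered_keys (srv t.+1 p) = rcons (delivered_keys (srv t p)) kk /\
  s_expnum (srv t.+1 p) kk.1.2 = kk.2.+1.
Proof.
case: kk => [[r beta] n] [W [/= E C En]]; rewrite -{}En in C *.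
rewrite /= E /= /upd eqxx; case: (srv t p) C => d bs en er pool last c dn cp acc /= ->.
by rewrite /delivered_keys /= rcons_cat /upd eqxx.
Qed.

Lemma expnum_mono p beta t t' : t <= t' ->
  s_expnum (srv t p) beta <= s_expnum (srv t' p) beta.
Proof.
move=> /subnKC <-; elim: (t' - t) => [|d IH]; rewrite ?addn0 // addnS.
apply: leq_trans IH _; case: (delivered_step p (t + d)) => [[_ ->]//|[kk [[W [_ _
    <-]] _ ->]]].
by rewrite /upd; case: eqP => // ->.
Qed.

Lemma delivered_mono p t t' : t <= t' ->
  exists s, delivered_keys (srv t' p) = delivered_keys (srv t p) ++ s.
Proof.
move=> /subnKC <-; elim: (t' - t) => [|d [s IH]]; first by exists [::]; rewrite addn0
    cats0.
rewrite addnS; case: (delivered_step p (t + d)) => [[-> _]|[kk [_ -> _]]]; first by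
    exists s.
by exists (rcons s kk); rewrite IH rcons_cat.
Qed.

Lemma delivered_split p t s1 kk s2 : delivered_keys (srv t p) = s1 ++ kk :: s2 ->
  exists2 u, u < t & delivers_key p kk u /\ delivered_keys (srv u p) = s1.
Proof.
elim: t s2 => [|t IH] s2; first by case: s1.
case: (delivered_step p t) => [[-> _] /IH[u lt H]|[k' [D -> _]]].
  by exists u => //; apply: leqW.
case/lastP: s2 => [|s2 k2].
  rewrite cats1 => /rcons_inj[E <-]; by exists t.
rewrite -rcons_cons -rcons_cat => /rcons_inj[/IH[u lt H] _].
by exists u => //; apply: leqW.
Qed.

Lemma delivered_keyP p t kk : kk \in delivered_keys (srv t p) ->
  exists2 u, u < t & delivers_key p kk u.
Proof.
move=> H; have [s1 [s2 E]] := mem_cat_cons H; case: (delivered_split E) => u lt [D _].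
by exists u.
Qed.

Lemma delivers_key_mem p kk u t : delivers_key p kk u -> u < t ->
  kk \in delivered_keys (srv t p).
Proof.
move=> /delivers_key_step[E _] lt; case: (delivered_mono p lt) => s ->.
by rewrite mem_cat E mem_rcons mem_head.
Qed.

Lemma correct_signer (A : {set Server}) : f < #|A| ->
  exists2 p, p \in A & correct (PServer p).
Proof.
move=> fA; have: ~~ (A \subset [set p : Server | ~~ correct (PServer p)]).
  by apply/negP=> /subset_leq_card; lia.
by case/subsetPn=> p pA; rewrite inE negbK; exists p.
Qed.

(** Only the handling of a Signatures message produces this statement, after all the checks of a
    witness. The directory is read at [u.+1] because the assignments in the message are imported
    before the checks. *)
Lemma signed_witness p kk u : correct (PServer p) ->
  signed (PServer p) (StWitness kk) u ->
  exists asg agg sigs b,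
  [/\ x u = EvReceive (PBroker kk.1.2) (PServer p) (MSignatures kk.1.1 kk.2 asg agg
      sigs),
      s_exproot (srv u p) kk.1.2 = Some kk.1.1,
      s_expnum (srv u p) kk.1.2 = kk.2,
      s_batches (srv u p) kk = Some b &
      [/\ well_formed b, all (known (s_dir (srv u.+1 p))) (ids b),
      valid_signatures (s_dir (srv u.+1 p)) b agg sigs,
      s_batches (srv u.+1 p) kk = Some b &
      s_exproot (srv u.+1 p) kk.1.2 = Some kk.1.1]].
Proof.
move=> cp [A]; case: (server_act cp A) => E1 E2; rewrite E2 {E2}.
have inv := server_invariant p u; move: (srv u p) (srv u.+1 p) inv E1 => st st' inv ->.
move: A; case: (x u) => [|src dst msg|c m b|c b|b i|b|b i|b|q sm|q|src dst msg|q sm]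
    //= [].
- move=> ->; case: src => [c|beta|q]; case: msg => //=.
  + by move=> n b; case: st inv => d bs en er pool last cnt dn cp' acc inv /=; case:
      ifP.
  + move=> r n asg agg sigs; case: st inv => d bs en er pool last cnt dn cp' acc inv.
    rewrite /server_signatures; case: ifP => // /and3P[/eqP E1 /eqP E2].
    case E3: (bs _) => [b|//] /andP[K V]; rewrite inE => /eqP[->].
    exists asg, agg, sigs, b; split=> //=; split=> //.
    by have [b'] := si_expected inv E1; rewrite /= -E2 E3 => -[->].
  + by move=> r n W; rewrite /server_witness; case: ifP.
  + by move=> k1; rewrite /server_request; case: s_batches.
  + by move=> k1 b asg; case: st inv => d bs en er pool last cnt dn cp' acc inv /=;
      case: ifP.
  + by move=> k1; rewrite /server_collection; case: ifP.
  + by move=> k1; case: st inv.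
- move=> _; case: st inv sm => d bs en er pool last cnt dn cp' acc inv [[beta r] W] /=.
  by case: ifP => //= _; case: ifP.
- move=> _; case: st inv => d bs en er [|k1 pool] last cnt dn cp' acc inv //=.
  by case: (bs k1) => [b|//]; case: complete_entries => [[? ?] ?].
Qed.

(** * Agreement of the correct servers *)

(** Integrity dates a broadcast of the certificate before its delivery, and unforgeability dates the
    signature no later than that broadcast. *)
Lemma signer_signed q beta r W v p : correct (PServer q) ->
  x v = EvStobDeliver q (beta, r, W) ->
  correct (PServer p) -> p \in cert_signers W ->
  exists2 u, u < v & signed (PServer p) (cert_stmt W) u.
Proof.
move=> cq E cp pW; have [q' [w [wv B]]] := stob_integrity (exec_stob exec) cq E.
have [|u uw S] := exec_unforgeable exec (t := w) (a := PServer p) (s := cert_stmt W) cp.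
  right; exists q', (beta, r, W); split=> //=; rewrite /cert_signatures.
  by apply: (In_map (fun p => (PServer p, _))); apply/InP; rewrite mem_enum.
by exists u => //; apply: leq_ltn_trans uw wv.
Qed.

(* A batch numbered n is witnessed by some correct server only after that server
   has delivered the batch numbered n - 1, so total order transports the latter
   in front of every delivery of the former.  In particular duplicated
   deliveries of a message are harmless. *)
Lemma delivery_expnum q beta r W n v : correct (PServer q) ->
  x v = EvStobDeliver q (beta, r, W) -> certifies f W (StWitness (r, beta, n)) ->
  n <= s_expnum (srv v q) beta.
Proof.
elim: n q r W v => [//|n IH] q r W v cq E C.
have /andP[/eqP CW /correct_signer[p pW cp]] := C.
have [u uv S] := signer_signed cq E cp pW; rewrite CW in S.
have [_ [_ [_ [_ [_ _ Eu _ _]]]]] := signed_witness cp S.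
(* Number 1 has no predecessor, but expected numbers start at 1. *)
have [->|n0] := posnP n.
  exact: leq_ltn_trans (leq0n _) (si_done (server_invariant q v) beta).
have [] := @delivered_ex (srv u p) beta n (server_invariant p u); first by rewrite Eu
    /= n0 leqnn.
move=> r' /delivered_keyP[u' u'u [W' [/= E' C' Eu']]].
have ne : (beta, r', W') <> (beta, r, W).
  case=> _ EW; move: C'; rewrite EW /certifies CW => /andP[/eqP[_]]; lia.
have [|w wv Ew] := stob_total_order (exec_stob exec) cp cq ne E' _ E.
  (* Had [p] delivered the new message before its predecessor, it would have signed the witness
     earlier still, with expected number [n.+1]; yet that number is only [n] at [u']. *)
  move=> w wu' Ew; have [u2 u2w] := signer_signed cp Ew cp pW.
  rewrite CW => /(signed_witness cp)[_ [_ [_ [_ [_ _ E2 _ _]]]]].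
  by have := expnum_mono p beta (ltnW (ltn_trans u2w wu')); rewrite Eu' E2 /= ltnn.
have := IH _ _ _ _ cq Ew C'; rewrite leq_eqVlt => /orP[/eqP En|lt]; last first.
  by apply: leq_trans lt _; exact/expnum_mono/ltnW.
have [|_ <-] := @delivers_key_step q (r', beta, n) w; first by exists W'.
exact: expnum_mono.
Qed.

Lemma delivered_expnum p kk u t : delivers_key p kk u -> u < t ->
  kk.2 < s_expnum (srv t p) kk.1.2.
Proof. by move=> /delivers_key_step[_ <-] /(expnum_mono p kk.1.2). Qed.

(** By [delivery_expnum] a certified delivery finds the expected number at least at [kk.2]: if
    equal, it takes effect and raises the number; if larger, the number was passed before. So none
    precedes a time at which [kk.2] is not yet passed. *)
Lemma delivery_first p q kk W v u : correct (PServer p) -> correct (PServer q) ->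
  x v = EvStobDeliver q (kk.1.2, kk.1.1, W) -> certifies f W (StWitness kk) ->
  s_expnum (srv u q) kk.1.2 <= kk.2 -> u <= v.
Proof.
case: kk => [[r beta] n] /= cp cq E C le; rewrite leqNgt; apply/negP => lt.
have := delivery_expnum cq E C; rewrite leq_eqVlt => /orP[/eqP En|ltn].
  have D : delivers_key q (r, beta, n) v by exists W.
  by have := delivered_expnum D lt; rewrite /= ltnNge le.
by have := expnum_mono q beta (ltnW lt); lia.
Qed.

(** If two different messages took effect for one number, total order would make [q] deliver the
    message of [p] before its own, and the number would then be passed too early at [q]. *)
Lemma delivered_message_unique p q r r' beta n W W' u v :
  correct (PServer p) -> correct (PServer q) ->
  x u = EvStobDeliver p (beta, r, W) -> certifies f W (StWitness (r, beta, n)) ->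
  s_expnum (srv u p) beta = n ->
  x v = EvStobDeliver q (beta, r', W') -> certifies f W' (StWitness (r', beta, n)) ->
  s_expnum (srv v q) beta = n -> (beta, r, W) = (beta, r', W').
Proof.
move=> cp cq E C En E' C' En'; apply/eqP/negPn/negP => /eqP ne.
have [|w wv Ew] := stob_total_order (exec_stob exec) cp cq ne E _ E'.
  move=> w wu Ew.
  by have := @delivery_first p p (r', beta, n) W' w u cp cp Ew C'; rewrite /= En
      leqnn leqNgt wu => /(_ isT).
by have := @delivery_first q q (r, beta, n) W w v cq cq Ew C; rewrite /= En' leqnn
    leqNgt wv => /(_ isT).
Qed.

Lemma delivers_key_unique p q r r' beta n u v :
  correct (PServer p) -> correct (PServer q) ->
  delivers_key p (r, beta, n) u -> delivers_key q (r', beta, n) v -> r = r'.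
Proof.
move=> cp cq [W [E C En]] [W' [E' C' En']].
by case: (delivered_message_unique cp cq E C En E' C' En').
Qed.

Lemma delivers_key_inj p kk u v : delivers_key p kk u -> delivers_key p kk v -> u = v.
Proof.
move=> D D'; have [lt|lt|//] := ltngtP u v.
  by have := delivered_expnum D lt; case: D' => W [_ _ ->]; rewrite ltnn.
by have := delivered_expnum D' lt; case: D => W [_ _ ->]; rewrite ltnn.
Qed.

(** The delivery at [q] need not be effective, but afterwards the number of [kk] is passed at [q],
    and by uniqueness the key that passed it is [kk]. *)
Lemma delivery_delivers_key p q kk W u v t : correct (PServer p) -> correct (PServer
    q) ->
  delivers_key p kk u -> x v = EvStobDeliver q (kk.1.2, kk.1.1, W) ->
  certifies f W (StWitness kk) -> v < t -> exists2 w, w < t & delivers_key q kk w.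
Proof.
case: kk => [[r beta] n] /= cp cq D E C vt.
have lt : n < s_expnum (srv t q) beta.
  have := delivery_expnum cq E C; rewrite leq_eqVlt => /orP[/eqP En|ltn].
    by apply: (@delivered_expnum q (r, beta, n) v t) => //; exists W.
  by apply: leq_trans ltn _; exact/expnum_mono/ltnW.
have [] := @delivered_ex (srv t q) beta n (server_invariant q t).
  rewrite lt andbT; case: D => W' [_ _ /= <-].
  exact: leq_ltn_trans (leq0n _) (si_done (server_invariant p u) beta).
move=> r' /delivered_keyP[w wt D']; exists w => //.
by rewrite (delivers_key_unique cp cq D D').
Qed.

Lemma delivers_key_agreement p q kk u : correct (PServer p) -> correct (PServer q) ->
  delivers_key p kk u -> exists v, delivers_key q kk v.
Proof.
move=> cp cq D; have [W [E C En]] := D.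
have [v E'] := stob_agreement (exec_stob exec) cp cq E.
by have [w _ D'] := delivery_delivers_key cp cq D E' C (leqnn v.+1); exists w.
Qed.

(** Lifts total order from STOB messages to keys: the effective message of [b] is the same at both
    servers, and once [q] has delivered the message of [a], the key [a] has taken effect there. *)
Lemma delivers_key_order p q a b u v : correct (PServer p) -> correct (PServer q) ->
  delivers_key p b u -> a \in delivered_keys (srv u p) -> delivers_key q b v ->
  a \in delivered_keys (srv v q).
Proof.
move=> cp cq Db /delivered_keyP[u' u'u Da] Db'.
have [Wa [Ea Ca Ena]] := Da; have [Wb [Eb Cb Enb]] := Db.
have [Wb' [Eb' Cb' Enb']] := Db'.
move: (Eb) (Eb') (Cb') (Cb) Enb Enb'; case: b Db Db' {Eb Eb' Cb' Cb} => [[rb bb] n]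
    Db Db' /= Eb Eb' Cb' Cb Enb Enb'.
have [EW] := delivered_message_unique cp cq Eb Cb Enb Eb' Cb' Enb'; subst Wb'.
have ne : (a.1.2, a.1.1, Wa) <> (bb, rb, Wb).
  case=> _ _ EW'; move: Ca; rewrite EW' => /andP[/eqP Es _]; case/andP: Cb; rewrite
      Es => /eqP[Eab] _.
  by have := delivers_key_inj Db; rewrite -Eab => /(_ _ Da) E; rewrite E ltnn in u'u.
have [|w wv Ew] := stob_total_order (exec_stob exec) cp cq ne Ea _ Eb'.
  move=> w wu' Ew.
  have := @delivery_first p p (rb, bb, n) Wb w u cp cp Ew Cb.
  by rewrite /= Enb leqnn leqNgt (ltn_trans wu' u'u) => /(_ isT).
have [w' w'v D] := delivery_delivers_key cp cq Da Ew Ca wv.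
exact: delivers_key_mem D w'v.
Qed.

(** Induction on the length of the prefix. The last key [a] before [kk] at [p] also precedes [kk] at
    [q], with the same prefix; a key between [a] and [kk] at [q] would precede [kk] at [p] and thus
    occur twice at [q]. *)
Lemma delivered_keys_agree p q kk u v : correct (PServer p) -> correct (PServer q) ->
  delivers_key p kk u -> delivers_key q kk v ->
  delivered_keys (srv u p) = delivered_keys (srv v q).
Proof.
move=> cp cq; move: {2}(size _) (erefl (size (delivered_keys (srv u p)))) => n.
elim: n kk u v => [|n IH] kk u v.
  move/size0nil=> E D D'; rewrite E; case E': (delivered_keys (srv v q)) => [|a s] //.
  by have := @delivers_key_order q p a kk v u cq cp D'; rewrite E E' mem_head => /(_
      isT D).
case/lastP E: (delivered_keys (srv u p)) => [|s a] // + D D'.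
rewrite size_rcons => -[sz].
have [u' u'u [Da Es]] : exists2 u', u' < u & delivers_key p a u' /\ delivered_keys
    (srv u' p) = s.
  by apply: (@delivered_split p u s a [::]); rewrite E cats1.
have /mem_cat_cons[s1 [s2 E']] : a \in delivered_keys (srv v q).
  by apply: (delivers_key_order cp cq D _ D'); rewrite E mem_rcons mem_head.
have [v' v'v [Da' Es']] := delivered_split E'.
have Ess : s = s1 by rewrite -Es -Es'; apply: (IH a) => //; rewrite Es.
rewrite E' -Ess -cats1; case: s2 E' => [//|b s2] E'.
have: b \in delivered_keys (srv v q) by rewrite E' !(mem_cat, inE) eqxx !orbT.
move=> /(delivers_key_order cq cp D')/(_ D); rewrite E mem_rcons inE Ess => bs.
have := delivered_uniq (server_invariant q v); rewrite E' cat_uniq /= => /and3P[_ H].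
case/and3P=> H' _ _; case/orP: bs => [/eqP Eb|bs].
  by move: H'; rewrite ?inE Eb eqxx.
by move: H; rewrite bs ?orbT.
Qed.

Lemma delivers_key_signer p kk v : correct (PServer p) -> delivers_key p kk v ->
  exists q u, [/\ correct (PServer q), u < v & signed (PServer q) (StWitness kk) u].
Proof.
move=> cp [W [E /andP[/eqP CW /correct_signer[q qW cq]] _]].
by have [u uv S] := signer_signed cp E cq qW; exists q, u; rewrite -CW.
Qed.

(** * Completion of the delivered batches *)

(** Fairness as a leads-to rule: if [Q] never came, [P] would persist and keep [e] enabled, so [e]
    would occur and bring [Q]. *)
Lemma fair_leads (P Q : nat -> Prop) (e : event) T : local e -> P T ->
  (forall u, T <= u -> P u -> enabled ident correct (cf u) e) ->
  (forall u, T <= u -> P u -> x u <> e -> P u.+1 \/ Q u.+1) ->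
  (forall u, T <= u -> P u -> x u = e -> Q u.+1) ->
  exists2 u, T <= u & Q u.
Proof.
move=> le PT en stay done; apply: NNPP => nQ.
have {}nQ u : T <= u -> ~ Q u by move=> Tu Qu; apply: nQ; exists u.
have always u : T <= u -> P u.
  move/subnKC <-; elim: (u - T) => [|d IH]; first by rewrite addn0.
  have Td := leq_addr d T; rewrite addnS.
  have [Ee|ne] := classic (x (T + d) = e); first by case: (nQ _ (leqW Td)); apply: done.
  by case: (stay _ Td IH ne) => // /nQ; rewrite leqW // => /(_ isT).
have [u Tu Eu] := exec_fair exec le (fun u Tu => en u Tu (always u Tu)).
by apply: (nQ _ (leqW Tu)); apply: done => //; apply: always.
Qed.

Lemma server_known_mono p t t' i : t <= t' ->
  known (s_dir (srv t p)) i -> known (s_dir (srv t' p)) i.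
Proof.
move=> /subnKC <- K; elim: (t' - t) => [|d IH]; rewrite ?addn0 // addnS.
case: (server_cases p (t + d)) => [->//|[_ ->]].
move: (srv (t + d) p) (x (t + d)) IH => st.
case=> [|src dst msg|c m b|c b|b j|b|b j|b|q sm|q|src dst msg|q sm] //=.
- case: src => [c|beta|q]; case: msg => //=.
  + by move=> n b; case: st => >; rewrite /server_batch; case: ifP.
  + by move=> r n asg agg sigs; case: st => > /=; apply: import_known.
  + by move=> r n W; rewrite /server_witness; case: ifP.
  + by move=> k1; rewrite /server_request; case: (s_batches st k1).
  + move=> k1 b asg; case: st => > /=; case: ifP => //= _; exact: import_known.
  + by move=> k1; rewrite /server_collection; case: ifP.
  + by move=> k1; case: st.
- by case: sm => [[beta r] W]; case: st => > /=; case: ifP.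
- case: st => d0 bs en er [|k1 pool] last cnt dn cp' acc //=.
  by case: (bs k1) => [b|//]; case: complete_entries => [[? ?] ?].
Qed.

Lemma completed_step p t :
  s_completed (srv t.+1 p) = s_completed (srv t p) \/
  exists kk b, [/\ x t = EvComplete p, ohead (s_pool (srv t p)) = Some kk,
    s_batches (srv t p) kk = Some b &
    s_completed (srv t.+1 p) = kk :: s_completed (srv t p)].
Proof.
case: (server_cases p t) => [->|[A ->]]; first by auto.
move: (srv t p) A => st.
case: (x t) => [|src dst msg|c m b|c b|b j|b|b j|b|q sm|q|src dst msg|q sm] //=; auto.
- move=> _; left; case: src => [c|beta|q]; case: msg => //=.
  + by move=> n b; case: st => >; rewrite /server_batch; case: ifP.
  + by move=> r n asg agg sigs; case: st.
  + by move=> r n W; rewrite /server_witness; case: ifP.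
  + by move=> k1; rewrite /server_request; case: (s_batches st k1).
  + by move=> k1 b asg; case: st => > /=; case: ifP.
  + by move=> k1; rewrite /server_collection; case: ifP.
  + by move=> k1; case: st.
- by move=> _; left; case: sm => [[beta r] W]; case: st => > /=; case: ifP.
- case: st => d0 bs en er [|k1 pool] last cnt dn cp' acc /=; auto.
  case E: (bs k1) => [b|]; last by auto.
  case: complete_entries => [[? ?] ?] /= [->]; right; exists k1, b; by rewrite E.
Qed.

Lemma completed_mono p t t' : t <= t' ->
  exists s, s_completed (srv t' p) = s ++ s_completed (srv t p).
Proof.
move=> /subnKC <-; elim: (t' - t) => [|d [s IH]]; first by exists [::]; rewrite addn0.
rewrite addnS; case: (completed_step p (t + d)) => [->|[kk [b [_ _ _ ->]]]]; first by
    exists s.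
by exists (kk :: s); rewrite IH.
Qed.

Lemma completed_mem p t t' kk : t <= t' ->
  kk \in s_completed (srv t p) -> kk \in s_completed (srv t' p).
Proof. by move=> /(completed_mono p)[s ->] H; rewrite mem_cat H orbT. Qed.

Lemma completed_event p t kk : kk \in s_completed (srv t p) ->
  exists u b pool, [/\ u < t, x u = EvComplete p, s_pool (srv u p) = kk :: pool &
    s_batches (srv u p) kk = Some b].
Proof.
elim: t => [//|t IH]; case: (completed_step p t) => [->|[k1 [b [E Eh Eb ->]]]].
  by move/IH=> [u [b [pool [ut E1 E2 E3]]]]; exists u, b, pool; rewrite leqW.
rewrite inE => /orP[/eqP->|/IH[u [b' [pool [ut E1 E2 E3]]]]].
  by move: Eh; case Ep: (s_pool _) => [|k2 pool] //= -[Ek]; subst k2; exists t, b, pool.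
by exists u, b', pool; rewrite leqW.
Qed.

(** A stored batch is never overwritten, only deleted by the last missing acceptance. *)
Lemma batch_step p kk b t : s_batches (srv t p) kk = Some b ->
  s_batches (srv t.+1 p) kk = Some b \/
  exists q, [/\ x t = EvReceive (PServer q) (PServer p) (MCollectionAccept kk),
    q |: s_accepts (srv t p) kk = setT & kk \in s_completed (srv t p)].
Proof.
case: (server_cases p t) => [->|[A ->]]; first by auto.
move: (srv t p) A => st.
case: (x t) => [|src dst msg|c m b1|c b1|b1 j|b1|b1 j|b1|q sm|q|src dst msg|q sm]
    //=; auto.
- move=> [->]; case: src => [c|beta|q]; case: msg => //=; try by auto.
  + move=> n b'; case: st => d0 bs en er pool last cnt dn cp' acc /=; case: ifP =>
      /=; auto.
    move=> /andP[N _] H; left; rewrite /upd; case: eqP => // E.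
    by move: N; rewrite -E H.
  + by move=> r n asg agg sigs; case: st; auto.
  + by move=> r n W; rewrite /server_witness; case: ifP; auto.
  + by move=> k1; rewrite /server_request; case: (s_batches st k1); auto.
  + move=> k1 b' asg; case: st => d0 bs en er pool last cnt dn cp' acc /=; case: ifP
      => /=; auto.
    move=> /andP[_ N] H; left; case: ifP => // _; rewrite /upd; case: eqP => // E.
    by move: N; rewrite -E H.
  + by move=> k1; rewrite /server_collection; case: ifP; auto.
  + move=> k1; case: st => d0 bs en er pool last cnt dn cp' acc /=.
    case: ifP => [/andP[Hk /eqP E] H|]; last by auto.
    rewrite /upd; have [->|] := eqVneq kk k1; last by auto.
    by right; exists q.
- by move=> _; case: sm => [[beta r] W]; case: st => > /=; case: ifP; auto.
- case: st => d0 bs en er [|k1 pool] last cnt dn cp' acc /=; auto.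
  case E: (bs k1) => [b'|]; last by auto.
  case: complete_entries => [[? ?] ?] /= [_]; by auto.
Qed.

Lemma accepts_received p kk q t : q \in s_accepts (srv t p) kk ->
  exists2 u, u < t & x u = EvReceive (PServer q) (PServer p) (MCollectionAccept kk).
Proof.
elim: t => [|t IH]; first by rewrite inE.
have old : q \in s_accepts (srv t p) kk -> exists2 u, u < t.+1 &
    x u = EvReceive (PServer q) (PServer p) (MCollectionAccept kk).
  by case/IH=> u ut; exists u => //; apply: leqW.
case: (server_cases p t) => [->//|[A ->]]; move: (srv t p) A old => st {IH}.
case E: (x t) => [|src dst msg|c m b1|c b1|b1 j|b1|b1 j|b1|p' sm|p'|src dst msg|p'
    sm] //=.
- move=> [Ed]; move: E; rewrite Ed; case: src => [c|beta|q']; case: msg => //=.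
  + by move=> n b' _ old; case: st old => d0 bs en er pool last cnt dn cp' acc /=;
      case: ifP.
  + by move=> r n asg agg sigs _; case: st.
  + by move=> r n W _ old; rewrite /server_witness; case: ifP.
  + by move=> k1 _ old; rewrite /server_request; case: (s_batches st k1).
  + by move=> k1 b' asg _ old; case: st old => d0 bs en er pool last cnt dn cp' acc
      /=; case: ifP.
  + by move=> k1 _ old; rewrite /server_collection; case: ifP.
  + move=> k1 E old; case: st old => d0 bs en er pool last cnt dn cp' acc /= old.
    rewrite /upd; case: eqP => [Ek|_]; last exact: old.
    rewrite inE => /orP[|H]; last by apply: old; rewrite Ek.
    by rewrite inE => /eqP Eq; exists t; rewrite // E Eq Ek.
- move=> _ old; case: sm {E} => [[beta r] W].
  by case: st old => d0 bs en er pool last cnt dn cp' acc old /=; case: ifP.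
- move=> _ old; case: st old => d0 bs en er [|k1 pool] last cnt dn cp' acc //= old.
  by case: (bs k1) => [b'|//]; case: complete_entries => [[? ?] ?].
Qed.

Lemma In_to_servers dst msg msg' :
  List.In (dst, msg) (to_servers msg' : seq (process * message)) -> msg = msg'.
Proof. by rewrite /to_servers => H; have [p _ [_ ->]] := In_mapP H. Qed.

Lemma to_servers_In p msg : List.In (PServer p, msg) (to_servers msg : seq (process *
    message)).
Proof.
apply: (In_map (fun p => (PServer p, msg))).
by apply/InP; rewrite mem_enum.
Qed.

Lemma accept_sent q dst kk t : correct (PServer q) ->
  sent (PServer q) dst (MCollectionAccept kk) t ->
  kk.2 <= s_done (srv t q) kk.1.2.
Proof.
move=> cq [A]; case: (server_act cq A) => _ ->; move: (srv t q) A => st.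
case: (x t) => [|src dst' msg|c m b1|c b1|b1 j|b1|b1 j|b1|p' sm|p'|src dst' msg|p'
    sm] //= [_].
- case: src => [c|beta|q']; case: msg => //=.
  + move=> n b'; case: st => d0 bs en er pool last cnt dn cp' acc /=.
    by case: ifP => //= _ [].
  + move=> r n asg agg sigs; case: st => d0 bs en er pool last cnt dn cp' acc /=.
    by case: ifP => //= _ [].
  + by move=> r n W; rewrite /server_witness; case: ifP.
  + by move=> k1; rewrite /server_request; case: (s_batches st k1) => //= b [].
  + by move=> k1 b' asg; case: st => d0 bs en er pool last cnt dn cp' acc /=; case: ifP.
  + by move=> k1; rewrite /server_collection; case: ifP => //= H [[_ <-]|].
  + by move=> k1; case: st.
- case: st sm => d0 bs en er pool last cnt dn cp' acc [[beta r] W] /=; case: ifP =>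
    //= _.
  by case: ifP => //= _ /In_to_servers.
- case: st => d0 bs en er [|k1 pool] last cnt dn cp' acc //=.
  by case: (bs k1) => [b'|//]; case: complete_entries => [[? ?] ?] /= [|/In_to_servers].
Qed.

(** An acceptance attests only a counter; but correct servers agree on the key of each number, so
    the key that [q] completed under this number is [kk]. *)
Lemma done_completed p q kk u t : correct (PServer p) -> correct (PServer q) ->
  delivers_key p kk u -> kk.2 <= s_done (srv t q) kk.1.2 ->
  kk \in s_completed (srv t q).
Proof.
case: kk => [[r beta] n] cp cq D /= le; have inv := server_invariant q t.
have /= n0 := @delivered_lt (srv u.+1 p) _ (server_invariant p u.+1)
    (delivers_key_mem D (leqnn _)).
have [] := @delivered_ex (srv t q) beta n inv.
  by have := si_done inv beta; lia.
move=> r' H; have [v _ D'] := delivered_keyP H.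
by rewrite (delivers_key_unique cp cq D D') delivered_done.
Qed.

(* A server deletes a batch only after every correct server has completed it. *)
Lemma batch_kept p q kk b u t t' : correct (PServer p) -> correct (PServer q) ->
  delivers_key p kk u -> s_batches (srv t q) kk = Some b -> t <= t' ->
  s_batches (srv t' q) kk = Some b \/ kk \in s_completed (srv t' p).
Proof.
move=> cp cq D E /subnKC <-; elim: (t' - t) => [|d]; first by rewrite addn0; auto.
rewrite addnS => -[|H]; last by right; apply: completed_mem H.
move/batch_step=> [|[q' [Ex Eall _]]]; first by auto.
have [w wt Ew] : exists2 w, w < (t + d).+1 &
    x w = EvReceive (PServer p) (PServer q) (MCollectionAccept kk).
  have: p \in q' |: s_accepts (srv (t + d) q) kk by rewrite Eall inE.
  rewrite !inE => /orP[/eqP ->|/accepts_received[w wt Ew]]; first by exists (t + d).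
  by exists w => //; apply: leqW.
have [w' w'w S] := exec_authentic exec Ew.
right; apply: (@completed_mem p w'); first by apply: ltnW; apply: ltn_trans wt.
exact: (done_completed cp cp D (accept_sent cp S)).
Qed.

(** A server that did not expect the root asks everybody, in particular a correct witness. The
    witness may have deleted the batch, but then [p] has completed it: hence the second
    alternative. *)
Lemma stored_or_completed p kk v : correct (PServer p) -> delivers_key p kk v ->
  exists2 t, v < t & isSome (s_batches (srv t p) kk) \/ kk \in s_completed (srv t p).
Proof.
move=> cp D; have [W [Ex C En]] := D.
have A : actor (x v) = Some (PServer p) by rewrite Ex.
have Dm t : v < t -> kk \in delivered_keys (srv t p) by apply: delivers_key_mem.
have [Er|nEr] := eqVneq (s_exproot (srv v p) kk.1.2) (Some kk.1.1).
  have [b Eb _] := si_expected (server_invariant p v) Er.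
  rewrite En -[(_, _)]/(kk.1.1, kk.1.2, kk.2) -!surjective_pairing in Eb.
  exists v.+1 => //.
  by case: (batch_kept cp cp D Eb (leqnSn v)) => [->|]; auto.
have [q [u [cq uv S]]] := delivers_key_signer cp D.
have [asg [agg [sigs [b [_ _ _ Eb [_ K _ Eb' _]]]]]] := signed_witness cq S.
have Sreq : sent (PServer p) (PServer q) (MRequestBatch kk) v.
  split=> //; case: (server_act cp A) => _ ->; rewrite Ex /=.
  case: kk C En nEr {D Dm Ex S Eb Eb'} => [[r beta] n] /= C En nEr.
  move: (srv v p) En nEr C => [d0 bs en er pool last cnt dn cp' acc] /= -> nEr -> /=.
  by rewrite (negPf nEr); apply: to_servers_In.
have [w vw Ew] := exec_reliable exec cp cq Sreq.
have [Ebw|Cw] := batch_kept cp cq D Eb' (ltn_trans uv vw); last first.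
  by exists w; auto.
have Srep : sent (PServer q) (PServer p)
    (MBatchReply kk b (export (s_dir (srv w q)) (ids b))) w.
  have Aw : actor (x w) = Some (PServer q) by rewrite Ew.
  split=> //; case: (server_act cq Aw) => _ ->.
  by rewrite Ew /= /server_request Ebw /=; auto.
have [w' ww' Ew'] := exec_reliable exec cq cp Srep.
have vw' : v < w' by apply: ltn_trans ww'.
exists w'.+1; first exact: leqW.
have Aw' : actor (x w') = Some (PServer p) by rewrite Ew'.
case: (server_act cp Aw') => -> _; rewrite Ew' /=.
have inv := server_invariant q w.
have := Dm _ vw'; rewrite mem_cat mem_rev.
have root : batch_root MT b == kk.1.1 by rewrite (si_root (server_invariant q u) Eb).
case: (srv w' p) => d0 bs en er pool last cnt dn cp' acc /=.
(* The reply is ignored if the key has left the pool, that is, has been completed, or if the batch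
   is already stored. *)
case: ifP => /= [_ _|nP /orP[|Hp]]; last 2 first.
- by auto.
- by move: nP; rewrite Hp => /negbFE; auto.
left; rewrite root andbT (_ : all _ _); first by rewrite /upd eqxx.
apply/allP=> i ib; apply: import_export => //; first exact: si_dir inv.
by apply: server_known_mono (allP K _ ib); exact: ltn_trans vw.
Qed.

Lemma pool_head_completed p kk pool t : correct (PServer p) ->
  s_pool (srv t p) = kk :: pool -> exists2 t', t <= t' & kk \in s_completed (srv t' p).
Proof.
move=> cp Ep; have Dm : kk \in delivered_keys (srv t p).
  by rewrite /delivered_keys Ep mem_cat mem_head orbT.
have [v vt D] := delivered_keyP Dm.
have [T vT [HT|HT]] := stored_or_completed cp D; last first.
  exists (maxn T t); first exact: leq_maxr.
  by apply: completed_mem HT; apply: leq_maxl.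
case Eb: (s_batches _ _) HT => [b|//] _.
have [nC|C] := boolP (kk \in s_completed (srv (maxn T t) p)); first by exists (maxn T
    t); rewrite ?leq_maxr.
pose P u := kk \notin s_completed (srv u p) /\ ohead (s_pool (srv u p)) = Some kk.
have stored u : T <= u -> kk \notin s_completed (srv u p) ->
    s_batches (srv u p) kk = Some b.
  by move=> Tu /negPf nc; case: (batch_kept cp cp D Eb Tu) => //; rewrite nc.
(* Both histories only grow: if anything has been completed since [t], the head [kk] was the
   first. *)
have head u : t <= u -> kk \notin s_completed (srv u p) ->
    ohead (s_pool (srv u p)) = Some kk.
  move=> tu nc; have := completed_mono p tu; have := delivered_mono p tu.
  rewrite /delivered_keys Ep => -[s Es] [s' Es'].
  move: Es nc; rewrite Es' rev_cat -!catA => /eqP.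
  rewrite eqseq_cat // eqxx /= => /eqP.
  case/lastP: s' {Es'} => [|s' a] /=; first by case: s_pool => // a pool' [->].
  by rewrite rev_rcons /= => -[->] _; rewrite mem_cat mem_rcons mem_head.
have [] := @fair_leads (fun u => kk \notin s_completed (srv u p))
    (fun u => kk \in s_completed (srv u p)) (EvComplete p) (maxn T t) => //.
- move=> u; rewrite geq_max => /andP[Tu tu] nc /=; rewrite cp /= /completable.
  by move: (head _ tu nc) (stored _ Tu nc); case: s_pool => //= k1 ? [->] ->.
- by move=> u _ _ _; case: (kk \in s_completed (srv u.+1 p)); auto.
- move=> u; rewrite geq_max => /andP[Tu tu] nc E.
  have A : actor (x u) = Some (PServer p) by rewrite E.
  case: (server_act cp A) => -> _; rewrite E /=.
  move: (head _ tu nc) (stored _ Tu nc).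
  case: (srv u p) => d0 bs en er [|k1 pool'] last cnt dn cp' acc //= [->] ->.
  by case: complete_entries => [[? ?] ?] /=; rewrite mem_head.
- by move=> u; rewrite geq_max => /andP[_ tu]; exists u.
Qed.

(** The pool is FIFO and the completed keys form a prefix of the delivered ones, so it suffices to
    count completions. *)
Lemma delivered_completed p kk u : correct (PServer p) -> delivers_key p kk u ->
  exists t, kk \in s_completed (srv t p).
Proof.
move=> cp /delivers_key_mem/(_ (leqnn _)); move: u.+1 => {u} t Dm.
suff [t' tt' le] : exists2 t', t <= t' &
    size (delivered_keys (srv t p)) <= size (s_completed (srv t' p)).
  exists t'; have [s Es] := delivered_mono p tt'.
  have: take (size (delivered_keys (srv t p))) (delivered_keys (srv t' p)) =
      delivered_keys (srv t p) by rewrite Es take_size_cat.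
  rewrite {2}/delivered_keys takel_cat ?size_rev // => E.
  by rewrite -mem_rev; rewrite -E in Dm; apply: mem_take Dm.
suff H n : n <= size (delivered_keys (srv t p)) ->
    exists2 t', t <= t' & n <= size (s_completed (srv t' p)) by exact: H.
elim: n => [|n IH] le; first by exists t.
have [t' tt' H] := IH (ltnW le).
move: H; rewrite leq_eqVlt => /orP[/eqP E|H]; last by exists t'.
have [s Es] := delivered_mono p tt'.
have: n < size (delivered_keys (srv t' p)) by rewrite Es size_cat ltn_addr.
rewrite {1}/delivered_keys size_cat size_rev -E -addn1 leq_add2l.
case Ep: (s_pool _) => [//|k1 pool] _.
have [t2 t't2 H] := pool_head_completed cp Ep.
exists t2; first exact: leq_trans t't2.
have [s' Es'] := completed_mono p t't2; rewrite Es' size_cat -E.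
(* If nothing new had been completed, the head of the pool would occur twice among the delivered
   keys. *)
case: s' Es' => [Es'|a s' _ /=]; last by lia.
have := delivered_uniq (server_invariant p t'); rewrite /delivered_keys Ep cat_uniq /=.
by move: H; rewrite Es' mem_rev => ->; rewrite andbF.
Qed.

(** * Correct clients *)

(** What a signature of a client for number [k] and message [m] leaves behind. The state is read
    after the step, since an inclusion raises the counter in the very step that signs. *)
Definition commits chi k m u :=
  c_pending (clt u.+1 chi) = Some m /\ c_seq (clt u.+1 chi) = k.

(** The evidence is left out of [ClientSame]: a certificate that completes nothing may still replace
    it. *)
Variant client_change (chi : Client) (t : nat) (st st' : client_state) : Prop :=
| ClientSame of c_seq st' = c_seq st & c_pending st' = c_pending st &
    c_tried st' = c_tried st & c_used st' = c_used st & c_last st' = c_last st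
| ClientBroadcast m beta of x t = EvBroadcast chi m beta &
    c_pending st = None /\ c_last st <> Some m &
    st' = ClientState (c_seq st) (c_evidence st) (Some m) (beta |: set0)
            [:: (beta, c_seq st)] (Some m) &
    exists E, sent (PClient chi) (PBroker beta) (MSubmission (ident chi, chi) m
        (c_seq st)
                (chi, StMessage m (c_seq st)) E) t
| ClientSubmit m beta of x t = EvSubmit chi beta & c_pending st = Some m &
    st' = ClientState (c_seq st) (c_evidence st) (Some m) (beta |: c_tried st)
            ((beta, c_seq st) :: c_used st) (c_last st) &
    exists E, sent (PClient chi) (PBroker beta) (MSubmission (ident chi, chi) m
        (c_seq st)
                (chi, StMessage m (c_seq st)) E) t
| ClientInclusion m beta k E of c_pending st = Some m & c_seq st <= k &
    st' = ClientState k E (Some m) (c_tried st) ((beta, k) :: c_used st) (c_last st)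
| ClientCompletion m beta r k pf n W of c_pending st = Some m &
    x t = EvReceive (PBroker beta) (PClient chi) (MCompletion r m k pf n W) &
    [/\ certifies f W (StCompletion r n), (beta, k) \in c_used st
      & mverify r (Some (ident chi, k, m)) pf] &
    [/\ c_seq st' = (c_seq st).+1, c_pending st' = None & c_last st' = c_last st].

Lemma client_changeP chi t : correct (PClient chi) ->
  client_change chi t (clt t chi) (clt t.+1 chi).
Proof.
move=> cc; case: (client_cases chi t) => [->|[A ->]]; first exact: ClientSame.
have [_ Eo] := client_act cc A; have := exec_enabled exec t.
have Sent dst msg : List.In (dst, msg) (sends (client_next chi (clt t chi) (x t)).2) ->
    sent (PClient chi) dst msg t by split; rewrite // Eo.
move: A Sent; rewrite /enabled.
case Ex: (x t) => [|src dst msg|c m b|c b|b i|b|b i|b|p sm|p|src dst msg|p sm] //=;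
  try (by move=> *; exact: ClientSame).
- move=> [Ed]; rewrite Ed in Ex *; case: src Ex => [c|beta|q]; case: msg => //=;
    try (by move=> *; exact: ClientSame).
  + move=> m root pf k E _ _ _; rewrite /client_inclusion; case: ifP; last by move=>
      *; exact: ClientSame.
    case/and5P=> /eqP Ep _ _ _ le /=; rewrite Ep. by apply: (@ClientInclusion _ _ _ _
        m beta k E).
  + move=> r m k pf n W Ex _ _; rewrite /client_completion; case: ifP; last by move=>
      *; exact: ClientSame.
    move=> C; case: ifP; last by move=> *; exact: ClientSame.
    move=> /and3P[/eqP Ep U M]; by apply: (ClientCompletion Ep Ex).
- move=> [Ec] Sent; rewrite Ec in Ex * => /and3P[_ /eqP Ep /eqP ne].
  apply: (ClientBroadcast Ex) => //.
  by exists (c_evidence (clt t chi)); apply: Sent; left.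
- move=> [Ec] Sent; rewrite Ec in Ex * => /and3P[_ + _].
  rewrite /client_submit in Sent *; case Ep: (c_pending (clt t chi)) Sent => [m|//]
      Sent _.
  apply: (ClientSubmit Ex Ep) => //.
  by exists (c_evidence (clt t chi)); apply: Sent; left.
Qed.

Section CorrectClient.
Variable chi : Client.
Hypothesis correct_chi : correct (PClient chi).

Lemma client_seq_mono t t' : t <= t' -> c_seq (clt t chi) <= c_seq (clt t' chi).
Proof.
move/subnKC <-; elim: (t' - t) => [|d IH]; rewrite ?addn0 // addnS.
apply: leq_trans IH _.
case: (client_changeP (t + d) correct_chi) => [->|m b _ _ ->|m b _ _ ->|m b k E _ le
    ->|m b r k pf n W _ _ _ [->]] //.
Qed.

(** Becoming idle takes a completion, which increments the counter. *)
Lemma client_seq_lt u t m : u <= t -> c_pending (clt u chi) = Some m ->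
  c_pending (clt t chi) = None -> c_seq (clt u chi) < c_seq (clt t chi).
Proof.
elim: t => [|t IH]; first by rewrite leqn0 => /eqP -> ->.
rewrite leq_eqVlt => /orP[/eqP -> -> //|ut] Ep.
case: (client_changeP t correct_chi) => [-> ->|m' b _ _ ->|m' b _ _ ->|m' b k E _ le
    ->|m' b r k pf n W _ _ _ [-> _ _]] //.
  by move=> _ _ _; exact: IH.
by move=> _; apply: client_seq_mono.
Qed.

Lemma client_last t m : c_pending (clt t chi) = Some m -> c_last (clt t chi) = Some m.
Proof.
elim: t m => [//|t IH] m.
case: (client_changeP t correct_chi) => [_ -> _ _ ->|m' b _ _ ->|m' b _ Ep -> _|m' b
    k E Ep le ->|m' b r k pf n W _ _ _ [_ ->]] //=.
- exact: IH.
- by rewrite (IH _ Ep).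
- by rewrite (IH _ Ep).
Qed.

Lemma client_last_None u t : u <= t -> c_last (clt t chi) = None ->
  c_last (clt u chi) = None.
Proof.
move/subnKC <-; elim: (t - u) => [|d IH]; rewrite ?addn0 // addnS => H; apply: IH;
    move: H.
case: (client_changeP (u + d) correct_chi) => [_ _ _ _ ->|m' b _ _ ->|m' b _ Ep ->
    _|m' b k E Ep le ->|m' b r k pf n W _ _ _ [_ _ ->]] //=.
Qed.

(** The used numbers are reset at each broadcast, so each of them was taken since then, between the
    counter values then and now. *)
Lemma client_period T m : c_pending (clt T chi) = Some m ->
  exists tb beta, [/\ tb < T, x tb = EvBroadcast chi m beta,
    c_pending (clt tb chi) = None,
    forall u, tb < u <= T -> c_pending (clt u chi) = Some m &
    forall b k, (b, k) \in c_used (clt T chi) ->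
      c_seq (clt tb chi) <= k <= c_seq (clt T chi)].
Proof.
elim: T m => [//|T IH] m ET.
have step : c_pending (clt T chi) = Some m ->
    (forall b k, (b, k) \in c_used (clt T.+1 chi) -> (b, k) \in c_used (clt T chi) \/
      c_seq (clt T chi) <= k <= c_seq (clt T.+1 chi)) ->
  exists tb beta, [/\ tb < T.+1, x tb = EvBroadcast chi m beta,
    c_pending (clt tb chi) = None,
    forall u, tb < u <= T.+1 -> c_pending (clt u chi) = Some m &
    forall b k, (b, k) \in c_used (clt T.+1 chi) ->
      c_seq (clt tb chi) <= k <= c_seq (clt T.+1 chi)].
  move=> Ep U; have [tb [beta [lt E N P B]]] := IH _ Ep.
  exists tb, beta; split=> //; first exact: leqW.
    by move=> u /andP[tu]; rewrite leq_eqVlt => /orP[/eqP->//|uT]; apply: P; rewrite tu.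
  have m1 := client_seq_mono (ltnW lt); have m2 := client_seq_mono (leqnSn T).
  by move=> b k /U[/B|]; lia.
case: (client_changeP T correct_chi).
- move=> _ Ep _ Eu _; apply: step; first by rewrite -Ep.
  by move=> b k; rewrite Eu; auto.
- move=> m' b Ex [N _] E _; have [Em] : Some m' = Some m by rewrite -ET E.
  subst m'.
  exists T, b; split=> //.
    by move=> u /andP[Tu uT]; have -> : u = T.+1; [lia|rewrite E].
  by move=> b' k; rewrite E inE => /eqP[_ ->]; rewrite leqnn.
- move=> m' b Ex Ep E _; have [Em] : Some m' = Some m by rewrite -ET E.
  subst m'.
  by apply: step => // b' k; rewrite E inE => /orP[/eqP[_ ->]|]; rewrite ?leqnn; auto.
- move=> m' b k E Ep le Es; have [Em] : Some m' = Some m by rewrite -ET Es.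
  subst m'.
  by apply: step => // b' k'; rewrite Es inE => /orP[/eqP[_ ->]|]; rewrite /= ?leqnn
      ?le; auto.
- by move=> m' b r k pf n W _ _ _ [_ E _]; rewrite E in ET.
Qed.

(** The dual of [client_period]: an idle client that has broadcast before is traced back to its last
    completion. *)
Lemma client_previous t m : c_pending (clt t chi) = None -> c_last (clt t chi) = Some
    m ->
  exists t1, [/\ t1 < t, c_pending (clt t1 chi) = Some m,
    c_seq (clt t chi) = (c_seq (clt t1 chi)).+1,
    forall u, t1 < u <= t -> c_pending (clt u chi) = None &
    exists beta r k pf n W,
    [/\ x t1 = EvReceive (PBroker beta) (PClient chi) (MCompletion r m k pf n W),
     certifies f W (StCompletion r n), (beta, k) \in c_used (clt t1 chi) &
     mverify r (Some (ident chi, k, m)) pf]].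
Proof.
elim: t => [//|t IH] EN EL; move: (EN) (EL).
case: (client_changeP t correct_chi) => [Es Ep _ _ El|m' b _ _ ->|m' b _ Ep -> _|m' b
    k E Ep le ->|m' b r k pf n W Ep Ex [C U M] [Es _ El]] //=.
  rewrite Ep El => EN' EL'; have [t1 [lt P S N X]] := IH EN' EL'.
  exists t1; split=> //; [exact: leqW|by rewrite Es|].
  by move=> u /andP[tu]; rewrite leq_eqVlt => /orP[/eqP->//|uT]; apply: N; rewrite tu.
rewrite El => _; rewrite (client_last Ep) => -[Em]; subst m'.
exists t; split=> //; last by exists b, r, k, pf, n, W.
by move=> u /andP[Tu uT]; have -> : u = t.+1; [lia|].
Qed.

(** A broadcast resets [c_tried] to the broker of its first submission, so every tried broker has
    been sent the current message. *)
Lemma client_submitted t0 m beta0 T beta : x t0 = EvBroadcast chi m beta0 -> t0 < T ->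
  (forall u, t0 < u <= T -> c_pending (clt u chi) = Some m) ->
  beta \in c_tried (clt T chi) ->
  exists u s E, [/\ t0 <= u, c_seq (clt t0 chi) <= s &
    sent (PClient chi) (PBroker beta)
      (MSubmission (ident chi, chi) m s (chi, StMessage m s) E) u].
Proof.
move=> Ex; elim: T => [//|T IH]; rewrite ltnS leq_eqVlt => /orP[/eqP ET|lt] P.
  rewrite -{}ET in P *; case: (client_changeP t0 correct_chi) => [_ Ep _ _ _|m' b Ex'
      _ -> [E S]|m' b Ex'|m' b k E Ep|m' b r k pf n W _ Ex'];
    try by rewrite Ex in Ex'.
  - have := exec_enabled exec t0; rewrite Ex /= -Ep P ?ltnSn ?leqnn //.
    by rewrite andbF.
  - move: Ex'; rewrite Ex => -[Em _]; subst m'.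
    by rewrite /= setU0 inE => /eqP ->; exists t0, (c_seq (clt t0 chi)), E.
  - by have := exec_enabled exec t0; rewrite Ex /= Ep /= andbF.
have Pu u : t0 < u <= T -> c_pending (clt u chi) = Some m.
  by move=> /andP[a b]; apply: P; rewrite a leqW.
have PT : c_pending (clt T chi) = Some m by apply: Pu; rewrite lt leqnn.
have PT1 : c_pending (clt T.+1 chi) = Some m by apply: P; rewrite leqnn ltnS ltnW.
have le := client_seq_mono (ltnW lt); move: PT1.
case: (client_changeP T correct_chi) => [_ _ -> _ _ _|m' b _ [N _]|m' b _ Ep -> [E S]
    _|m' b k E Ep _ -> _|m' b r k pf n W _ _ _ [_ ->]] //=.
- exact: IH.
- by rewrite PT in N.
- move: Ep; rewrite PT => -[Em]; subst m'; rewrite !inE => /orP[/eqP->|]; last exact: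
    IH.
  by exists T, (c_seq (clt T chi)), E; split=> //; apply: ltnW.
- exact: IH.
Qed.

Lemma signed_message_commits m k u :
  signed (PClient chi) (StMessage m k) u -> commits chi k m u.
Proof.
move=> [A]; rewrite /commits; case: (client_act correct_chi A) => -> ->.
move: (clt u chi) A => st.
case: (x u) => [|src dst msg|c m' b|c b|b i|b|b i|b|p sm|p|src dst msg|p sm] //=.
- move=> _; case: src => [c|beta|q]; case: msg => //=.
    by move=> >; rewrite /client_inclusion; case: ifP => //= _; rewrite inE => /eqP.
  by move=> >; rewrite /client_completion; case: ifP => // _; case: ifP.
- by move=> _; rewrite inE => /eqP[-> ->].
- by move=> _; rewrite /client_submit; case: (c_pending st) => //= m'; rewrite inE =>
    /eqP[-> ->].
Qed.

Lemma signed_reduction_commits r u : signed (PClient chi) (StReduction r) u ->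
  exists k m pf, mverify r (Some (ident chi, k, m)) pf /\ commits chi k m u.
Proof.
move=> [A]; rewrite /commits; case: (client_act correct_chi A) => -> ->.
move: (clt u chi) A => st.
case: (x u) => [|src dst msg|c m' b|c b|b i|b|b i|b|p sm|p|src dst msg|p sm] //=.
- move=> _; case: src => [c|beta|q]; case: msg => //=.
    move=> m r' pf k E; rewrite /client_inclusion; case: ifP => // /and5P[/eqP Ep _ M
        _ _].
    by rewrite inE => /eqP[->]; exists k, m, pf.
  by move=> >; rewrite /client_completion; case: ifP => // _; case: ifP.
- by move=> _; rewrite /client_submit; case: (c_pending st).
Qed.

(* The individual and aggregate signatures checked by a witness bind the correct
   client to the entry, since identifiers are distinct within the batch. *)
Lemma witness_commits p kk u es k m : correct (PServer p) ->
  signed (PServer p) (StWitness kk) u -> mroot MT (map Some es) = kk.1.1 ->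
  (ident chi, k, m) \in es -> exists2 w, w < u & commits chi k m w.
Proof.
move=> cp S R He; have [asg [agg [sigs [b [Ex _ _ Eb [wf K V _ _]]]]]] :=
    signed_witness cp S.
have Eroot := si_root (server_invariant p u) Eb.
have {es R}He : (ident chi, k, m) \in numbered b.
  move: Eroot; rewrite -R => /mroot_inj/inj_map -> //; by move=> ? ? [].
have [w wu Sent] := exec_authentic exec Ex.
(* Even a faulty broker can only relay signatures that exist when it sends its message. *)
have forge s : List.In (PClient chi, s)
    (message_signatures (MSignatures kk.1.1 kk.2 asg agg sigs : message)) ->
    exists2 w', w' < u & signed (PClient chi) s w'.
  move=> Hs; have [|w' w'w Sw] := exec_unforgeable exec (t := w) (a := PClient chi)
      (s := s) correct_chi.
    by left; do 3 eexists; split; [exact: Sent|exact: Hs].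
  by exists w' => //; apply: leq_ltn_trans wu.
have dE : s_dir (srv u.+1 p) (ident chi) = Some chi.
  have := allP K _ (numbered_id He); rewrite /known; case Ed: (s_dir _ _) => [c|//] _.
  by rewrite (ident_inj (si_dir (server_invariant p u.+1) Ed)).
case/and4P: V => V1 V2 /eqP V3 V4.
have [ns|st] := boolP (~~ is_straggler b (ident chi)).
  have : chi \in agg.2.
    rewrite -(mem_map (f := Some)); last by move=> ? ? [].
    rewrite (perm_mem V4) -dE; apply: map_f; rewrite mem_filter ns.
    exact: numbered_id He.
  move=> Hc; have [|w' w'u Sw] := forge (StReduction (reduction_root MT b)).
    apply: List.in_or_app; left; rewrite -V3.
    by apply: (In_map (fun c => (PClient c, agg.1))); apply/InP.
  have [k0 [m0 [pf [M C]]]] := signed_reduction_commits Sw.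
  by have [<- <-] := merkle_leaf_commits wf ns He M; exists w'.
have [k0 [E1 E2]] := mem_numbered He.
move: st; rewrite negbK /is_straggler; rewrite -(perm_mem V1) => /mapP[[i sg] Hsg /=
    Ei].
have := allP V2 _ Hsg; rewrite /= -Ei dE (lookup_uniq (uniq_entries wf) E1).
case El: lookup E2 => [k'|//] /= -> /eqP Esg.
have [|w' w'u Sw] := forge (StMessage m k').
  apply: List.in_or_app; right.
  have := @In_map _ _ (fun y : nat * client_sig Broker Client MT =>
    (PClient y.2.1 : process, y.2.2)) (i, sg) sigs; rewrite /= Esg; apply.
  by rewrite -Esg; apply/InP.
by exists w' => //; apply: signed_message_commits.
Qed.

End CorrectClient.

(** * Correct brokers *)

(** What an honest batch needs to pass the checks of a witness, relative to the assignments that the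
    broker can export. *)
Definition good_pool (d : nat -> option Client)
    (subs : seq (submission Server Broker Client MT)) : bool :=
  [&& uniq (map (sub_id ident) subs), all (@valid_submission _ _ _ _ _) subs
    & all (known d) (map (sub_id ident) subs)].

Definition good_sealed (d : nat -> option Client) (y : sealed Broker Client MT) :=
  exists ms subs, y = seal ident ms subs /\ good_pool d subs.

(** [bi_reducing] bounds the ranks in use by [b_flushes], so that no flush overwrites a running
    reduction; [bi_numbers] makes each number name one batch. *)
Record broker_inv (st : broker_state) : Prop := BrokerInv {
  bi_dir : forall i c, b_dir st i = Some c -> ident c = i;
  bi_queue : forall i z, z \in b_queue st i ->
    [&& valid_submission z, sub_id ident z == i & known (b_dir st) i];
  bi_pool : good_pool (b_dir st) (b_pool st);
  bi_reducing : forall i subs, b_reducing st i = Some subs ->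
    i < b_flushes st /\ good_pool (b_dir st) subs;
  bi_outbox : forall y, y \in b_outbox st -> good_sealed (b_dir st) y;
  bi_sent : forall n y, (n, y) \in b_sent st -> good_sealed (b_dir st) y;
  bi_num : b_num st = (size (b_sent st)).+1;
  bi_numbers : map fst (b_sent st) = rev (iota 1 (size (b_sent st))) }.

Lemma good_pool_mono (d d' : nat -> option Client) subs :
  (forall i, known d i -> known d' i) -> good_pool d subs -> good_pool d' subs.
Proof.
by move=> dd' /and3P[u v k]; rewrite /good_pool u v; apply: sub_all k.
Qed.

Lemma good_sealed_mono (d d' : nat -> option Client) y :
  (forall i, known d i -> known d' i) -> good_sealed d y -> good_sealed d' y.
Proof.
by move=> dd' [ms [subs [-> g]]]; exists ms, subs; split=> //; apply: good_pool_mono g.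
Qed.

(** In [BrokerQueue] the assignment is imported even when the submission is refused, hence the
    disjunctions. *)
Variant broker_change (beta : Broker) (t : nat) (st st' : broker_state) : Prop :=
| BrokerSame of b_queue st' = b_queue st & b_pool st' = b_pool st &
    b_flushes st' = b_flushes st & b_reducing st' = b_reducing st &
    (b_outbox st' = b_outbox st /\ b_num st' = b_num st /\ b_sent st' = b_sent st) &
    b_dir st' = b_dir st
| BrokerQueue a z of b_queue st' = upd (b_queue st) a.1 (rcons (b_queue st a.1) z) \/
      b_queue st' = b_queue st &
    b_pool st' = b_pool st &
    b_flushes st' = b_flushes st & b_reducing st' = b_reducing st &
    (b_outbox st' = b_outbox st /\ b_num st' = b_num st /\ b_sent st' = b_sent st) &
    b_dir st' = import ident (b_dir st) [:: a] /\
    (b_queue st' = b_queue st \/ [&& ident a.2 == a.1, sub_client z == a.2 &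
        valid_submission z])
| BrokerPool i y q of x t = EvPool beta i & b_queue st i = y :: q &
    i \notin map (sub_id ident) (b_pool st) &
    st' = BrokerState (b_dir st) (upd (b_queue st) i q) (rcons (b_pool st) y)
            (b_flushes st) (b_reducing st) (b_reduced st) (b_outbox st) (b_num st)
            (b_sent st) (b_witnesses st) (b_completions st)
| BrokerFlush of x t = EvFlush beta &
    st' = BrokerState (b_dir st) (b_queue st) [::] (b_flushes st).+1
            (upd (b_reducing st) (b_flushes st) (Some (b_pool st))) (b_reduced st)
            (b_outbox st) (b_num st) (b_sent st) (b_witnesses st) (b_completions st)
| BrokerSeal i subs of x t = EvSeal beta i & b_reducing st i = Some subs &
    st' = BrokerState (b_dir st) (b_queue st) (b_pool st) (b_flushes st)
            (upd (b_reducing st) i None) (b_reduced st)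
            (rcons (b_outbox st) (seal ident (b_reduced st) subs)) (b_num st)
            (b_sent st) (b_witnesses st) (b_completions st)
| BrokerSend y ob of x t = EvSend beta & b_outbox st = y :: ob &
    previous_delivered correct (cf t) beta &
    st' = BrokerState (b_dir st) (b_queue st) (b_pool st) (b_flushes st)
            (b_reducing st) (b_reduced st) ob (b_num st).+1
            ((b_num st, y) :: b_sent st) (b_witnesses st) (b_completions st).

Lemma broker_submission_change beta t st a m s sg E :
  broker_change beta t st (broker_submission f ident st a m s sg E).1.
Proof.
case: st => d q pl fl red ms ob num sn wit compl.
apply: (@BrokerQueue _ _ _ _ a (Submission a.2 m s sg E)) => //=.
  by case: ifP => _; auto.
split=> //; case: ifP => [/and3P[-> /eqP Hsg _]|_]; last by left.
by right; rewrite eqxx /valid_submission /= Hsg.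
Qed.

Section CorrectBroker.
Variable beta : Broker.
Hypothesis correct_beta : correct (PBroker beta).

Lemma broker_changeP t : broker_change beta t (brk t beta) (brk t.+1 beta).
Proof.
case: (broker_cases beta t) => [->|[A ->]]; first exact: BrokerSame.
have := exec_enabled exec t.
move: A; rewrite /enabled.
case Ex: (x t) => [|src dst msg|c m b|c b|b i|b|b i|b|p sm|p|src dst msg|p sm] //=;
  try (by move=> *; exact: BrokerSame).
- move=> _ _; case: (brk t beta) => d q pool fl red ms ob num sn wit compl.
  case: src {Ex} => [c|b|q']; case: msg => //=;
    try (by move=> *; exact: BrokerSame).
  + by move=> a m s sg E; exact: broker_submission_change.
  + by move=> [c' [m k|r|kk|r n]] /=; exact: BrokerSame.
  + by move=> a m s sg E; exact: broker_submission_change.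
  + by move=> a m s sg E; exact: broker_submission_change.
  + move=> r u; rewrite /broker_acquired; case: (ohead _) => [[n y]|]; exact:
      BrokerSame.
  + move=> [p [m k|r|[[r b'] n]|r n]] /=; try exact: BrokerSame.
    by case: ifP => _; exact: BrokerSame.
  + move=> [[r b'] n] [p s] exc /=; case: (lookup _ _) => [y|]; last exact: BrokerSame.
    by case: s => [m k|r'|kk|r' n'] /=; try exact: BrokerSame; case: ifP => _; exact:
        BrokerSame.
- move=> [Eb]; rewrite Eb in Ex * => /andP[_ /andP[]].
  case: (brk t beta) => d q pool fl red ms ob num sn wit compl /=.
  case Eq: (q i) => [//|y q_i] _ ni; exact: (@BrokerPool _ _ _ _ i y q_i).
- move=> [Eb]; rewrite Eb in Ex * => _.
  by case: (brk t beta) => d q pool fl red ms ob num sn wit compl; exact: BrokerFlush.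
- move=> [Eb]; rewrite Eb in Ex * => /andP[_].
  case: (brk t beta) => d q pool fl red ms ob num sn wit compl /=.
  case Er: (red i) => [subs|//] _; exact: (@BrokerSeal _ _ _ _ i subs).
- move=> [Eb]; rewrite Eb in Ex * => /and3P[_].
  move: (@BrokerSend beta t (brk t beta)).
  case: (brk t beta) => d q pool fl red ms ob num sn wit compl /=.
  by case: ob => [//|y ob] H _ P; apply: (H _ y ob).
Qed.

Lemma broker_invariant t : broker_inv (brk t beta).
Proof.
elim: t => [|t IH]; first by split=> //= i c; exact: dir0P.
case: IH => I1 I2 I3 I4 I5 I6 I7 I8.
case: (broker_changeP t).
- move=> Eq Ep Ef Er [Eo [En Es]] Ed.
  by split; rewrite ?Ed ?Ep ?Eq ?Er ?Ef ?Eo ?Es ?En.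
- move=> a z Eq Ep Ef Er [Eo [En Es]] [Ed Hz].
  have kd i : known (b_dir (brk t beta)) i -> known (b_dir (brk t.+1 beta)) i.
    by rewrite Ed; apply: import_known.
  split; rewrite ?Ep ?Es ?En //.
  + by rewrite Ed; apply: import_sound.
  + move=> i z'; have old : z' \in b_queue (brk t beta) i ->
        [&& valid_submission z', sub_id ident z' == i & known (b_dir (brk t.+1 beta))
            i].
      by move/I2 => /and3P[-> -> /kd ->].
    case: Hz => [->|/and3P[/eqP Ea /eqP Ec V]]; first exact: old.
    case: Eq => [->|->]; last exact: old.
    rewrite /upd; case: eqP => [->|_]; last exact: old.
    rewrite mem_rcons inE => /orP[/eqP->|/I2/and3P[-> -> /kd ->//]].
    by rewrite V /sub_id Ec Ea eqxx Ed /= Ea eqxx /known /upd eqxx.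
  + exact: good_pool_mono I3.
  + by move=> i subs; rewrite Er Ef => /I4[-> /(good_pool_mono kd)].
  + by move=> y; rewrite Eo => /I5/(good_sealed_mono kd).
  + by move=> n y /I6/(good_sealed_mono kd).
- move=> i y q Ex Eq ni ->; split=> //=.
  + move=> j z; rewrite /upd; case: eqP => [->|_]; last exact: I2.
    by move=> zq; apply: I2; rewrite Eq inE zq orbT.
  + have /and3P[V /eqP Ey K] := I2 i y (eq_ind_r (fun s => y \in s) (mem_head y q) Eq).
    case/and3P: I3 => u v k.
    by rewrite /good_pool map_rcons rcons_uniq !all_rcons Ey ni u V v K k.
- move=> Ex ->; split=> //= i subs; rewrite /upd; case: eqP => [-> [<-]|_ /I4[lt g]] //.
  by split=> //; apply: leqW.
- move=> i subs Ex Er ->; split=> //= [j subs'|y].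
    by rewrite /upd; case: eqP => // _; apply: I4.
  rewrite mem_rcons inE => /orP[/eqP->|]; last exact: I5.
  by exists (b_reduced (brk t beta)), subs; split=> //; case: (I4 _ _ Er).
- move=> y ob Ex Eo _ ->; split=> //=.
  + by move=> z zo; apply: I5; rewrite Eo inE zo orbT.
  + by move=> n z; rewrite inE => /orP[/eqP[_ ->]|]; [apply: I5; rewrite Eo
      mem_head|apply: I6].
  + by rewrite I7.
  + by rewrite -[1 :: _]/(iota 1 (size _).+1) rev_iota1S I8 I7.
Qed.

(** * Progress of a submission inside the broker *)

Notation queue t i := (b_queue (brk t beta) i).
Notation pool t := (b_pool (brk t beta)).

(** Two rounds of fairness. While the pool holds a submission of [i], a flush stays enabled and
    empties it; afterwards only pooling for [i] itself can take the place, so that event stays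
    enabled. The suffix is existential because the queue may grow meanwhile. *)
Lemma queue_head_pooled T i y s s' : queue T i = y :: s ++ s' ->
  exists2 u, T <= u & y \in pool u /\ exists s2, queue u i = s ++ s2.
Proof.
move=> E0.
have [u Tu [[s1 E1] ni]] : exists2 u, T <= u &
    (exists s1, queue u i = y :: s ++ s1) /\ i \notin map (sub_id ident) (pool u).
  have [ni|ip] := boolP (i \notin map (sub_id ident) (pool T)).
    by exists T => //; split=> //; exists s'.
  apply: (@fair_leads (fun u => (exists s1, queue u i = y :: s ++ s1) /\
    i \in map (sub_id ident) (pool u)) _ (EvFlush beta)) => //.
  - by split; [exists s'|rewrite negbK in ip].
  - by move=> u _ [_ H]; rewrite /= correct_beta; case: b_pool H.
  - move=> u _ [[s1 E1] H] ne.
    case: (broker_changeP u) => [-> -> _ _ _ _|a z Eq -> _ _ _ _|j z q Ex Eq nj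
        ->|//|j subs _ _ ->|z ob _ _ _ ->] /=.
    + by left; split=> //; exists s1.
    + left; split=> //; case: Eq => ->; last by exists s1.
      rewrite /upd; case: eqP => [<-|_]; last by exists s1.
      by exists (rcons s1 z); rewrite E1 rcons_cons rcons_cat.
    + left; split; last by rewrite map_rcons mem_rcons inE H orbT.
      exists s1; rewrite /upd; case: eqP => // Ei.
      by move: nj; rewrite -Ei H.
    + by left; split=> //; exists s1.
    + by left; split=> //; exists s1.
  - move=> u _ [[s1 E1] H] Eu.
    case: (broker_changeP u) => [_ Ep _ _ _ _|a z _ Ep _ _ _ _|j z q Ex|_ ->|j subs
        Ex|z ob Ex];
      try by rewrite Eu in Ex.
    + case: (broker_act correct_beta (t := u)); rewrite Eu //= => Es _.
      move: Es E1; case: (brk u beta) => d q pl fl red ms ob num sn wit compl /= ->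
          /= E1.
      by split=> //; exists s1.
    + case: (broker_act correct_beta (t := u)); rewrite Eu //= => Es _.
      move: Es E1; case: (brk u beta) => d q pl fl red ms ob num sn wit compl /= ->
          /= E1.
      by split=> //; exists s1.
    + by split=> //=; exists s1.
suff [v uv H] : exists2 v, u <= v & y \in pool v /\ exists s2, queue v i = s ++ s2.
  by exists v => //; apply: leq_trans uv.
apply: (@fair_leads (fun u => (exists s1, queue u i = y :: s ++ s1) /\
  i \notin map (sub_id ident) (pool u)) _ (EvPool beta i)) => //.
- by split=> //; exists s1.
- by move=> v _ [[s2 E2] H]; rewrite /= correct_beta /poolable E2 H.
- move=> v _ [[s2 E2] H] ne.
  case: (broker_changeP v) => [-> -> _ _ _ _|a z Eq -> _ _ _ _|j z q Ex Eq nj ->|_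
      ->|j subs _ _ ->|z ob _ _ _ ->] /=;
    try by left; split=> //; exists s2.
  + left; split=> //; case: Eq => ->; last by exists s2.
    rewrite /upd; case: eqP => [<-|_]; last by exists s2.
    by exists (rcons s2 z); rewrite E2 rcons_cons rcons_cat.
  + have nij : i != j by apply/eqP => ij; apply: ne; rewrite ij.
    left; split; first by exists s2; rewrite /upd (negPf nij).
    have /and3P[_ /eqP Ez _] := bi_queue (broker_invariant v) (eq_ind_r (fun s => z
        \in s) (mem_head z q) Eq).
    by rewrite map_rcons mem_rcons inE Ez negb_or nij.
- move=> v _ [[s2 E2] H] Ev; case: (broker_act correct_beta (t := v)); rewrite Ev //=
    => Es _.
  move: Es E2; case: (brk v beta) => d q pl fl red ms ob num sn wit compl /= -> /= E2.
  rewrite E2 /= mem_rcons mem_head; split=> //; exists s2.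
  by rewrite /upd eqxx.
Qed.

Lemma queued_pooled T i z : z \in queue T i -> exists2 u, T <= u & z \in pool u.
Proof.
move=> /mem_cat_cons[s1 [s2]]; elim: s1 T s2 => [|y s1 IH] T s2 E.
  by have [u Tu [H _]] := @queue_head_pooled T i z [::] s2 E; exists u.
have [] := @queue_head_pooled T i y (s1 ++ [:: z]) s2; first by rewrite E -catA.
move=> u Tu [_ [s3]]; rewrite -catA => /IH[v uv H].
by exists v => //; apply: leq_trans uv.
Qed.

Lemma pooled_reducing T z : z \in pool T ->
  exists2 u, T <= u & exists i subs, b_reducing (brk u beta) i = Some subs /\ z \in
      subs.
Proof.
move=> zT; apply: (@fair_leads (fun u => z \in pool u) _ (EvFlush beta)) => //.
- by move=> u _ H; rewrite /= correct_beta; case: b_pool H.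
- move=> u _ H ne.
  case: (broker_changeP u) => [_ -> _ _ _ _|a y _ -> _ _ _ _|j y q Ex Eq nj ->|//|j
      subs _ _ ->|y ob _ _ _ ->] /=; auto.
  by left; rewrite mem_rcons inE H orbT.
- move=> u _ H Eu; case: (broker_act correct_beta (t := u)); rewrite Eu //= => Es _.
  move: Es H; case: (brk u beta) => d q pl fl red ms ob num sn wit compl /= -> /= H.
  by exists fl, pl; rewrite /upd eqxx.
Qed.

(** As with [delivered_keys], sending only moves the border, so this sequence is append-only. *)
Definition sealed_batches t :=
  rev (map snd (b_sent (brk t beta))) ++ b_outbox (brk t beta).

Lemma reducing_sealed T i subs : b_reducing (brk T beta) i = Some subs ->
  exists2 u, T <= u & exists ms, seal ident ms subs \in sealed_batches u.
Proof.
move=> E; apply: (@fair_leads (fun u => b_reducing (brk u beta) i = Some subs) _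
    (EvSeal beta i)) => //.
- by move=> u _ H; rewrite /= correct_beta H.
- move=> u _ H ne.
  case: (broker_changeP u) => [_ _ _ -> _ _|a y _ _ _ -> _ _|j y q Ex Eq nj ->|Ex
      ->|j subs' Ex _ ->|y ob _ _ _ ->] /=; auto; left.
  + by rewrite /upd; case: eqP => // Ei; have [] := bi_reducing (broker_invariant u)
      H; rewrite Ei ltnn.
  + by rewrite /upd; case: eqP => // Ei; case: ne; rewrite Ei.
- move=> u _ H Eu; case: (broker_act correct_beta (t := u)); rewrite Eu //= => Es _.
  rewrite /sealed_batches; move: Es H; case: (brk u beta) => d q pl fl red ms ob num
      sn wit compl /= -> /= ->.
  by exists ms; rewrite /= mem_cat mem_rcons mem_head orbT.
Qed.

Lemma sealed_batches_mono t t' : t <= t' ->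
  exists s, sealed_batches t' = sealed_batches t ++ s.
Proof.
move=> /subnKC <-; elim: (t' - t) => [|d [s IH]]; first by exists [::]; rewrite addn0
    cats0.
rewrite addnS /sealed_batches; move: IH; rewrite /sealed_batches.
case: (broker_changeP (t + d)) => [_ _ _ _ [-> [_ ->]] _|a y _ _ _ _ [-> [_ ->]] _|j
    y q Ex Eq nj ->|Ex ->|j subs' Ex _ ->|y ob _ -> _ ->] /= IH;
  try by exists s.
- by eexists (rcons s _); rewrite -rcons_cat IH rcons_cat.
- by exists s; rewrite rev_cons cat_rcons IH.
Qed.

Lemma sent_mono t t' : t <= t' ->
  exists s, b_sent (brk t' beta) = s ++ b_sent (brk t beta).
Proof.
move=> /subnKC <-; elim: (t' - t) => [|d [s IH]]; first by exists [::]; rewrite addn0.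
rewrite addnS; case: (broker_changeP (t + d)) => [_ _ _ _ [_ [_ ->]] _|a y _ _ _ _ [_
    [_ ->]] _|j y q Ex Eq nj ->|Ex ->|j subs' Ex _ ->|y ob _ _ _ ->] /=;
  try by exists s.
by eexists (_ :: s); rewrite IH.
Qed.

Lemma num_mono t t' : t <= t' -> b_num (brk t beta) <= b_num (brk t' beta).
Proof.
move=> /sent_mono[s E]; rewrite (bi_num (broker_invariant t)) (bi_num
    (broker_invariant t')).
by rewrite E size_cat ltnS leq_addl.
Qed.

Lemma sent_unique t n y y' : (n, y) \in b_sent (brk t beta) ->
  (n, y') \in b_sent (brk t beta) -> y = y'.
Proof.
move=> H H'; have u : uniq (map fst (b_sent (brk t beta))).
  by rewrite (bi_numbers (broker_invariant t)) rev_uniq iota_uniq.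
by have [] := uniq_map_inj u H H' erefl.
Qed.

Lemma sent_lt t n y : (n, y) \in b_sent (brk t beta) -> 0 < n < b_num (brk t beta).
Proof.
move=> /(map_f fst); rewrite (bi_numbers (broker_invariant t)) mem_rev mem_iota /=.
by rewrite (bi_num (broker_invariant t)) add1n.
Qed.

Lemma sent_event t n y : (n, y) \in b_sent (brk t beta) ->
  exists u, [/\ u < t, previous_delivered correct (cf u) beta, b_num (brk u beta) = n,
    exists s, b_sent (brk u.+1 beta) = (n, y) :: s /\ b_num (brk u.+1 beta) = n.+1 &
    forall p, sent (PBroker beta) (PServer p) (MBatch n (sl_batch y)) u].
Proof.
elim: t => [//|t IH].
have old : (n, y) \in b_sent (brk t beta) -> exists u,
    [/\ u < t.+1, previous_delivered correct (cf u) beta, b_num (brk u beta) = n,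
    exists s, b_sent (brk u.+1 beta) = (n, y) :: s /\ b_num (brk u.+1 beta) = n.+1 &
    forall p, sent (PBroker beta) (PServer p) (MBatch n (sl_batch y)) u].
  by case/IH=> u [ut P N S M]; exists u; split=> //; apply: leqW.
case: (broker_changeP t) => [_ _ _ _ [_ [_ ->]] _|a z _ _ _ _ [_ [_ ->]] _|j z q Ex
    Eq nj ->|Ex ->|j subs' Ex _ ->|z ob Ex Eo P Est] //=.
rewrite Est /= inE => /orP[/eqP[En Ey]|]; last exact: old.
subst n z; exists t; split=> //; first by exists (b_sent (brk t beta)); rewrite Est.
move=> p; have A : actor (x t) = Some (PBroker beta) by rewrite Ex.
split=> //; case: (broker_act correct_beta A) => _ ->; rewrite Ex /=.
move: Eo; case: (brk t beta) => d q pl fl red ms ob' num sn wit compl /= ->.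
exact: to_servers_In.
Qed.

Lemma batch_sent dst n b t : sent (PBroker beta) dst (MBatch n b) t ->
  exists y, [/\ b_num (brk t beta) = n, (n, y) \in b_sent (brk t.+1 beta) & sl_batch
      y = b].
Proof.
move=> [A]; case: (broker_act correct_beta A) => -> ->.
case: (x t) A => [|src dst' msg|c m b'|c b'|b' i|b'|b' i|b'|p sm|p|src dst' msg|p sm]
    //= _.
- case: (brk t beta) => d q pl fl red ms ob num sn wit compl.
  case: src => [c|b'|q']; case: msg => //=.
  + by move=> [c' [m k|r|kk|r k]].
  + by move=> r u; rewrite /broker_acquired; case: (ohead _) => [[k y]|] //= [].
  + move=> [p [m k|r|[[r b''] k]|r k]] //=; case: ifP => // _ /=.
    by case: ifP => //= _ /In_to_servers.
  + move=> [[r b''] k] [p s] exc /=; case: (lookup _ _) => [y|//].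
    case: s => [m j|r'|kk|r' j] //=; case: ifP => // _ /=; case: ifP => //= _.
    move=> H; have [l] := In_pmapP H; case: l => [[[j' k'] m']|] //=.
    by case: (d j').
- by case: (brk t beta) => d q pl fl red ms ob num sn wit compl /=; case: (q i).
- case: (brk t beta) => d q pl fl red ms ob num sn wit compl /= H.
  by have [z _ []] := In_mapP H.
- by case: (brk t beta) => d q pl fl red ms ob num sn wit compl /=; case: (red i).
- case: (brk t beta) => d q pl fl red ms [|y ob] num sn wit compl //=
    /In_to_servers[-> ->].
  by exists y; rewrite mem_head.
Qed.

(** * Batches of a correct broker at the servers *)

Lemma expected_step p t r : s_exproot (srv t.+1 p) beta = Some r ->
  s_exproot (srv t p) beta = Some r /\
    s_expnum (srv t.+1 p) beta = s_expnum (srv t p) beta \/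
  exists b, [/\ x t = EvReceive (PBroker beta) (PServer p) (MBatch (s_expnum (srv t
      p) beta) b),
    batch_root MT b = r, s_expnum (srv t.+1 p) beta = s_expnum (srv t p) beta,
    s_batches (srv t.+1 p) (r, beta, s_expnum (srv t p) beta) = Some b &
    correct (PServer p) -> sent (PServer p) (PBroker beta)
      (MBatchAcquired r [seq i <- ids b | ~~ known (s_dir (srv t p)) i]) t].
Proof.
have act := @server_act p t.
case: (server_cases p t) => [->|[A E]]; first by auto.
rewrite /Defs.sent; move: (act^~ A) => {}act; move: A act; rewrite E {E}.
move: (srv t p) => st.
case: (x t) => [|src dst msg|c m b1|c b1|b1 j|b1|b1 j|b1|q sm|q|src dst msg|q sm]
    //=; auto.
- move=> [->]; case: src => [c|b1|q]; case: msg => //=; auto.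
  + move=> n b; case: st => d0 bs en er pool last cnt dn cp' acc /=; case: ifP => /=;
      auto.
    case/and5P=> _ /eqP En _ _ _ act; rewrite /upd; have [Eb|_] := eqVneq beta b1;
        last by auto.
    subst b1;    move=> [Er]; right; exists b; split=> //.
    * by rewrite -En.
    * by rewrite -En -Er eqxx.
    * by move=> cp; split=> //; rewrite (act cp).2 -Er /=; left.
  + by move=> r' n asg agg sigs; case: st => > /=; auto.
  + by move=> r' n W; rewrite /server_witness; case: ifP; auto.
  + by move=> k1; rewrite /server_request; case: (s_batches st k1); auto.
  + by move=> k1 b asg; case: st => > /=; case: ifP; auto.
  + by move=> k1; rewrite /server_collection; case: ifP; auto.
  + by move=> k1; case: st => > /=; auto.
- move=> _ _; case: sm => [[b1 r'] W]; case: st => > /=; case: ifP => /=; auto.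
  by move=> _; rewrite /upd; case: eqP => //; auto.
- move=> _ _; case: st => d0 bs en er [|k1 pool] last cnt dn cp' acc /=; auto.
  by case: (bs k1) => [b'|] /=; auto; case: complete_entries => [[? ?] ?] /=; auto.
Qed.

(** An expected root comes from a Batch message of the broker, received under the number still
    expected; the stored batch cannot have been deleted, since its key is not completed. *)
Lemma expected_received p t r : s_exproot (srv t p) beta = Some r ->
  exists u b, [/\ u < t,
    x u = EvReceive (PBroker beta) (PServer p) (MBatch (s_expnum (srv t p) beta) b) /\
    s_expnum (srv u p) beta = s_expnum (srv t p) beta,
    batch_root MT b = r, s_batches (srv t p) (r, beta, s_expnum (srv t p) beta) =
        Some b &
    correct (PServer p) -> sent (PServer p) (PBroker beta)
      (MBatchAcquired r [seq i <- ids b | ~~ known (s_dir (srv u p)) i]) u].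
Proof.
elim: t r => [//|t IH] r /expected_step[[Er En]|[b [Ex R En Eb S]]]; last first.
  by exists t, b; rewrite En.
have [u [b [ut [Ex Eu] R Eb S]]] := IH _ Er.
exists u, b; rewrite En; split=> //; first exact: leqW.
case: (batch_step Eb) => // -[q [_ _ H]].
have := @delivered_lt _ (r, beta, s_expnum (srv t p) beta) (server_invariant p t).
by rewrite mem_cat mem_rev H /= ltnn andbF => /(_ isT).
Qed.

(** A root, once expected, is never replaced; it is cleared only by an effective delivery, which
    also raises the number. *)
Lemma expected_persists p t t' r : t <= t' -> s_exproot (srv t p) beta = Some r ->
  s_expnum (srv t' p) beta = s_expnum (srv t p) beta ->
  s_exproot (srv t' p) beta = Some r.
Proof.
move=> /subnKC <- Er; elim: (t' - t) => [|d IH]; rewrite ?addn0 // addnS => En.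
have m1 := expnum_mono p beta (leq_addr d t); have m2 := expnum_mono p beta (leqnSn
    (t + d)).
have {}/IH Ed : s_expnum (srv (t + d) p) beta = s_expnum (srv t p) beta by lia.
have {En}: s_expnum (srv (t + d).+1 p) beta <= s_expnum (srv (t + d) p) beta by lia.
case: (server_cases p (t + d)) => [->//|[A ->]].
move: (srv (t + d) p) Ed A => st Ed.
case: (x (t + d)) => [|src dst msg|c m b1|c b1|b1 j|b1|b1 j|b1|q sm|q|src dst msg|q
    sm] //=.
- move=> _; case: src => [c|b1|q]; case: msg => //=.
  + move=> n b; case: st Ed => d0 bs en er pool last cnt dn cp' acc /= Ed; case: ifP
      => //=.
    case/and5P=> _ _ /eqP N _ _; rewrite /upd; case: eqP => // Eb.
    by rewrite -Eb Ed in N.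
  + by move=> r' n asg agg sigs; case: st Ed.
  + by move=> r' n W; rewrite /server_witness; case: ifP.
  + by move=> k1; rewrite /server_request; case: (s_batches st k1).
  + by move=> k1 b asg; case: st Ed => > /=; case: ifP.
  + by move=> k1; rewrite /server_collection; case: ifP.
  + by move=> k1; case: st Ed.
- move=> _; case: sm => [[b1 r'] W]; case: st Ed => > /=; case: ifP => //= _ Er'.
  by rewrite /upd; case: eqP => // ->; rewrite ltnn.
- move=> _; case: st Ed => d0 bs en er [|k1 pool] last cnt dn cp' acc //= Ed.
  by case: (bs k1) => [b'|] //=; case: complete_entries => [[? ?] ?].
Qed.

(** The message is refused only if a root is already expected or the key already stored, and by
    [si_stored] the latter implies the former. *)
Lemma batch_received p u n b : correct (PServer p) ->
  x u = EvReceive (PBroker beta) (PServer p) (MBatch n b) -> well_formed b ->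
  s_expnum (srv u p) beta = n -> exists r, s_exproot (srv u.+1 p) beta = Some r.
Proof.
move=> cp Ex /andP[w1 w2] En; have A : actor (x u) = Some (PServer p) by rewrite Ex.
case: (server_act cp A) => -> _; rewrite Ex /=.
have := @si_stored _ (server_invariant p u) (batch_root MT b, beta, n).
move: (srv u p) En => -[d0 bs en er pool last cnt dn cp' acc] /= <-.
rewrite eqxx w1 w2 /= !andbT; case: (bs _) => [b'|] /= H.
  by have [|] := H b' erefl; rewrite ?ltnn // => -[_ ->]; exists (batch_root MT b).
case Er: (er beta) => [r|] /=; first by exists r.
by exists (batch_root MT b); rewrite /upd eqxx.
Qed.

Lemma eventually_all (P : Server -> nat -> Prop) T :
  (forall p t t', t <= t' -> P p t -> P p t') -> (forall p, exists t, P p t) ->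
  exists2 t, T <= t & forall p, P p t.
Proof.
move=> mono ex; suff [t Tt H] : exists2 t, T <= t & forall p, p \in enum Server -> P
    p t.
  by exists t => // p; apply: H; rewrite mem_enum.
elim: (enum Server) => [|p s [t Tt IH]]; first by exists T.
have [t' H] := ex p; exists (maxn t t'); first by rewrite leq_max Tt.
move=> q; rewrite inE => /orP[/eqP->|qs]; first by apply: mono H; apply: leq_maxr.
by apply: mono (IH _ qs); apply: leq_maxl.
Qed.

(** * Collection of witness shards *)

Lemma witnesses_step t kk :
  b_witnesses (brk t.+1 beta) kk = b_witnesses (brk t beta) kk \/
  exists2 p, p \notin b_witnesses (brk t beta) kk &
    b_witnesses (brk t.+1 beta) kk = p |: b_witnesses (brk t beta) kk /\
    (#|b_witnesses (brk t.+1 beta) kk| = f.+1 -> forall q,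
      sent (PBroker beta) (PServer q) (MWitness kk.1.1 kk.2
        (Cert (StWitness kk) (b_witnesses (brk t.+1 beta) kk))) t).
Proof.
case: (broker_cases beta t) => [->|[A _]]; first by auto.
case: (broker_act correct_beta A) => Es Eo; rewrite /Defs.sent Eo {Eo} Es {Es}.
case: (x t) A => [|src dst msg|c m b1|c b1|b1 j|b1|b1 j|b1|q sm|q|src dst msg|q sm]
    //= A;
  auto; case: (brk t beta) => d q pl fl red ms ob num sn wit compl /=; auto.
- case: src A => [c|b1|q']; case: msg => //=; auto.
  + by move=> [c' [m k|r|k1|r k]] /=; auto.
  + by move=> r u _; rewrite /broker_acquired; case: (ohead _) => [[k y]|]; auto.
  + move=> [p [m k|r|[[r b'] k]|r k]] /= A; auto.
    case: ifP => [/and3P[_ _ H]|]; last by auto.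
    rewrite /= /upd; case: eqP => [Ek|_]; last by auto.
    right; exists p; rewrite Ek //; split=> // Ec q''; split=> //.
    by rewrite Ec eqxx; apply: to_servers_In.
  + move=> [[r b'] k] [p s] exc A /=; case: (lookup _ _) => [y|]; last by auto.
    by case: s => [m j|r'|k1|r' j] /=; auto; case: ifP; auto.
- by case: (q j); auto.
- by case: (red j); auto.
- by case: ob; auto.
Qed.

Lemma witnesses_mono t t' kk p : t <= t' -> p \in b_witnesses (brk t beta) kk ->
  p \in b_witnesses (brk t' beta) kk.
Proof.
move=> /subnKC <- H; elim: (t' - t) => [|d IH]; rewrite ?addn0 // addnS.
by case: (witnesses_step (t + d) kk) => [->//|[q _ [-> _]]]; rewrite inE IH orbT.
Qed.

(** The certificate is sent when the count equals [f.+1]; witnesses arrive one at a time, so the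
    first crossing of [f] hits this value. *)
Lemma witnesses_sent t kk : f < #|b_witnesses (brk t beta) kk| ->
  exists u (A : {set Server}), f < #|A| /\ forall q,
    sent (PBroker beta) (PServer q) (MWitness kk.1.1 kk.2 (Cert (StWitness kk) A)) u.
Proof.
elim: t => [|t IH]; first by rewrite /= cards0.
have [lt|ge] := boolP (f < #|b_witnesses (brk t beta) kk|); first by move=> _; apply:
    IH.
case: (witnesses_step t kk) => [->|[p np [E S]]]; first by rewrite (negPf ge).
move=> lt; exists t, (b_witnesses (brk t.+1 beta) kk); split=> //; apply: S.
by move: lt; rewrite E cardsU1 np; lia.
Qed.

Lemma shard_received t q p r n y : x t = EvReceive (PServer q) (PBroker beta)
    (MWitnessShard (p, StWitness (r, beta, n))) ->
  (n, y) \in b_sent (brk t beta) -> batch_root MT (sl_batch y) = r ->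
  p \in b_witnesses (brk t.+1 beta) (r, beta, n).
Proof.
move=> Ex Hs Er; have A : actor (x t) = Some (PBroker beta) by rewrite Ex.
case: (broker_act correct_beta A) => -> _; rewrite Ex /=.
have {Hs}: lookup n (b_sent (brk t beta)) = Some y.
  by apply: lookup_uniq Hs; rewrite (bi_numbers (broker_invariant t)) rev_uniq
      iota_uniq.
case: (brk t beta) => d q' pl fl red ms ob num sn wit compl /= ->.
rewrite !eqxx Er eqxx /=; case: ifP => [_|/negbFE//] /=.
have -> : upd wit (r, beta, n) (p |: wit (r, beta, n)) (r, beta, n) =
    p |: wit (r, beta, n) by rewrite /upd eqxx.
by rewrite !inE eqxx.
Qed.

(** By agreement it suffices that one correct server passes [n]. Otherwise all of them stay at [n]
    from the sending time [tau] on, and the broker, barred from sending again, keeps this batch as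
    its latest. The whole exchange then succeeds up to a STOB broadcast, whose delivery is
    effective: a contradiction. *)
Lemma sent_delivered T n y : (n, y) \in b_sent (brk T beta) ->
  forall p, correct (PServer p) -> exists t, n < s_expnum (srv t p) beta.
Proof.
move=> Hy.
have [[p0 [t0 [cp0 lt0]]]|none] := classic (exists p t, correct (PServer p) /\ n <
    s_expnum (srv t p) beta).
  move=> p cp; have [] := @delivered_ex _ beta n (server_invariant p0 t0).
    by rewrite lt0; case/andP: (sent_lt Hy) => ->.
  move=> r /delivered_keyP[u _ D]; have [v D'] := delivers_key_agreement cp0 cp D.
  by exists v.+1; apply: (delivered_expnum D').
move=> p1 _; exfalso; have {p1} {}none p t : correct (PServer p) -> s_expnum (srv t
    p) beta <= n.
  by move=> cp; rewrite leqNgt; apply/negP=> lt; apply: none; exists p, t.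
have [tau [tauT /forallP prev Nt [s0 [Es0 Nt1]] Sent]] := sent_event Hy.
have const p t : correct (PServer p) -> tau <= t -> s_expnum (srv t p) beta = n.
  move=> cp lt; apply/eqP; rewrite eqn_leq none //=.
  by apply: leq_trans (expnum_mono p beta lt); have := prev p; rewrite cp Nt.
have num t : tau < t -> b_num (brk t beta) = n.+1 /\ b_sent (brk t beta) = (n, y) :: s0.
  move=> /subnKC <-; elim: (t - tau.+1) => [|d [IH1 IH2]]; first by rewrite addn0.
  rewrite addnS; case: (broker_changeP (tau.+1 + d)) => [_ _ _ _ [_ [-> ->]] _|a z _
      _ _ _ [_ [-> ->]] _|j z q Ex Eq nj ->|Ex ->|j subs' Ex _ ->|z ob Ex Eo /forallP
      P Est] //=.
  have [p _ cp] : exists2 p, p \in [set: Server] & correct (PServer p).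
    by apply: correct_signer; rewrite cardsT card_server; lia.
  have := P p; rewrite cp IH1 const ?ltnn //; lia.
have [ms [subs [Ey g]]] := bi_sent (broker_invariant T) Hy.
have /and3P[gu gv gk] := g.
set b := sl_batch y in Sent; set r := batch_root MT b; pose kk : key := (r, beta, n).
have wf : well_formed b by rewrite /b Ey; apply: well_formed_make_batch.
(* Numbers before [tau] were smaller and none is reused, so [b] is the only batch that the broker
   sends under [n]. *)
have auth u p b' : x u = EvReceive (PBroker beta) (PServer p) (MBatch n b') ->
    tau < u /\ b' = b.
  move=> Ex; have [w wu Sw] := exec_authentic exec Ex.
  have [y' [Nw Hy' <-]] := batch_sent Sw.
  have [tw|tw|tw] := ltngtP tau w; last 1 first.
  - split; first by rewrite tw.
    by move: Hy'; rewrite -tw => Hy'; rewrite (sent_unique Hy' (_ : (n, y) \in _)) //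
        Es0 mem_head.
  - by have := num _ tw; rewrite Nw => -[]; lia.
  - by have := num_mono tw; have := sent_lt Hy'; rewrite Nt; lia.
have stored p t : correct (PServer p) -> tau <= t ->
    s_exproot (srv t p) beta <> None -> exists u, [/\ tau < u < t,
    x u = EvReceive (PBroker beta) (PServer p) (MBatch n b),
    s_exproot (srv t p) beta = Some r, s_batches (srv t p) kk = Some b &
    sent (PServer p) (PBroker beta)
      (MBatchAcquired r [seq i <- ids b | ~~ known (s_dir (srv u p)) i]) u].
  move=> cp tt; case Er: s_exproot => [r'|//] _.
  have [u [b' [ut [Ex Eu] R Eb S]]] := expected_received Er.
  rewrite (const p t) // in Ex Eb; have [tu Ebb] := auth _ _ _ Ex.
  have Er' : r' = r by rewrite -R Ebb.
  by subst b' r'; exists u; split=> //; [rewrite tu|apply: S].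
have acked p : correct (PServer p) -> exists2 t, tau < t & p \in b_witnesses (brk t
    beta) kk.
  move=> cp; have [w tw Ew] := exec_reliable exec correct_beta cp (Sent p).
  have [r' Er'] := batch_received cp Ew wf (const _ _ cp (ltnW tw)).
  have [|u [/andP[tu uw] Eu Er Eb Sack]] := stored p w.+1 cp (leqW (ltnW tw)); first
      by rewrite Er'.
  have [w2 uw2 Ew2] := exec_reliable exec cp correct_beta Sack.
  have tw2 : tau < w2 by apply: ltn_trans uw2.
  set unk := filter _ _ in Ew2.
  have Ssig : sent (PBroker beta) (PServer p) (MSignatures r n
      (export (b_dir (brk w2 beta)) unk) (sl_aggregate y) (sl_signatures y)) w2.
    have A : actor (x w2) = Some (PBroker beta) by rewrite Ew2.
    split=> //; case: (broker_act correct_beta A) => _ ->; rewrite Ew2 /=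
        /broker_acquired.
    by rewrite (num _ tw2).2 /= eqxx /=; left.
  have [w3 w23 Ew3] := exec_reliable exec correct_beta cp Ssig.
  have tw3 : tau < w3 by apply: ltn_trans w23.
  have uw3 : u.+1 <= w3 by apply: ltn_trans w23.
  have Er3 : s_exproot (srv w3 p) beta <> None.
    have [r1 E] := batch_received cp Eu wf (const _ _ cp (ltnW tu)).
    by rewrite (expected_persists uw3 E) // !const //; lia.
  have [_ [_ _ {}Er3 Eb3 _]] := stored p w3 cp (ltnW tw3) Er3.
  have kdb : all (known (b_dir (brk w2 beta))) (ids b).
    have [ms' [subs' [Ey' /and3P[_ _ k']]]] : good_sealed (b_dir (brk w2 beta)) y.
      by apply: (bi_sent (broker_invariant w2) (n := n)); rewrite (num _ tw2).2
          mem_head.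
    by rewrite /b Ey'.
  pose d' := import ident (s_dir (srv w3 p)) (export (b_dir (brk w2 beta)) unk).
  have d'P i c : d' i = Some c -> ident c = i.
    by apply: import_sound; apply: si_dir (server_invariant p w3).
  (* Identifiers known when the batch was acknowledged remain known; the others are those that the
     broker exports. *)
  have kd' : all (known d') (ids b).
    apply/allP=> i ib; case K: (known (s_dir (srv u p)) i).
      by apply: import_known; apply: server_known_mono K; apply: ltnW.
    apply: import_export; [exact: bi_dir (broker_invariant w2)|by rewrite mem_filter
        K ib|].
    exact: (allP kdb).
  have V : valid_signatures d' b (sl_aggregate y) (sl_signatures y).
    by rewrite /b Ey; apply: sealed_valid_signatures => //; move: kd'; rewrite /b Ey.
  have Sw : sent (PServer p) (PBroker beta) (MWitnessShard (p, StWitness kk)) w3.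
    have A : actor (x w3) = Some (PServer p) by rewrite Ew3.
    split=> //; case: (server_act cp A) => _ ->; rewrite Ew3 /=.
    have := const p w3 cp (ltnW tw3); move: V kd' Er3 Eb3; rewrite /d'.
    case: (srv w3 p) => d0 bs en er pool last cnt dn cp' acc /= V' k' -> Eb3 ->.
    by rewrite !eqxx /= -/kk Eb3 V' k' /=; left.
  have [w4 w34 Ew4] := exec_reliable exec cp correct_beta Sw.
  have tw4 : tau < w4 by apply: ltn_trans w34.
  exists w4.+1; first exact: leqW.
  by apply: (shard_received Ew4 (y := y)) => //; rewrite (num _ tw4).2 mem_head.
have [t _ Hall] : exists2 t, tau <= t &
    forall p, ~~ correct (PServer p) || (p \in b_witnesses (brk t beta) kk).
  apply: eventually_all => [p t t' tt' /orP[->//|H]|p].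
    by rewrite (witnesses_mono tt' H) orbT.
  case cp: (correct (PServer p)); last by exists 0.
  by have [t _ H] := acked p cp; exists t.
have [u [A [fA SW]]] : exists u (A : {set Server}), f < #|A| /\ forall q,
    sent (PBroker beta) (PServer q) (MWitness kk.1.1 kk.2 (Cert (StWitness kk) A)) u.
  apply: (@witnesses_sent t); set W := b_witnesses _ _.
  (* At least [2 * f + 1] servers are correct, more than [f]. *)
  have: #|~: [set p : Server | ~~ correct (PServer p)]| <= #|W|.
    apply/subset_leq_card/subsetP => p; rewrite !inE negbK => cp.
    by have := Hall p; rewrite cp.
  by have := cardsC [set p : Server | ~~ correct (PServer p)]; rewrite card_server; lia.
(* Having signed, a correct signer expected the root, and still does while its number is frozen; so
   it broadcasts the certificate. *)
have [p0 p0A cp0] := correct_signer fA.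
have [|u' u'u Sp0] := exec_unforgeable exec (t := u) (a := PServer p0) (s :=
    StWitness kk) cp0.
  left; exists (PBroker beta), (PServer p0); eexists; split; first exact: (SW p0).
  by apply: (In_map (fun p => (PServer p, _))); apply/InP; rewrite mem_enum.
have [_ [_ [_ [_ [_ _ Eu' _ [_ _ _ _ Er']]]]]] := signed_witness cp0 Sp0.
have [w uw Ew] := exec_reliable exec correct_beta cp0 (SW p0).
have u'w : u' < w by apply: leq_ltn_trans uw.
have Ew' : s_expnum (srv w p0) beta = n.
  apply/eqP; rewrite eqn_leq none //=.
  by have := expnum_mono p0 beta (ltnW u'w); rewrite Eu'.
have Eu1 : s_expnum (srv u'.+1 p0) beta = n.
  apply/eqP; rewrite eqn_leq none //=.
  by have := expnum_mono p0 beta (leqnSn u'); rewrite Eu'.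
have Erw : s_exproot (srv w p0) beta = Some r.
  by apply: expected_persists Er' _; rewrite // Ew' Eu1.
pose W := Cert (StWitness kk) A.
have CW : certifies f W (StWitness kk) by rewrite /certifies /= eqxx.
have B : stob_broadcast f ident dir0 x p0 (beta, r, W) w.
  have Aw : actor (x w) = Some (PServer p0) by rewrite Ew.
  split=> //; case: (server_act cp0 Aw) => _ ->; rewrite Ew /= /server_witness.
  by rewrite Erw Ew' !eqxx CW /=; left.
have [q [v [cq Ev]]] := stob_validity (exec_stob exec) cp0 B.
have Env : s_expnum (srv v q) beta = n.
  by apply/eqP; rewrite eqn_leq none //= (delivery_expnum cq Ev CW).
have D : delivers_key q kk v by exists W.
by have := none q v.+1 cq; rewrite leqNgt => /negP[]; apply: delivered_expnum D _.
Qed.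

(** The latest number sent is one less than [b_num]: this is [sent_delivered] for it, or the initial
    expected number 1 if nothing has been sent. *)
Lemma previous_eventually T : exists2 t, T <= t &
  forall p, correct (PServer p) -> b_num (brk T beta) <= s_expnum (srv t p) beta.
Proof.
have [||t Tt H] := @eventually_all (fun p t => correct (PServer p) ==>
    (b_num (brk T beta) <= s_expnum (srv t p) beta)) T.
- move=> p t t' tt' /implyP H; apply/implyP=> /H le.
  exact: leq_trans (expnum_mono p beta tt').
- move=> p; case cp: (correct (PServer p)); last by exists 0.
  case E: (b_sent (brk T beta)) => [|[n y] s].
    exists 0; rewrite (bi_num (broker_invariant T)) E /=.
    exact: leq_ltn_trans (leq0n _) (si_done (server_invariant p 0) beta).
  have [|t H] := @sent_delivered T n y _ p cp; first by rewrite E mem_head.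
  exists t; rewrite (bi_num (broker_invariant T)).
  have := bi_numbers (broker_invariant T); rewrite E [size _]/= rev_iota1S => -[En _].
  by move: H; rewrite En.
- by exists t => // p cp; have := H p; rewrite cp.
Qed.

Lemma sealed_sent T y : y \in sealed_batches T ->
  exists t n, (n, y) \in b_sent (brk t beta).
Proof.
move=> Hy.
suff [t Tt le] : exists2 t, T <= t & size (sealed_batches T) <= size (b_sent (brk t
    beta)).
  have [s Es] := sealed_batches_mono Tt.
  have: take (size (sealed_batches T)) (sealed_batches t) = sealed_batches T.
    by rewrite Es take_size_cat.
  rewrite {2}/sealed_batches takel_cat ?size_rev ?size_map // => E.
  move: Hy; rewrite -{1}E => /mem_take; rewrite mem_rev => /mapP[[n y'] H /= ->].
  by exists t, n.
suff H n : n <= size (sealed_batches T) ->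
    exists2 t, T <= t & n <= size (b_sent (brk t beta)) by exact: H.
elim: n => [|n IH] le; first by exists T.
have [t Tt H] := IH (ltnW le).
move: H; rewrite leq_eqVlt => /orP[/eqP E|H]; last by exists t.
have [t1 tt1 P] := previous_eventually t.
have [Ht1|ge] := boolP (n < size (b_sent (brk t1 beta))).
  by exists t1 => //; apply: leq_trans tt1.
(* Until another batch is sent [b_num] is constant, so the condition for sending, once true, stays
   true. *)
have Nt u : t <= u -> size (b_sent (brk u beta)) <= n -> b_num (brk u beta) = b_num
    (brk t beta).
  move=> tu lu; rewrite (bi_num (broker_invariant u)) (bi_num (broker_invariant t)).
  congr _.+1; apply/eqP; rewrite eqn_leq -{1}E lu /=.
  by have [s ->] := sent_mono tu; rewrite size_cat leq_addl.
have [u t1u Hu] : exists2 u, t1 <= u & n < size (b_sent (brk u beta)).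
  apply: (@fair_leads (fun u => size (b_sent (brk u beta)) <= n) _ (EvSend beta)) => //.
  - by rewrite leqNgt.
  - move=> u t1u lu; rewrite /= correct_beta /=; apply/andP; split.
      have [s Es] := sealed_batches_mono (leq_trans Tt (leq_trans tt1 t1u)).
      move: le; have := congr1 size Es; rewrite /sealed_batches !size_cat !size_rev
          !size_map.
      by lia.
    apply/forallP=> p; apply/implyP=> cp; rewrite Nt ?(leq_trans tt1) //.
    exact: leq_trans (P p cp) (expnum_mono p beta t1u).
  - by move=> u _ _ _; case: (leqP (size (b_sent (brk u.+1 beta))) n); auto.
  - move=> u t1u lu Eu; have En : size (b_sent (brk u beta)) = n.
      apply/eqP; rewrite eqn_leq lu E /=.
      by have [s ->] := sent_mono (leq_trans tt1 t1u); rewrite size_cat leq_addl.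
    have := exec_enabled exec u; rewrite Eu /= => /and3P[_ + _].
    have A : actor (x u) = Some (PBroker beta) by rewrite Eu.
    case: (broker_act correct_beta A) => -> _; rewrite Eu /=; move: En.
    by case: (brk u beta) => d q pl fl red ms [|z ob] num sn wit compl //= ->.
exists u => //; exact: leq_trans Tt (leq_trans tt1 t1u).
Qed.

(** The condition on [s] is the acceptance test of the broker; queue, pool, reduction and outbox
    then lead the submission to delivery. *)
Lemma submission_delivered chi m s E src t p : correct (PServer p) ->
  x t = EvReceive src (PBroker beta)
    (MSubmission (ident chi, chi) m s (chi, StMessage m s) E) ->
  (s == 0) || evidence_covers f E s ->
  exists u kk es k, [/\ delivers_key p kk u, mroot MT (map Some es) = kk.1.1,
    (ident chi, k, m) \in es & s <= k].
Proof.
move=> cp Ex cov; pose z := Submission chi m s (chi, StMessage m s) E.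
have Hz : z \in b_queue (brk t.+1 beta) (ident chi).
  have A : actor (x t) = Some (PBroker beta) by rewrite Ex.
  case: (broker_act correct_beta A) => -> _; rewrite Ex /=.
  case: (brk t beta) => d q pl fl red ms ob num sn wit compl; case: src {Ex A} =>
      [?|?|?] /=;
  by rewrite !eqxx cov /= /upd eqxx mem_rcons mem_head.
have [t1 _ Hz1] := queued_pooled Hz.
have [t2 _ [i [subs [Er zs]]]] := pooled_reducing Hz1.
have [t3 _ [ms Hy]] := reducing_sealed Er.
have [t4 [n Hn]] := sealed_sent Hy; set y := seal _ _ _ in Hy Hn.
have [_ /and3P[us _ _]] := bi_reducing (broker_invariant t2) Er.
have [k sk Hk] := sealed_numbered ms us zs.
have [t5 lt] := sent_delivered Hn cp.
have [] := @delivered_ex _ beta n (server_invariant p t5).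
  by rewrite lt; case/andP: (sent_lt Hn) => ->.
move=> r /delivered_keyP[u _ D]; exists u, (r, beta, n), (numbered (sl_batch y)), k.
split=> //.
(* The delivered root is that of the batch of the broker itself: a correct witness expected it,
   hence received it from the broker, which uses each number once. *)
have [q [u0 [cq _ S]]] := delivers_key_signer cp D.
have [_ [_ [_ [_ [_ /= Er0 En0 _ _]]]]] := signed_witness cq S.
have [w [b [_ [Ew _] <- _ _]]] := expected_received Er0.
rewrite En0 in Ew; have [w' _ Sw] := exec_authentic exec Ew.
have [y' [_ Hy' <-]] := batch_sent Sw.
have [s1 E1] := sent_mono (leq_maxl w'.+1 t4).
have [s2 E2] := sent_mono (leq_maxr w'.+1 t4).
have -> // : y' = y.
apply: (@sent_unique (maxn w'.+1 t4) n); [rewrite E1|rewrite E2];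
  by rewrite mem_cat ?Hy' ?Hn orbT.
Qed.

End CorrectBroker.

(** * Validity *)

Lemma root_inj (es es' : seq (nat * nat * Msg)) :
  mroot MT (map Some es) = mroot MT (map Some es') -> es = es'.
Proof. by move/mroot_inj/inj_map => H; apply: H => ? ? []. Qed.

Lemma roots_inj (ess ess' : seq (seq (nat * nat * Msg))) :
  [seq mroot MT (map Some es) | es <- ess] = [seq mroot MT (map Some es) | es <-
      ess'] ->
  ess = ess'.
Proof. by apply: inj_map => es es'; apply: root_inj. Qed.

(** [ess] lists the entries of the batches completed by [p], oldest first, known only through their
    roots. *)
Notation log := (fun p t ess => [seq mroot MT (map Some es) | es <- ess] =
  [seq kk.1.1 | kk <- rev (s_completed (srv t p))]).

Lemma completed_delivers p t K1 kk K2 :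
  rev (s_completed (srv t p)) = K1 ++ kk :: K2 ->
  exists2 u, u < t & delivers_key p kk u /\ delivered_keys (srv u p) = K1.
Proof.
move=> E; apply: (@delivered_split _ _ _ _ (K2 ++ s_pool (srv t p))).
by rewrite /delivered_keys E -catA.
Qed.

Lemma log_entry p t ess E1 e E2 : log p t ess -> flatten ess = E1 ++ e :: E2 ->
  exists K1 kk u ess1 es e1 e2,
  [/\ delivers_key p kk u /\ delivered_keys (srv u p) = K1,
      es = e1 ++ e :: e2, E1 = flatten ess1 ++ e1,
      mroot MT (map Some es) = kk.1.1 &
      [seq mroot MT (map Some es) | es <- ess1] = [seq kk.1.1 | kk <- K1]].
Proof.
move=> El Ef; have [ess1 [es [ess2 [e1 [e2 [Eess Ees EE]]]]]] := flatten_split Ef.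
rewrite Eess in El; have [K1 [kk [K2 [Ek E3 E4]]]] := map_eq_cat (esym El).
have [u _ H] := completed_delivers Ek.
by exists K1, kk, u, ess1, es, e1, e2.
Qed.

Section Validity.
Variables (chi : Client).
Hypothesis correct_chi : correct (PClient chi).

Lemma log_commits p t ess E1 k m E2 : correct (PServer p) -> log p t ess ->
  flatten ess = E1 ++ (ident chi, k, m) :: E2 -> exists w, commits chi k m w.
Proof.
move=> cp El /(log_entry El)[K1 [kk [u [ess1 [es [e1 [e2 [[D _] Ees _ R _]]]]]]]].
have [q [u0 [cq _ S]]] := delivers_key_signer cp D.
have [|w _ C] := witness_commits correct_chi cq S R (k := k) (m := m); last by exists w.
by rewrite Ees mem_cat mem_head orbT.
Qed.

Lemma completed_log p t kk : kk \in s_completed (srv t p) ->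
  exists ess1 es ess2 K1 K2, [/\ log p t (ess1 ++ es :: ess2),
    rev (s_completed (srv t p)) = K1 ++ kk :: K2,
    [seq mroot MT (map Some es) | es <- ess1] = [seq kk.1.1 | kk <- K1] &
    mroot MT (map Some es) = kk.1.1].
Proof.
rewrite -mem_rev => /mem_cat_cons[K1 [K2 Ek]].
have [ess [El _]] := si_last (server_invariant p t).
move: (El); rewrite Ek => El'; have [ess1 [es [ess2 [Ee E1 E2]]]] := map_eq_cat El'.
by exists ess1, es, ess2, K1, K2; rewrite -Ee El Ek.
Qed.

Variables (m : Msg) (t : nat).
Hypothesis idle_t : c_pending (clt t chi) = None.

Notation delivered := (exists t' p, [/\ t < t', correct (PServer p)
  & server_delivers f ident dir0 x p chi m t']).

Lemma commits_after k m' w : commits chi k m' w -> c_seq (clt t chi) <= k -> t <= w.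
Proof.
move=> [Ep Ek] le; rewrite leqNgt; apply/negP=> lt.
by have := client_seq_lt correct_chi lt Ep idle_t; rewrite Ek ltnNge le.
Qed.

(* The server that signed the witness of the batch containing a fresh entry knows
   the directory entry of the client, and it completes the batch after the same
   prefix of batches. *)
Lemma fresh_entry_delivered p T ess E1 k E2 : correct (PServer p) -> log p T ess ->
  flatten ess = E1 ++ (ident chi, k, m) :: E2 ->
  fresh (record_all (fun=> None) E1 (ident chi)) k m -> c_seq (clt t chi) <= k ->
  delivered.
Proof.
move=> cp El Ef F le.
have [K1 [kk [u [ess1 [es [e1 [e2 [[D EK] Ees EE R Er]]]]]]]] := log_entry El Ef.
have [p0 [u0 [cp0 _ S]]] := delivers_key_signer cp D.
have Hes : (ident chi, k, m) \in es by rewrite Ees mem_cat mem_head orbT.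
have [w wu0 C] := witness_commits correct_chi cp0 S R Hes.
have tw := commits_after C le.
have [_ [_ [_ [b0 [_ _ En Eb0 [_ K0 _ _ _]]]]]] := signed_witness cp0 S.
have [v0 D0] := delivers_key_agreement cp cp0 D.
have [T' Hc] := delivered_completed cp0 D0.
have [t' [b [pool [_ Ex Epool Eb]]]] := completed_event Hc.
have [v vt' [Dv EKv]] : exists2 v, v < t' &
    delivers_key p0 kk v /\ delivered_keys (srv v p0) = rev (s_completed (srv t' p0)).
  by apply: (@delivered_split _ _ _ _ pool); rewrite /delivered_keys Epool.
(* A witness signs while the number is expected, hence no later than the effective delivery. *)
have u0v : u0 <= v.
  rewrite leqNgt; apply/negP=> lt.
  by have := delivered_expnum Dv lt; rewrite En ltnn.
have [ess0 [El0 Es0]] := si_last (server_invariant p0 t').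
(* Equal prefixes of keys have equal roots, hence equal entries: freshness at [p] is freshness at
   [p0]. *)
have Eess : ess0 = ess1.
  by apply: roots_inj; rewrite El0 Er -EKv -EK (delivered_keys_agree cp cp0 D Dv).
have Enum : numbered b = es.
  by apply: root_inj; rewrite R -(si_root (server_invariant p0 t') Eb).
have Enum0 : numbered b0 = es.
  by apply: root_inj; rewrite R -(si_root (server_invariant p0 u0) Eb0).
have dE : s_dir (srv t' p0) (ident chi) = Some chi.
  have ib0 : ident chi \in ids b0 by apply: (@numbered_id _ b0 _ k m); rewrite Enum0.
  have := server_known_mono (leq_ltn_trans u0v vt') (allP K0 _ ib0).
  rewrite /known; case Ed: (s_dir _ _) => [c|//] _.
  by rewrite (ident_inj (si_dir (server_invariant p0 t') Ed)).
exists t', p0; split=> //; first exact: leq_ltn_trans tw (ltn_trans (leq_trans wu0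
    u0v) vt').
have A : actor (x t') = Some (PServer p0) by rewrite Ex.
split=> //; case: (server_act cp0 A) => _ ->; rewrite Ex /=.
have : (ident chi, m) \in (complete_entries (s_last (srv t' p0)) es).2.
  rewrite Ees; apply: complete_entries_deliver.
  by rewrite Es0 Eess -record_all_cat -EE.
move: Epool Eb dE; case: (srv t' p0) => d0 bs en er pl last cnt dn cp' acc /= -> -> dE.
rewrite Enum; case: complete_entries => [[? ?] dls] /= H.
by rewrite mem_pmap; apply/mapP; exists (ident chi, m) => //=; rewrite dE.
Qed.

End Validity.

(** * Completion certificates *)

Lemma signed_completion p r n u : correct (PServer p) ->
  signed (PServer p) (StCompletion r n) u -> exists kk b pool,
  [/\ s_pool (srv u p) = kk :: pool, s_batches (srv u p) kk = Some b,
      s_completed (srv u.+1 p) = kk :: s_completed (srv u p) &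
      r = mroot MT (complete_entries (s_last (srv u p)) (numbered b)).1.2].
Proof.
move=> cp [A]; case: (server_act cp A) => -> ->; move: (srv u p) => st.
case: (x u) A => [|src dst msg|c m' b1|c b1|b1 j|b1|b1 j|b1|q sm|q|src dst msg|q sm]
    //= _.
- case: src => [c|b1|q]; case: msg => //=.
  + by move=> n' b; case: st => > /=; case: ifP.
  + by move=> >; case: st => > /=; case: ifP => //= _; rewrite inE => /eqP.
  + by move=> >; rewrite /server_witness; case: ifP.
  + by move=> k1; rewrite /server_request; case: (s_batches st k1).
  + by move=> >; case: st => > /=; case: ifP.
  + by move=> k1; rewrite /server_collection; case: ifP.
  + by move=> k1; case: st.
- by case: sm => [[b1 r'] W']; case: st => > /=; case: ifP => //= _; case: ifP.
- case: st => d0 bs en er [|kk pool] last cnt dn cp' acc //=.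
  case Eb: (bs kk) => [b|//]; case Ec: complete_entries => [[last' ls] dls] /=.
  by rewrite inE => /eqP[-> _]; exists kk, b, pool; rewrite Ec.
Qed.

(** A correct signer computed [r] as the root of its own completion leaves, so the inclusion proof
    is sound and the leaf is a record of that server, reached after the part [es1] of the batch. *)
Lemma completion_log chi t beta r m k pf n W :
  x t = EvReceive (PBroker beta) (PClient chi) (MCompletion r m k pf n W) ->
  certifies f W (StCompletion r n) -> mverify r (Some (ident chi, k, m)) pf ->
  exists p u kk pool es1 es2 ess,
  [/\ correct (PServer p), u < t,
      [/\ s_pool (srv u p) = kk :: pool,
       s_completed (srv u.+1 p) = kk :: s_completed (srv u p) &
       mroot MT (map Some (es1 ++ es2)) = kk.1.1],
      log p u ess &
      record_all (fun=> None) (flatten ess ++ es1) (ident chi) = Some (k, m)].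
Proof.
move=> Ex /andP[/eqP CW /correct_signer[p pW cp]] M.
have [w wt Sw] := exec_authentic exec Ex.
have [|u uw S] := exec_unforgeable exec (t := w) (a := PServer p) (s := StCompletion
    r n) cp.
  left; do 3 eexists; split; first exact: Sw.
  rewrite /= /cert_signatures CW.
  by apply: (In_map (fun p => (PServer p, _))); apply/InP; rewrite mem_enum.
have [ess [El Es]] := si_last (server_invariant p u).
have [kk [b [pool [Ep Eb Ec Er]]]] := signed_completion cp S.
rewrite {}Er in M; have [es1 [es2 [En Hr]]] := complete_entries_leaf (mverify_sound M).
exists p, u, kk, pool, es1, es2, ess; split=> //; first exact: leq_ltn_trans wt.
  by split=> //; rewrite -En -(si_root (server_invariant p u) Eb).
by rewrite record_all_cat -Es.
Qed.

(** * A broadcast message, completed or pending forever *)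

Section Broadcast.
Variables (chi : Client) (m : Msg) (t : nat) (beta0 : Broker).
Hypothesis correct_chi : correct (PClient chi).
Hypothesis broadcast_t : x t = EvBroadcast chi m beta0.

Notation delivered := (exists t' p, [/\ t < t', correct (PServer p)
  & server_delivers f ident dir0 x p chi m t']).

Lemma broadcast_idle :
  c_pending (clt t chi) = None /\ c_last (clt t chi) <> Some m.
Proof.
by have := exec_enabled exec t; rewrite broadcast_t => /and3P[_ /eqP -> /eqP].
Qed.

Lemma pending_after_broadcast : c_pending (clt t.+1 chi) = Some m.
Proof.
have A : actor (x t) = Some (PClient chi) by rewrite broadcast_t.
by case: (client_act correct_chi A) => -> _; rewrite broadcast_t.
Qed.

(** The certificate that ends the pending period carries a number used since the broadcast, hence at
    least the counter at [t]; the origin of the certified record is a fresh entry. *)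
Lemma completed_broadcast_delivered u : t < u -> c_pending (clt u chi) <> Some m ->
  delivered.
Proof.
have [idle _] := broadcast_idle => tu nP.
have [t1 [tt1 P1 nP1]] : exists t1, [/\ t < t1,
    forall v, t < v <= t1 -> c_pending (clt v chi) = Some m &
    c_pending (clt t1.+1 chi) <> Some m].
  have ex : exists v, (t < v) && (c_pending (clt v chi) != Some m).
    by exists u; rewrite tu; apply/eqP.
  case: (ex_minnP ex) => -[//|v] /andP[tv /eqP nPv] least; exists v; split=> //.
    move: tv; rewrite ltnS leq_eqVlt => /orP[/eqP tv|//].
    by case: nPv; rewrite -tv pending_after_broadcast.
  move=> w /andP[tw wv]; apply/eqP/negPn/negP => nPw.
  by have := least w; rewrite tw nPw => /(_ isT); rewrite leqNgt ltnS wv.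
have Pt1 : c_pending (clt t1 chi) = Some m by apply: P1; rewrite tt1 leqnn.
have [tb [beta [tbt1 Eb Nb Pb Ub]]] := client_period correct_chi Pt1.
have Etb : tb = t.
  have [lt|lt|//] := ltngtP tb t.
    by have := Pb t; rewrite lt (ltnW tt1) idle => /(_ isT).
  by have := P1 tb; rewrite lt (ltnW tbt1) Nb => /(_ isT).
have {nP1} [b [r [k [pf [n [W [Ex C U M]]]]]]] : exists b r k pf n W,
    [/\ x t1 = EvReceive (PBroker b) (PClient chi) (MCompletion r m k pf n W),
    certifies f W (StCompletion r n), (b, k) \in c_used (clt t1 chi) &
    mverify r (Some (ident chi, k, m)) pf].
  case: (client_changeP t1 correct_chi) => [_ Ep _ _ _|m' b _ [Ep _]|m' b _ Ep Es
      _|m' b k E Ep _ Es|m' b r k pf n W Ep Ex [C U M] _].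
  - by case: nP1; rewrite Ep.
  - by rewrite Pt1 in Ep.
  - by case: nP1; rewrite Es /= -Ep.
  - by case: nP1; rewrite Es /= -Ep.
  - move: Ep; rewrite Pt1 => -[Em]; subst m'; by exists b, r, k, pf, n, W.
have /andP[le _] := Ub _ _ U; rewrite Etb in le.
have [p [v [kk [pool [es1 [es2 [ess [cp _ [_ Ec R] El Hr]]]]]]]] := completion_log Ex
    C M.
have [F1 [F2 [EF F]]] := record_all_origin Hr.
(* The log is read at [v.+1] so as to include the batch being completed. *)
apply: (@fresh_entry_delivered _ correct_chi m t idle p v.+1 (rcons ess (es1 ++ es2))
    F1 k (F2 ++ es2)) => //.
  by rewrite map_rcons Ec rev_cons map_rcons El R.
by rewrite flatten_rcons catA EF -catA.
Qed.

Lemma reaches_correct_broker beta : correct (PBroker beta) ->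
  (forall u, t < u -> c_pending (clt u chi) = Some m) ->
  exists u s E, c_seq (clt t chi) <= s /\
    ((s == 0) || evidence_covers f E s) /\
    x u = EvReceive (PClient chi) (PBroker beta)
      (MSubmission (ident chi, chi) m s (chi, StMessage m s) E).
Proof.
move=> cb P; have [T tT HT] : exists2 T, t < T & beta \in c_tried (clt T chi).
  have [H|H] := boolP (beta \in c_tried (clt t.+1 chi)); first by exists t.+1.
  apply: (@fair_leads (fun u => beta \notin c_tried (clt u chi)) _ (EvSubmit chi
      beta)) => //.
  - by move=> u tu nb; rewrite /= correct_chi P.
  - by move=> u _ _ _; case: (beta \in c_tried (clt u.+1 chi)); auto.
  - move=> u tu _ Eu; have A : actor (x u) = Some (PClient chi) by rewrite Eu.
    case: (client_act correct_chi A) => -> _; rewrite Eu /= /client_submit P //=.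
    by rewrite !inE eqxx.
have [|u [s [E [tu le S]]]] := client_submitted correct_chi broadcast_t tT _ HT.
  by move=> u /andP[tu _]; apply: P.
have [v _ Ev] := exec_reliable exec correct_chi cb S.
exists v, s, E; split=> //; split=> //.
by have [->//|s0] := posnP s; rewrite (exec_covered exec correct_chi S s0) orbT.
Qed.

(* The previous message of the client, distinct from m, has been completed before
   the new broadcast: its number then bounds from below every later record. *)
Lemma recorded_number_current p v kk es1 q k E1 ess1 e1 :
  correct (PServer p) -> delivers_key p kk v ->
  mroot MT (map Some es1) = kk.1.1 -> (ident chi, k, m) \in es1 ->
  c_seq (clt t chi) <= k ->
  [seq mroot MT (map Some es) | es <- ess1] = [seq kk.1.1 | kk <- delivered_keys (srv
      v p)] ->
  E1 = flatten ess1 ++ e1 ->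
  record_all (fun=> None) E1 (ident chi) = Some (q, m) ->
  (exists w, commits chi q m w) -> c_seq (clt t chi) <= q.
Proof.
move=> cp D R Hk le Er EE Hq [w [Pw Sw]]; rewrite leqNgt; apply/negP => lt.
have [idle notlast] := broadcast_idle.
have wt : w < t.
  rewrite ltnNge; apply/negP=> tw; move: lt; rewrite -Sw ltnNge.
  by rewrite (client_seq_mono correct_chi (leqW tw)).
(* A client that signed at [w] had broadcast something, so a last message exists. *)
case Elast: (c_last (clt t chi)) notlast => [m2|] ne; last first.
  have := client_last_None correct_chi wt Elast.
  by rewrite (client_last correct_chi Pw).
have [t1 [t1t P1 S1 N1 [b [r [k2 [pf [n [W [Ex C U M]]]]]]]]] :=
  client_previous correct_chi idle Elast.
have [tb [beta [tbt1 Eb Nb Pb Ub]]] := client_period correct_chi P1.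
have /andP[lek2 _] := Ub _ _ U.
(* The certificate of the previous message comes from a batch completed at [p2] before [t1], whereas
   [kk] is delivered after an entry signed since [t]. The former batch thus precedes [kk], and its
   record for the client bounds [q] from below. *)
have k2q : k2 <= q.
  have [p2 [u2 [kk2 [pool [es2 [es3 [ess2 [cp2 u2t1 [Epool _ R2] El2 Hr2]]]]]]]] :=
    completion_log Ex C M.
  have [v2 D2] := delivers_key_agreement cp cp2 D.
  have [p3 [u3 [cp3 u3v2 S3]]] := delivers_key_signer cp2 D2.
  have [w3 w3u3 C3] := witness_commits correct_chi cp3 S3 R Hk.
  have tw3 := commits_after correct_chi idle C3 le.
  have u2v2 : u2 <= v2.
    by apply: ltnW; apply: ltn_trans u2t1 (ltn_trans t1t (leq_ltn_trans tw3
        (ltn_trans w3u3 u3v2))).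
  have [s Es] := delivered_mono p2 u2v2.
  rewrite (delivered_keys_agree cp cp2 D D2) Es /delivered_keys Epool -catA cat_cons
      in Er.
  have [r1 [es4 [r2 [Eess Er1 Er2]]]] := map_eq_cat Er.
  have Er1' : r1 = ess2 by apply: roots_inj; rewrite Er1 El2.
  have Ees4 : es4 = es2 ++ es3 by apply: root_inj; rewrite R2 Er2.
  move: Hq; rewrite EE Eess Er1' Ees4 flatten_cat /= -!catA catA record_all_cat => Hq.
  have [k' [m' []]] := record_all_mono (es3 ++ flatten r2 ++ e1) Hr2.
  by rewrite Hq => -[<- _].
(* The signature at [w] fits nowhere: before [tb] its number would be below [k2], from [tb] to [t1]
   another message is pending, and from [t1] to [t] the client is idle. *)
have [wtb|tbw] := leqP w.+1 tb.
  by have := client_seq_lt correct_chi wtb Pw Nb; rewrite Sw ltnNge (leq_trans lek2).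
have [wt1|t1w] := leqP w.+1 t1.
  have := Pb w.+1; rewrite tbw wt1 Pw => /(_ isT) [Em].
  by apply: ne; rewrite Em.
by have := N1 w.+1; rewrite t1w wt Pw => /(_ isT).
Qed.

Lemma pending_broadcast_delivered beta : correct (PBroker beta) ->
  (forall u, t < u -> c_pending (clt u chi) = Some m) -> delivered.
Proof.
move=> cb P; have [idle _] := broadcast_idle.
have [u [s [E [le [cov Eu]]]]] := reaches_correct_broker cb P.
have [p _ cp] : exists2 p, p \in [set: Server] & correct (PServer p).
  by apply: correct_signer; rewrite cardsT card_server; lia.
have [v [kk [es [k [D R Hk sk]]]]] := submission_delivered cb cp Eu cov.
have [T HT] := delivered_completed cp D.
have [ess1 [es' [ess2 [K1 [K2 [El Ek E1 E2]]]]]] := completed_log HT.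
have Ees : es' = es by apply: root_inj; rewrite R.
subst es'; have [e1 [e2 Ee]] := mem_cat_cons Hk.
have Ef : flatten (ess1 ++ es :: ess2) =
    (flatten ess1 ++ e1) ++ (ident chi, k, m) :: (e2 ++ flatten ess2).
  by rewrite flatten_cat /= {1}Ee -!catA.
have lek := leq_trans le sk.
case F: (fresh (record_all (fun=> None) (flatten ess1 ++ e1) (ident chi)) k m).
  exact: (fresh_entry_delivered correct_chi idle cp El Ef F lek).
case Hq: (record_all _ _ _) F => [[q m']|//] /= F.
have [F1 [F2 [EF FF]]] := record_all_origin Hq.
have Ef' : flatten (ess1 ++ es :: ess2) =
    F1 ++ (ident chi, q, m') :: (F2 ++ (ident chi, k, m) :: (e2 ++ flatten ess2)).
  by rewrite Ef EF -catA.
have [w Cw] := log_commits correct_chi cp El Ef'.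
have later : c_seq (clt t chi) <= q -> delivered.
  move=> leq; have tw := commits_after correct_chi idle Cw leq.
  have Em : m' = m by case: Cw; rewrite P // => -[->].
  by subst m'; apply: (fresh_entry_delivered correct_chi idle cp El Ef' FF leq).
have [leq|lt] := leqP (c_seq (clt t chi)) q; first exact: later.
(* As [q < k], the entry can be refused only for repeating the recorded message. *)
have Em : m' = m.
  by move: F; rewrite (leq_trans lt lek) /= => /negbFE/eqP.
subst m'; apply: later.
have [v' _ [D' EK]] := completed_delivers Ek.
apply: (recorded_number_current cp D' R Hk lek _ erefl Hq); last by exists w.
by rewrite EK.
Qed.

End Broadcast.

End Protocol.

Theorem theorem5 (f : nat) (Server Broker : finType) (Client Msg : eqType)
    (MT : merkle (leaf Msg)) (ident : Client -> nat)
    (correct : process Server Broker Client -> bool)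
    (dir0 : process Server Broker Client -> nat -> option Client)
    (x : nat -> event Server Broker Client MT) :
  #|Server| = 3 * f + 1 ->
  #|[set p : Server | ~~ correct (PServer p)]| <= f ->
  (exists beta : Broker, correct (PBroker beta)) ->
  injective ident ->
  (forall a i chi, dir0 a i = Some chi -> ident chi = i) ->
  execution f ident correct dir0 x ->
  forall (chi : Client) (m : Msg) (t : nat),
    correct (PClient chi) ->
    client_broadcasts x chi m t ->
    exists (t' : nat) (p : Server),
      [/\ t < t', correct (PServer p)
        & server_delivers f ident dir0 x p chi m t'].
Proof.
move=> cardS cardF [beta cb] ident_inj dir0P exec chi m t cc [beta0 Eb].
have [P|] := classic (forall u, t < u ->
    c_pending (clients (conf f ident dir0 x u) chi) = Some m).
  exact: (pending_broadcast_delivered exec dir0P ident_inj cardS cardF cc Eb cb P).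
move=> nP; apply: NNPP => none; apply: nP => u tu; apply: NNPP => nPu.
exact/none/(completed_broadcast_delivered exec dir0P ident_inj cardS cardF cc Eb tu
    nPu).
Qed.
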